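(* Let $n,k,r$ be positive integers with $3\leq r\leq k-2\leq n-2$. If $H$ is an $n$-vertex $2$-connected $r$-uniform hypergraph with minimum degree \[\delta(H)\geq \binom{k-1}{r-1}+1,\] then $H$ contains a Berge cycle of length at least $\min\{2k,n\}$.
   Context: An $r$-uniform hypergraph is a family of $r$-element subsets (edges) of a finite vertex set; the degree of a vertex is the number of edges containing it and $\delta(H)$ is the minimum degree. A Berge cycle of length $\ell$ is a list $v_1,e_1,v_2,\ldots,v_\ell,e_\ell,v_1$ of $\ell$ distinct vertices and $\ell$ distinct edges with $\{v_i,v_{i+1}\}\subseteq e_i$ for all $i$ (indices mod $\ell$). The incidence bipartite graph $I_H$ has vertex classes $V(H)$ and $E(H)$, with $x\in V(H)$ adjacent to $y\in E(H)$ iff $x\in y$. $H$ is $k$-connected if $I_H$ is a $k$-connected graph. *)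

(* Defs.v *)
From mathcomp Require Import all_boot.

Set Implicit Arguments.
Unset Strict Implicit.
Unset Printing Implicit Defensive.

(* A hypergraph on the vertex set T is given by its edge family
   H : {set {set T}}. *)

Definition uniform (T : finType) (r : nat) (H : {set {set T}}) : bool :=
  [forall e in H, #|e| == r].

Definition degree (T : finType) (H : {set {set T}}) (v : T) : nat :=
  #|[set e in H | v \in e]|.

(* Every degree is at most #|H|, so the default value #|H| does not alter the
   minimum as soon as T is nonempty. *)
Definition min_degree (T : finType) (H : {set {set T}}) : nat :=
  \big[minn/#|H|]_(v : T) degree H v.

Lemma degree_le_card (T : finType) (H : {set {set T}}) (v : T) :
  degree H v <= #|H|.
Proof. by apply/subset_leq_card/subsetP => e; rewrite inE => /andP[]. Qed.

Lemma leq_min_degree (T : finType) (H : {set {set T}}) (d : nat) (v0 : T) :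
  (d <= min_degree H) = [forall v, d <= degree H v].
Proof.
apply/idP/forallP => [le_d v | le_d].
  move: le_d (mem_index_enum v); rewrite /min_degree.
  elim: (index_enum T) => // u s IHs; rewrite big_cons leq_min inE.
  by case/andP=> le_u /IHs le_s /predU1P[-> // | /le_s].
rewrite /min_degree; apply: (big_ind (fun m => d <= m)) => //.
- exact: leq_trans (le_d v0) (degree_le_card H v0).
- by move=> m1 m2 le1 le2; rewrite leq_min le1.
Qed.

(* In a Berge cycle of length l the indices are taken modulo l: ordS i is the
   cyclic successor of i in 'I_l. *)
Definition berge_cycle (T : finType) (H : {set {set T}}) (l : nat)
    (v : 'I_l -> T) (e : 'I_l -> {set T}) : Prop :=
  [/\ injective v, injective e, forall i, e i \in H
    & forall i, [set v i; v (ordS i)] \subset e i].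

Definition incidence_graph (T : finType) (H : {set {set T}}) :
    rel (T + {e : {set T} | e \in H}) :=
  fun a b => match a, b with
  | inl x, inr e | inr e, inl x => x \in val e
  | _, _ => false
  end.

(* The graph with adjacency relation g minus the vertex set S. *)
Definition delete (U : finType) (g : rel U) (S : {set U}) : rel U :=
  [rel x y | [&& x \notin S, y \notin S & g x y]].

Definition k_connected_graph (k : nat) (U : finType) (g : rel U) : bool :=
  (k < #|U|) &&
  [forall S : {set U}, (#|S| < k) ==>
    [forall x in ~: S, forall y in ~: S, connect (delete g S) x y]].

Definition k_connected (k : nat) (T : finType) (H : {set {set T}}) : bool :=
  k_connected_graph k (@incidence_graph T H).

(* Main.v *)
Require Import Defs.
From mathcomp Require Import all_boot zify.

Set Implicit Arguments.
Unset Strict Implicit.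
Unset Printing Implicit Defensive.

(** Work with the longest cycles of the incidence graph and, among them, with
    lollipops: a longest cycle [a :: c] and a path [t] leaving it at [a] and ending at
    a vertex [y]; the length of the tail [t] is made maximal.  Suppose that every
    cycle has fewer than [min (2 * k) n] vertices.  Exchanging arcs bounds the places of the cycle to
    which [y] can be linked, while the degree of [y] forces many links.  Without a
    proper tail all edges at a vertex off the cycle lie close to the cycle, and the
    count leaves only configurations that admit a longer cycle.  A tail with fewer
    than [k] vertices leaves one extremal configuration, destroyed by rotating the
    tail.  A longer tail has no other link to the cycle; by 2-connectedness two
    disjoint paths join its part spanned by the edges at [y] to the cycle, and a
    path inside that part, together with these two paths and the longer arc of the
    cycle, gives a cycle that is too long. *)

(** * Cycles and lollipops in a graph *)

(** The degree bound reflects a trade between edges and places. Let [y] be off a longest cycle, or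
    the end of a tail. If the edges at [y] off the cycle spread over [h] vertices, there are at most
    ['C(h, r - 1)] of them, and each of these vertices blocks two places; a cycle edge at [y] blocks
    one place, and an edge with a private cycle vertex two, yet each of them adds a single edge.
    Fewer than [2 * k] places exist, so [h <= k - 1]; the growth of the binomial leaves [h = k - 1]
    as the only way to reach the degree, up to a few cases with [k <= 6], and the summand 1 then
    demands a cycle edge at [y]. Exchanges need hyperedges that are distinct and not yet used, which
    is why they are made in the incidence graph. A tail edge at the end of the tail is already used:
    it obeys the position bounds only once a rotation has freed it, and this is the main difficulty
    for short tails. When tails are too long to have links, the places of the cycle no longer
    matter, and the vertices and edges of a path are counted instead. *)

Lemma size_cons (T : Type) (x : T) s : size (x :: s) = (size s).+1.
Proof. by []. Qed.

Ltac perm_by_count :=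
  apply/permP => ?; rewrite /= ?count_cat /= ?count_cat /= ?count_rev /= ?count_cat /=;
  repeat match goal with |- context [nat_of_bool ?b] => move: (nat_of_bool b) => ? end;
  clear; lia.

Lemma split_last (U : eqType) (C : pred U) (s : seq U) : has C s ->
  exists p1 u p2, [/\ s = p1 ++ u :: p2, C u & ~~ has C p2].
Proof.
elim/last_ind: s => [//|s u IHs]; rewrite has_rcons.
have [uC _|uC /= /IHs[p1 [v [p2 [-> vC nC]]]]] := boolP (C u).
  by exists s, u, [::]; rewrite cats1.
by exists p1, v, (rcons p2 u); rewrite rcons_cat has_rcons (negbTE uC).
Qed.

Section Graph.

Variables (U : eqType) (g : rel U).
Hypothesis gC : symmetric g.

(** The empty list, and the two ends of an edge, count as cycles, so that a longest one exists
    trivially; arguments that need a genuine cycle assume a size above 2 or 4. *)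
Definition ucyc (s : seq U) := cycle g s && uniq s.

Lemma path_revE x p : path g (last x p) (rev (belast x p)) = path g x p.
Proof. by rewrite rev_path; apply: eq_path => a b; rewrite gC. Qed.

Lemma path_rcons_rev x p z : path g x (rcons p z) = path g z (rcons (rev p) x).
Proof.
by rewrite -path_revE last_rcons belast_rcons rev_cons.
Qed.

Lemma ucyc_rot n s : ucyc (rot n s) = ucyc s.
Proof. by rewrite /ucyc rot_cycle rot_uniq. Qed.

Lemma ucyc_rotE s1 s2 : ucyc (s1 ++ s2) = ucyc (s2 ++ s1).
Proof. by rewrite -rot_size_cat ucyc_rot. Qed.

Lemma ucyc_rev x s : ucyc (x :: rev s) = ucyc (x :: s).
Proof.
by rewrite /ucyc /= -path_rcons_rev mem_rev rev_uniq.
Qed.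

Lemma cycle_cat_cons x p z q :
  cycle g (x :: p ++ z :: q) = path g x (rcons p z) && path g z (rcons q x).
Proof. by rewrite /= rcons_cat rcons_cons -cat_rcons cat_path last_rcons. Qed.

(* Every bound on the links of a longest cycle comes from this exchange: replacing
   the arc [m] by [w] gives another cycle. *)
Lemma ear N x m z rest w :
    (forall s, ucyc s -> size s <= N) ->
    size (x :: m ++ z :: rest) = N -> ucyc (x :: m ++ z :: rest) ->
    path g x (rcons w z) -> uniq w ->
    (forall u, u \in w -> u \notin x :: z :: rest) ->
  size w <= size m.
Proof.
move=> maxN szN /andP[]; rewrite cycle_cat_cons => /andP[_ pz] us pw uw dw.
have /maxN : ucyc (x :: w ++ z :: rest).
  rewrite /ucyc cycle_cat_cons pw pz /= mem_cat negb_or cat_uniq uw.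
  move: us; rewrite cons_uniq cat_uniq mem_cat negb_or => /and3P[/andP[_ ->] _ /andP[_ ->]].
  rewrite !andbT; apply/andP; split.
    by apply/negP => /dw; rewrite inE eqxx.
  by apply/hasPn => u uz; apply/negP => /dw; rewrite inE uz orbT.
by rewrite -szN /= !size_cat; lia.
Qed.

(** The tail does not contain its attachment [a], so [t] may be empty and [last a t] is its end in
    all cases. *)
Definition lolli (a : U) (c t : seq U) :=
  [&& ucyc (a :: c), path g a t, uniq t & all [predC a :: c] t].

Lemma lolli_notin a c t u : lolli a c t -> u \in t -> u \notin a :: c.
Proof. by case/and4P=> _ _ _ /allP h /h. Qed.

Lemma lolli_rev a c t : lolli a c t -> lolli a (rev c) t.
Proof.
rewrite /lolli ucyc_rev => /and4P[-> -> -> /allP h]; apply/allP => u /h /=.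
by rewrite !inE mem_rev.
Qed.

(** The tail followed by [m] takes the place of the arc [c1] between [a] and [b]. *)
Lemma tail_link_left N a c t c1 b c2 m :
    (forall s, ucyc s -> size s <= N) -> size (a :: c) = N -> lolli a c t ->
    c = c1 ++ b :: c2 -> path g (last a t) (rcons m b) -> uniq m ->
    (forall u, u \in m -> u \notin a :: c ++ t) ->
  size t + size m <= size c1.
Proof.
move=> maxN szN lol Ec pm um dm; rewrite -size_cat.
have /and4P[cy pt ut /allP dt] := lol; rewrite Ec in szN cy.
have dsub u : u \in a :: b :: c2 -> u \in a :: c.
  by rewrite Ec !inE mem_cat inE => /or3P[] ->; rewrite ?orbT.
apply: (ear maxN szN cy).
- by rewrite rcons_cat cat_path pt.
- rewrite cat_uniq ut um andbT; apply/hasPn => u /dm.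
  by rewrite inE mem_cat !negb_or => /and3P[].
- move=> u; rewrite mem_cat => /orP[/dt | /dm] h; apply/negP => /dsub.
    exact/negP.
  by apply/negP; move: h; rewrite !inE mem_cat !negb_or andbA => /andP[].
Qed.

Lemma tail_link N a c t c1 b c2 m :
    (forall s, ucyc s -> size s <= N) -> size (a :: c) = N -> lolli a c t ->
    c = c1 ++ b :: c2 -> path g (last a t) (rcons m b) -> uniq m ->
    (forall u, u \in m -> u \notin a :: c ++ t) ->
  size t + size m <= size c1 /\ size t + size m <= size c2.
Proof.
move=> maxN szN lol Ec pm um dm; split; first exact: (tail_link_left maxN szN lol Ec pm um dm).
(* The other arc becomes the first one when the cycle is read backwards. *)
rewrite -[size c2]size_rev.
apply: (@tail_link_left N a (rev c) t (rev c2) b (rev c1) m) => //.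
- by rewrite /= size_rev.
- exact: lolli_rev.
- by rewrite Ec rev_cat rev_cons cat_rcons.
- by move=> u /dm; rewrite !inE !mem_cat mem_rev.
Qed.

Lemma split_index (s : seq U) u v : u \in s -> v \in s -> index u s < index v s ->
  exists s1 s2 s3, [/\ s = s1 ++ u :: s2 ++ v :: s3, size s1 = index u s
                     & size s2 = (index v s - index u s).-1].
Proof.
move=> us vs lt_uv; have ltv : index v s < size s by rewrite index_mem.
have ltu : index u s < size s by rewrite index_mem.
exists (take (index u s) s), (take (index v s - index u s).-1 (drop (index u s).+1 s)),
  (drop (index v s).+1 s).
have Es1 := drop_nth u ltu; rewrite nth_index // in Es1.
have Es2 := drop_nth v ltv; rewrite nth_index // in Es2.
split.
- rewrite -[LHS](cat_take_drop (index u s)) Es1; congr (_ ++ _ :: _).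
  rewrite -[LHS](cat_take_drop (index v s - index u s).-1); congr (_ ++ _).
  by rewrite drop_drop -Es2; congr drop; lia.
- by rewrite size_take ltu.
- by rewrite size_takel ?size_drop; lia.
Qed.

Lemma index_eq (s : seq U) u v : u \in s -> v \in s -> index u s = index v s -> u = v.
Proof. by move=> us vs Ei; rewrite -(nth_index u us) Ei nth_index. Qed.

Lemma split_index1 (s : seq U) u : u \in s ->
  exists s1 s2, [/\ s = s1 ++ u :: s2, size s1 = index u s
                 & size s2 = (size s - index u s).-1].
Proof.
move=> us; have ltu : index u s < size s by rewrite index_mem.
exists (take (index u s) s), (drop (index u s).+1 s); split.
- by rewrite -[LHS](cat_take_drop (index u s)) (drop_nth u ltu) nth_index.
- by rewrite size_take ltu.
- by rewrite size_drop; lia.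
Qed.

Lemma tail_link_index N a c t b m :
    (forall s, ucyc s -> size s <= N) -> size (a :: c) = N -> lolli a c t ->
    b \in c -> path g (last a t) (rcons m b) -> uniq m ->
    (forall u, u \in m -> u \notin a :: c ++ t) ->
  size t + size m <= index b c /\ size t + size m + index b c < size c.
Proof.
move=> maxN szN lol bc pm um dm.
have [c1 [c2 [Ec s1 s2]]] := split_index1 bc.
have [] := tail_link maxN szN lol Ec pm um dm.
by rewrite s1 s2; have := bc; rewrite -index_mem; lia.
Qed.

Lemma chord_index N a c u v w :
    (forall s, ucyc s -> size s <= N) -> size (a :: c) = N -> ucyc (a :: c) ->
    u \in c -> v \in c -> index u c < index v c ->
    path g u (rcons w v) -> uniq w -> (forall z, z \in w -> z \notin a :: c) ->
  size w + index u c < index v c.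
Proof.
move=> maxN szN cy uc vc lt_uv pw uw dw.
have [c1 [c2 [c3 [Ec _ s2]]]] := split_index uc vc lt_uv.
have Erot : (a :: c1) ++ u :: c2 ++ v :: c3 = a :: c by rewrite Ec.
have Ecy : ucyc (u :: c2 ++ v :: (c3 ++ a :: c1)).
  by move: cy; rewrite -Erot ucyc_rotE cat_cons -catA cat_cons.
have := @ear N u c2 v (c3 ++ a :: c1) w maxN _ Ecy pw uw.
rewrite s2 => h; suff : size w <= (index v c - index u c).-1 by lia.
apply: h.
  by rewrite -szN -Erot !(size_cat, size_cons) /=; lia.
move=> z /dw; apply: contra; rewrite -Erot !(inE, mem_cat).
by case/or4P=> [|->|->|/orP[]->]; rewrite ?orbT // => ->; rewrite ?orbT.
Qed.

Lemma perm_middle (s1 s2 : seq U) e : perm_eq (s1 ++ e :: s2) (e :: s1 ++ s2).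
Proof. by rewrite -cat_rcons -cat1s catA perm_cat2r perm_rcons. Qed.

(** Posa rotation of the tail: [f] joins the node before [e] to the end, and the part after [e] is
    traversed backwards. The choice [f = e] is possible because the rotation drops [e]. *)
Lemma lolli_rotate a c s1 e t2 f :
    lolli a c (s1 ++ e :: t2) -> t2 <> [::] ->
    g (last a s1) f -> g f (last a t2) -> f = e \/ f \notin a :: c ++ s1 ++ e :: t2 ->
  lolli a c (s1 ++ f :: rev t2).
Proof.
case: t2 => // y t2 /and4P[cy pt ut dt] _ gqf gfl off; apply/and4P; split=> //.
- move: pt; rewrite !cat_path /= => /and4P[-> _ _ py] /=.
  by rewrite gqf rev_cons path_rcons_rev revK rcons_path py gC.
- have -> : uniq (s1 ++ f :: rev (y :: t2)) = uniq (f :: s1 ++ y :: t2).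
    apply: perm_uniq; rewrite (perm_trans (perm_middle _ _ _)) // perm_cons.
    by rewrite perm_cat2l perm_rev.
  move: ut; rewrite (perm_uniq (perm_middle _ _ _)) !cons_uniq => /andP[ne ->].
  rewrite andbT; case: off => [->//|].
  by rewrite inE !mem_cat inE !negb_or => /and5P[_ _ -> _ ->].
- move: dt; rewrite !all_cat => /andP[-> /andP[de dy]].
  have {}dy : all [predC a :: c] (rev (y :: t2)) by rewrite all_rev.
  rewrite andTb; apply/andP; split; last exact: dy.
  case: off => [->//|].
  by rewrite -cat_cons mem_cat negb_or => /andP[].
Qed.

Lemma lolli_extend a c t f w :
    lolli a c t -> g (last a t) f -> g f w -> f != w ->
    f \notin a :: c ++ t -> w \notin a :: c ++ t ->
  lolli a c (t ++ [:: f; w]).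
Proof.
case/and4P=> cy pt ut dt gf gw fw; rewrite -!cat_cons !mem_cat !negb_or.
move=> /andP[fc ft] /andP[wc wt]; apply/and4P; split=> //.
- by rewrite cat_path pt /= gf gw.
- by rewrite cat_uniq ut /= !inE fw orbF negb_or ft wt.
- apply/allP => u; rewrite mem_cat !inE => /or3P[/(allP dt) //|/eqP->|/eqP->]; rewrite negb_or; [exact: fc|exact: wc].
Qed.

Lemma ucyc_from s x : ucyc s -> x \in s -> exists2 c, ucyc (x :: c) & perm_eq (x :: c) s.
Proof.
move=> us /rot_to[n c Ec]; exists c; first by rewrite -Ec ucyc_rot.
by rewrite -Ec perm_rot.
Qed.

Lemma ucyc_next s x : ucyc s -> x \in s ->
  exists c, [/\ ucyc (x :: c), perm_eq (x :: c) s & next (x :: c) =1 next s].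
Proof.
move=> cy /rot_to[n c Ec]; exists c; rewrite -Ec ucyc_rot perm_rot; split=> // u.
by case/andP: cy => _ us; rewrite next_rot.
Qed.

Lemma ear_next N s x w :
    (forall s, ucyc s -> size s <= N) -> size s = N -> ucyc s -> x \in s -> next s x != x ->
    path g x (rcons w (next s x)) -> uniq w -> (forall u, u \in w -> u \notin s) ->
  w = [::].
Proof.
move=> maxN szN cy xs; have [c [cx pc <-]] := ucyc_next cy xs.
case: c cx pc => [|z c] cx pc; first by rewrite /= !eqxx.
rewrite /= eqxx => _ pw uw dw; apply: size0nil; apply/eqP; rewrite -leqn0.
apply: (@ear N x [::] z c w) => //; first by rewrite -szN -(perm_size pc).
by move=> u /dw; rewrite -(perm_mem pc).
Qed.

Lemma ear_next2 N s x w :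
    (forall s, ucyc s -> size s <= N) -> size s = N -> ucyc s -> x \in s -> 2 < size s ->
    path g x (rcons w (next s (next s x))) -> uniq w -> (forall u, u \in w -> u \notin s) ->
  size w <= 1.
Proof.
move=> maxN szN cy xs; have [c [cx pc En]] := ucyc_next cy xs.
rewrite -!En -(perm_size pc); case: c cx pc {En} => [|e [|z c]] cx pc // _.
have ex : x != e by case/andP: cx => _ /= /andP[]; rewrite inE negb_or => /andP[].
rewrite /= eqxx eq_sym (negPf ex) eqxx => pw uw dw.
apply: (@ear N x [:: e] z c w) => //; first by rewrite -szN -(perm_size pc).
move=> u /dw; rewrite -(perm_mem pc); apply: contra; rewrite !inE.
by case/or3P=> ->; rewrite ?orbT.
Qed.

Lemma next2_neq s x : ucyc s -> x \in s -> 2 < size s -> next s (next s x) != x.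
Proof.
move=> cy xs; have [c [cx pc En]] := ucyc_next cy xs.
rewrite -!En -(perm_size pc); case: c cx pc {En} => [|e [|z c]] cx pc // _.
case/andP: cx => _ /= /andP[]; rewrite !inE !negb_or => /and3P[xe xz _] _.
by rewrite eqxx [e == x]eq_sym (negPf xe) eqxx eq_sym.
Qed.

Lemma next4_neq s x : ucyc s -> x \in s -> 4 < size s ->
  next s (next s (next s (next s x))) != x.
Proof.
move=> cy xs; have [c [cx pc En]] := ucyc_next cy xs.
rewrite -!En -(perm_size pc); case: c cx pc {En} => [|e [|z [|e' [|z' c]]]] cx pc // _.
case/andP: cx => _; rewrite /= !inE !negb_or => /andP[/and5P[xe xz xe' xz' _]].
case/and3P=> /and4P[ez ee' _ _] /and3P[ze' _ _] _.
have F (u v : U) : u != v -> (v == u) = false by rewrite eq_sym => /negPf.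
by rewrite eqxx (F _ _ xe) eqxx (F _ _ xz) (F _ _ ez) eqxx (F _ _ xe') (F _ _ ee') (F _ _ ze')
  eqxx eq_sym.
Qed.

Lemma next_edge s x : ucyc s -> x \in s -> g x (next s x).
Proof. by case/andP=> cy _ xs; apply: next_cycle. Qed.

Lemma next_inj s : ucyc s -> injective (next s).
Proof. by case/andP=> _ us; apply: can_inj (prev_next us). Qed.

Lemma next_cat (s1 s2 : seq U) p q : uniq (s1 ++ p :: q :: s2) -> next (s1 ++ p :: q :: s2) p = q.
Proof.
move=> us; rewrite -(next_rot (size s1) us) rot_size_cat /= eqxx.
by [].
Qed.

Lemma next_last (x : U) s1 : uniq (x :: s1) -> next (x :: s1) (last x s1) = x.
Proof.
move=> us; case/lastP: s1 us => [|s1 z] us; first by rewrite /= eqxx.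
rewrite last_rcons -(next_rot (size s1).+1 us).
have -> : rot (size s1).+1 (x :: rcons s1 z) = z :: x :: s1.
  by rewrite -rcons_cons -cats1 -[(size s1).+1]/(size (x :: s1)) rot_size_cat.
by rewrite /= eqxx.
Qed.

(** Displays five consecutive nodes at the head of the list, so that a local exchange becomes an
    operation on lists; successors do not change under the rotation. *)
Lemma ucyc_spine s x : ucyc s -> x \in s -> 4 < size s ->
  exists rest, let l := [:: x, next s x, next s (next s x), next s (next s (next s x)),
      next s (next s (next s (next s x))) & rest] in
    [/\ ucyc l, perm_eq l s & forall u, next l u = next s u].
Proof.
move=> cy xs; have [c [cx pc En]] := ucyc_next cy xs.
rewrite -(perm_size pc) -!En; case: c cx pc En => [|e1 [|z [|e2 [|b c]]]] cx pc En // _.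
have /andP[_ us] := cx; exists c.
have -> : next [:: x, e1, z, e2, b & c] x = e1 by rewrite (@next_cat [::]).
have -> : next [:: x, e1, z, e2, b & c] e1 = z by rewrite (@next_cat [:: x]).
have -> : next [:: x, e1, z, e2, b & c] z = e2 by rewrite (@next_cat [:: x; e1]).
by have -> : next [:: x, e1, z, e2, b & c] e2 = b by rewrite (@next_cat [:: x; e1; z]).
Qed.

(** Distinctness of the nodes of a rearranged cycle is reduced to counting: it suffices to name the
    nodes [l'] that the surgery drops. *)
Lemma uniq_insert (l m A : seq U) : uniq l -> uniq m -> (forall u, u \in m -> u \notin l) ->
  (exists l', perm_eq (A ++ l') (m ++ l)) -> uniq A.
Proof.
move=> ul um dm [l' /perm_uniq]; rewrite [RHS]cat_uniq um ul andbT => E.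
have : uniq (A ++ l').
  by rewrite E; apply/hasPn => u ul'; apply/negP => /dm; rewrite ul'.
by rewrite cat_uniq => /andP[].
Qed.

Lemma ucyc_replace a e1 x e2 b rest f1 y f2 : ucyc [:: a, e1, x, e2, b & rest] ->
    path g a [:: f1; y; f2; b] -> uniq [:: f1; y; f2] ->
    (forall u, u \in [:: f1; y; f2] -> u \notin [:: a, e1, x, e2, b & rest]) ->
  ucyc [:: a, f1, y, f2, b & rest].
Proof.
case/andP=> cy us pw uw dw; apply/andP; split.
  by move: cy pw => /= /and5P[_ _ _ _ h] /and5P[-> -> -> -> _].
apply: (uniq_insert us uw dw); exists [:: e1; x; e2].
perm_by_count.
Qed.

(** The chord from [x] to [e] reverses the segment [b :: r1], and [f, y, f'] bridges the gap that
    arises. Only [e2] is dropped and three nodes come in, so the cycle grows by two. The node after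
    [e] is [head a r2], since an empty [r2] means that the cycle closes at [a]. *)
Lemma ucyc_cross1 a e1 x e2 b r1 e r2 f y f' :
    ucyc [:: a, e1, x, e2, b & r1 ++ e :: r2] -> g x e ->
    path g b [:: f; y; f'; head a r2] -> uniq [:: f; y; f'] ->
    (forall u, u \in [:: f; y; f'] -> u \notin [:: a, e1, x, e2, b & r1 ++ e :: r2]) ->
  ucyc (x :: e :: rev (b :: r1) ++ [:: f, y, f' & r2 ++ [:: a; e1]]).
Proof.
case/andP=> cy us gxe pw uw dw; apply/andP; split; last first.
  apply: (uniq_insert us uw dw); exists [:: e2].
  perm_by_count.
move: cy; rewrite /= rcons_cat cat_path /= => /and5P[ga1 g1x gx2 g2b].
case/and3P=> pb be pe.
rewrite rcons_cat /= gxe cat_path /= rev_cons path_rcons_rev revK.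
rewrite rcons_path be pb /= last_rcons.
move: pw => /= /and5P[-> -> -> gq _] /=.
rewrite rcons_cat cat_path /= ga1 g1x !andbT.
move: pe gq; case: r2 {us dw} => [|q r2] /=; first by rewrite andbT => _ ->.
by rewrite rcons_path => /and3P[_ -> ->] ->.
Qed.

(** Mirror image of [ucyc_cross1]: the bridge joins [a] to the node before [e], and [e1] is
    dropped. *)
Lemma ucyc_cross2 a e1 x e2 b r1 e r2 f y f' :
    ucyc [:: a, e1, x, e2, b & r1 ++ e :: r2] -> g x e ->
    path g a [:: f; y; f'; last b r1] -> uniq [:: f; y; f'] ->
    (forall u, u \in [:: f; y; f'] -> u \notin [:: a, e1, x, e2, b & r1 ++ e :: r2]) ->
  ucyc (x :: e :: r2 ++ [:: a, f, y, f' & rev (b :: r1) ++ [:: e2]]).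
Proof.
case/andP=> cy us gxe pw uw dw; apply/andP; split; last first.
  apply: (uniq_insert us uw dw); exists [:: e1].
  perm_by_count.
move: cy; rewrite /= rcons_cat cat_path /= => /and5P[ga1 g1x gx2 g2b].
case/and3P=> pb be pe.
rewrite rcons_cat /= gxe; move: pe; rewrite rcons_path => /andP[pe ge].
rewrite cat_path pe /= ge /=.
move: pw => /= /and5P[-> -> -> gq _] /=.
have -> : rev (b :: r1) ++ [:: e2] = rcons (rev (b :: r1)) e2 by rewrite cats1.
rewrite !rcons_path last_rcons [g e2 x]gC gx2 andbT.
have : path g (last b r1) (rev (belast b r1)) by rewrite path_revE.
case/lastP: r1 gq {pb us dw be} => [|r1 p] /=; first by rewrite gC => -> _; rewrite gC g2b.
rewrite -rcons_cons rev_rcons last_rcons belast_rcons [path g f' _]/= => -> pr.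
by rewrite andTb pr /= rev_cons last_rcons gC g2b.
Qed.

End Graph.

(** * Binomial estimates *)

Lemma bin2_double m : 2 * 'C(m, 2) = m * m.-1.
Proof. by elim: m => // m IHm; rewrite binS bin1 mulnDr IHm; case: m {IHm} => // m; nia. Qed.

Lemma bin2_le_bin m j : 2 <= j -> j <= m - 2 -> 'C(m, 2) <= 'C(m, j).
Proof.
elim: m j => [|m IHm] j j2 jm; first by lia.
have [->//|jn2] := eqVneq j 2.
have [Ej|jnm] := eqVneq j m.-1.
  by rewrite -(@bin_sub m.+1 j) ?Ej //; [have -> : m.+1 - m.-1 = 2 by lia | lia].
case: j j2 jm jn2 jnm => // j j2 jm jn2 jnm; rewrite [X in _ <= X]binS.
have h1 : 'C(m, 2) <= 'C(m, j.+1) by apply: IHm; lia.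
have h2 : 'C(m, 2) <= 'C(m, j) by apply: IHm; lia.
by have := bin2_double m; rewrite binS bin1; nia.
Qed.

Lemma leq_bin_self n i : 0 < i -> i < n -> n <= 'C(n, i).
Proof.
elim: n i => // n IHn [|i] // _ lt_in; rewrite binS.
have [Ei|ni] := eqVneq i.+1 n; first by rewrite -Ei binn binSn; lia.
have := IHn i.+1 isT; have : 0 < 'C(n, i) by rewrite bin_gt0; lia.
lia.
Qed.

(* Moving [h] vertices away from the extremal value [m] costs more edges than
   the two cycle edges per vertex that it frees. *)
Lemma bin_gap2 m j h : 2 <= j -> j <= m - 2 -> 2 <= h -> h < m ->
  'C(h, j) + 2 * m + 1 <= 'C(m, j) + 2 * h.
Proof.
move=> j2 jm h2 hm; have [jh|hj] := leqP j h.
  have [i Em] : exists i, m = h + i.+1 by exists (m - h.+1); lia.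
  elim: i h h2 hm jh Em => [|i IHi] h h2 hm jh Em.
    have {}Em : m = h.+1 by lia.
    subst m; case: j j2 jm jh => // j j2 jm jh; rewrite binS.
    by have := @leq_bin_self h j; lia.
  have := IHi h.+1; case: j j2 jm jh {IHi} => // j j2 jm jh; rewrite binS.
  by have := @leq_bin_self h j; lia.
rewrite bin_small //; have := bin2_le_bin j2 jm; have := bin2_double m; nia.
Qed.

(** For [j >= 3] the binomial grows fast enough to pay, besides two edges per freed vertex, one edge
    for each of the [h] remaining ones; [tail_deficit] spends these on tail edges. *)
Lemma bin_gap1 m j h : 3 <= j -> j <= m - 2 -> h < m ->
  'C(h, j) + 2 * m <= 'C(m, j) + h.
Proof.
move=> j3 jm hm; have [jh|hj] := leqP j.-1 h.
  have [i Em] : exists i, m = h + i.+1 by exists (m - h.+1); lia.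
  elim: i h hm jh Em => [|i IHi] h hm jh Em.
    have {}Em : m = h.+1 by lia.
    subst m; case: j j3 jm jh => // j j3 jm jh; rewrite binS.
    have := @bin2_le_bin h j; have := bin2_double h; nia.
  have := IHi h.+1; case: j j3 jm jh {IHi} => // j j3 jm jh; rewrite binS.
  have : 0 < 'C(h, j) by rewrite bin_gt0; lia.
  lia.
rewrite bin_small; last by lia.
have j2 : 2 <= j by lia.
have := bin2_le_bin j2 jm; have := bin2_double m; nia.
Qed.

(* [m = k - 1] and [j = r - 1]; a vertex off a longest cycle of [c] vertices has [D]
   edges on the cycle, and its other edges have [h] thick vertices and [s] thin edges. *)
Lemma cycle_count_cases m j h s D c :
    2 <= j -> j <= m - 2 -> c <= 2 * m + 1 -> 2 * h + 2 * s + D <= c ->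
    'C(m, j) + 1 <= 'C(h, j) + s + D -> (0 < h -> 2 <= 'C(h, j) + s) ->
    (h = 0 -> 3 * s + D <= c) ->
  [/\ h = m, s = 0, D = 1 & c = 2 * m + 1] \/ [/\ h = 0, m <= 5 & 'C(m, j) <= D].
Proof.
move=> j2 jm cm hc hd h0 s3; have C2 := bin2_le_bin j2 jm; have D2 := bin2_double m.
have [h2|h2] := ltnP h 2.
  have Ch : 'C(h, j) = 0 by rewrite bin_small //; lia.
  rewrite Ch in hd h0; right; case: h h2 hc {Ch} h0 s3 hd => [|[|//]] _ hc h0 s3 hd.
    have {}s3 := s3 erefl; have m5 : m <= 5 by nia.
    have [Em|Em] : m = 4 \/ m = 5 by lia.
      by subst m; split; lia.
    by subst m; split; lia.
  by have {}h0 := h0 isT; exfalso; nia.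
have [hm|mh] := ltnP h m; first by have := bin_gap2 j2 jm h2 hm; lia.
have Eh : h = m by lia.
by left; subst h; split; lia.
Qed.

(** Here [h] counts tail vertices together with thick ones. The tail makes it positive, so only the
    first outcome of [cycle_count_cases] survives. *)
Lemma tail_count_cases m j h s D :
    2 <= j -> j <= m - 2 -> 0 < h -> 2 * h + 2 * s + D <= 2 * m + 1 ->
    'C(m, j) + 1 <= 'C(h, j) + s + D -> 0 < 'C(h, j) + s ->
  [/\ h = m, s = 0 & D = 1].
Proof.
move=> j2 jm h1 hc hd h0; have C2 := bin2_le_bin j2 jm; have D2 := bin2_double m.
have [h2|h2] := ltnP h 2.
  have Ch : 'C(h, j) = 0 by rewrite bin_small //; lia.
  by rewrite Ch in hd h0; exfalso; nia.
have [hm|mh] := ltnP h m; first by have := bin_gap2 j2 jm h2 hm; lia.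
have Eh : h = m by lia.
by subst h; split; lia.
Qed.

(** When the counted edges at [y] avoid one of the [h] vertices, the binomial drops to
    ['C(h.-1, j)], and even [b] further edges do not restore the degree ['C(m, j) + 1]. *)
Lemma tail_deficit m j h s D b :
    3 <= j -> j <= m - 2 -> 0 < h -> 2 * h + 2 * s + D <= 2 * m + 1 -> b <= h ->
  'C(h.-1, j) + s + b + D <= 'C(m, j).
Proof.
move=> j3 jm h1 hc bh; have hm : h.-1 < m by lia.
by have := bin_gap1 j3 jm hm; lia.
Qed.

(** For [j = 2] the binomial is too flat for [bin_gap1]. With at most two further edges one
    exception remains, [m = 4], that is [k = 5]. *)
Lemma tail_deficit2 m h s D b :
    4 <= m -> 0 < h -> 2 * h + 2 * s + D <= 2 * m + 1 -> b <= 2 -> (h = 1 -> b <= 1) ->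
    'C(m, 2) + 1 <= 'C(h.-1, 2) + s + b + D ->
  [/\ m = 4, 5 <= D & b = 2 \/ h = 1].
Proof.
move=> m4 h1 hc b2 hb hd; have D2 := bin2_double m.
have [h3|h3] := ltnP h.-1 2; last first.
  have hm : h.-1 < m by lia.
  have m2 : 2 <= m - 2 by lia.
  by have := bin_gap2 (leqnn 2) m2 h3 hm; lia.
rewrite (@bin_small h.-1) // in hd; have m6 : m <= 5 by nia.
have [Eh|Eh] : h = 1 \/ h = 2 by lia.
  subst h; have {}hb := hb erefl; have [Em|Em] : m = 4 \/ m = 5 by lia.
    by subst m; split; lia.
  by subst m; exfalso; lia.
have [Em|Em] : m = 4 \/ m = 5 by lia.
  by subst h m; split; lia.
by subst h m; exfalso; lia.
Qed.

Lemma leq_bin_mid k r : 3 < r -> r <= k - 2 -> k <= 'C(k - 2, r - 2).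
Proof.
move=> r4 rk; apply: leq_trans (@bin2_le_bin (k - 2) (r - 2) _ _); try lia.
have [n En] : exists n, k = n + 6 by exists (k - 6); lia.
have D2 := bin2_double (k - 2); move: D2; clear r4 rk.
have -> : k - 2 = n + 4 by lia.
have -> : (n + 4).-1 = n + 3 by lia.
by rewrite {}En; move: 'C(_, _) => x; nia.
Qed.

(** Here [m] counts the mates of the end [y], [o] its edges off the lollipop and [b] its tail edges;
    [v] and [e] count the vertices and edges of a path through the tail, [i1] and [i0] tell whether
    its ends are vertices, [rv] whether the last reach node before the gap is one, and [na] whether
    the first reach node differs from [a]. The length bound on the path and the degree together
    leave [m] almost no freedom. *)
Lemma path_count_cases k r m b o v e i1 i0 rv na : 2 < r -> r <= k - 2 ->
    'C(k - 1, r - 1) + 1 <= o + b -> o <= 'C(m, r - 1) -> m < v -> b + rv <= e ->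
    v + 1 = e + i1 + i0 -> v + e + na <= 2 * k - 1 -> i1 <= 1 -> i0 <= 1 -> (r = 3 -> na = 0 -> i0 = 1) ->
  [/\ na = 0, i0 = 1, i1 = 1, v = k &
    m = k - 1 \/ [/\ r = 3, m = k - 2, b = k - 1, rv = 0 & o = 'C(m, r - 1)]] \/
  [/\ r = 3 /\ i1 + i0 = 1, m = k - 2, b = k - 1, v = k - 1 & o = 'C(m, r - 1)].
Proof.
move=> r3 rk hd ho hv he hve hs i1le i0le hr.
have [mk|mk] := leqP (k - 1) m; first by left; split; try left; lia.
have h1 : 'C(m, r - 1) <= 'C(k - 2, r - 1) by apply: leq_bin2l; lia.
have h2 : 'C(k - 1, r - 1) = 'C(k - 2, r - 1) + 'C(k - 2, r - 2).
  have -> : k - 1 = (k - 2).+1 by lia.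
  have -> : r - 1 = (r - 2).+1 by lia.
  by rewrite binS.
have [r4|r4] := ltnP 3 r.
  have h3 := leq_bin_mid r4 rk; exfalso.
  move: h3 hd ho h1 h2 he hs hve r4 rk i1le i0le; clear.
  by move: 'C(_, _) 'C(_, _) 'C(_, _) 'C(_, _) => x1 x2 x3 x4; lia.
have Er : r = 3 by lia.
subst r; change (3 - 1) with 2 in *; change (3 - 2) with 1 in *; rewrite bin1 in h2.
have [Em|mk3] := eqVneq m (k - 2).
  have hr' := hr erefl; subst m.
  have [bk|kb] := leqP k b; first by exfalso; lia.
  have Ev : v = k \/ v = k - 1 by lia.
  by case: Ev => Ev; [left; split; try right; try split; lia | right; split; try split; lia].
have h3 : 'C(m, 2) <= 'C(k - 3, 2) by apply: leq_bin2l; lia.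
have h4 : 'C(k - 2, 2) = 'C(k - 3, 2) + (k - 3).
  have -> : k - 2 = (k - 3).+1 by lia.
  by rewrite binS bin1.
by exfalso; lia.
Qed.

(** * The incidence graph *)

Section Incidence.

Variables (T : finType) (H : {set {set T}}).

Local Notation E := {e : {set T} | e \in H}.
Local Notation node := (T + E)%type.
Local Notation g := (@incidence_graph T H).

Definition isV (x : node) : bool := if x is inl _ then true else false.

Lemma inc_sym : symmetric g.
Proof. by case=> [x|e] [y|f]. Qed.

Lemma inc_parity x y : g x y -> isV y = ~~ isV x.
Proof. by case: x y => [x|e] [y|f]. Qed.

Lemma path_parity a p : path g a p -> isV (last a p) = isV a (+) odd (size p).
Proof.
elim: p a => [|b p IHp] a /=; first by rewrite addbF.
by case/andP=> /inc_parity ab /IHp ->; rewrite ab addNb addbN.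
Qed.

Lemma index_parity a p x : path g a p -> x \in p -> isV x = isV a (+) ~~ odd (index x p).
Proof.
move=> pp /split_index1[p1 [p2 [Ep <- _]]]; move: pp; rewrite Ep -cat_rcons cat_path.
by case/andP=> /path_parity; rewrite last_rcons size_rcons.
Qed.

Definition Vs (s : seq node) : {set T} := [set x | inl x \in s].
Definition Es (s : seq node) : {set E} := [set e | inr e \in s].

Lemma in_Vs s x : (x \in Vs s) = (inl x \in s). Proof. by rewrite inE. Qed.
Lemma in_Es s e : (e \in Es s) = (inr e \in s). Proof. by rewrite inE. Qed.

Lemma card_Vs s : uniq s -> #|Vs s| = count isV s.
Proof.
move=> us; rewrite -size_filter -(card_imset _ (@inl_inj T E)).
rewrite -(card_uniqP (filter_uniq isV us)); apply: eq_card => x.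
rewrite mem_filter; apply/imsetP/andP => [[y] /[!inE] ys ->//|[]].
by case: x => // x _ xs; exists x; rewrite ?inE.
Qed.

Lemma card_Es s : uniq s -> #|Es s| = count (predC isV) s.
Proof.
move=> us; rewrite -size_filter -(card_imset _ (@inr_inj T E)).
rewrite -(card_uniqP (filter_uniq (predC isV) us)); apply: eq_card => x.
rewrite mem_filter; apply/imsetP/andP => [[y] /[!inE] ys ->//|[]].
by case: x => // x _ xs; exists x; rewrite ?inE.
Qed.

Lemma card_VsEs s : uniq s -> #|Vs s| + #|Es s| = size s.
Proof. by move=> us; rewrite card_Vs // card_Es // count_predC. Qed.

Lemma path_countV a p : path g a p ->
  count isV p + isV a = count (predC isV) p + isV (last a p).
Proof.
elim: p a => //= b p IHp a /andP[/inc_parity Eb /IHp]; rewrite Eb; lia.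
Qed.

Lemma ucyc_card (s : seq node) : ucyc g s -> #|Vs s| = #|Es s|.
Proof.
case/andP=> cy us; rewrite card_Vs // card_Es //; case: s cy {us} => //= a p /path_countV.
by rewrite last_rcons -!cats1 !count_cat /=; lia.
Qed.

Lemma ucyc_size (s : seq node) : ucyc g s -> size s = 2 * #|Vs s|.
Proof.
move=> cy; have /andP[_ us] := cy; rewrite -card_VsEs // -ucyc_card //; lia.
Qed.

(** Rotated to start at a vertex, the cycle carries vertices at even and edges at odd positions. *)
Lemma ucyc_berge (s : seq node) l : ucyc g s -> size s = 2 * l -> 0 < l ->
  exists (v : 'I_l -> T) (e : 'I_l -> {set T}), berge_cycle H v e.
Proof.
move=> cy sz l0.
have /card_gt0P[x0] : 0 < #|Vs s| by have := ucyc_size cy; lia.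
rewrite inE => x0s; have [c cx pc] := ucyc_from cy x0s.
have {}sz : size c = 2 * l - 1 by have := perm_size pc; rewrite sz /=; lia.
have /andP[cyc unq] := cx; set q := inl x0 :: c in cx cyc unq pc.
have gq i : i < size q -> g (nth (inl x0) q i) (nth (inl x0) (rcons c (inl x0)) i).
  move=> lt_i; have /pathP := cyc => /(_ (inl x0) i); rewrite size_rcons => /(_ lt_i).
  by rewrite -rcons_cons nth_rcons /= lt_i.
have parq i : i < size q -> isV (nth (inl x0) q i) = ~~ odd i.
  elim: i => // i IHi lt_i; have lt_i' : i < size q by lia.
  have := gq _ lt_i' => /inc_parity; rewrite IHi // nth_rcons.
  by have -> : i < size c by move: lt_i; rewrite /q /=; lia.
pose vof (u : node) := if u is inl x then x else x0.
pose eof (u : node) : {set T} := if u is inr e then val e else set0.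
have szq : size q = 2 * l by rewrite /q /= sz; lia.
have hv (i : 'I_l) : {x | nth (inl x0) q (2 * i) = inl x}.
  have lt_i : 2 * i < size q by rewrite szq; have := ltn_ord i; lia.
  have := parq _ lt_i; case: (nth _ q _) => [x _|e]; first by exists x.
  by rewrite /= oddM.
have he (i : 'I_l) : {e | nth (inl x0) q (2 * i).+1 = inr e}.
  have lt_i : (2 * i).+1 < size q by rewrite szq; have := ltn_ord i; lia.
  have := parq _ lt_i; case: (nth _ q _) => [x|e _]; last by exists e.
  by rewrite /= oddM.
exists (fun i => sval (hv i)), (fun i => val (sval (he i))); split.
- move=> i j; case: (hv i) (hv j) => x /= hx [y /= hy] xy.
  apply/val_inj => /=; suff : 2 * i = 2 * j by lia.
  have li : 2 * i < size q by rewrite szq; have := ltn_ord i; lia.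
  have lj : 2 * j < size q by rewrite szq; have := ltn_ord j; lia.
  by apply/eqP; rewrite -(nth_uniq (inl x0) li lj unq) hx hy xy.
- move=> i j; case: (he i) (he j) => x /= hx [y /= hy] /val_inj xy.
  apply/val_inj => /=; suff : (2 * i).+1 = (2 * j).+1 by lia.
  have li : (2 * i).+1 < size q by rewrite szq; have := ltn_ord i; lia.
  have lj : (2 * j).+1 < size q by rewrite szq; have := ltn_ord j; lia.
  by apply/eqP; have /= := nth_uniq (inl x0) li lj unq; rewrite hx hy xy eqxx => <-.
- by move=> i; apply: valP.
- move=> i; apply/subsetP => z; rewrite !inE; have lti := ltn_ord i.
  case: (he i) (hv i) (hv (ordS i)) => e /= hE [x /= hx] [y /= hy] /orP[] /eqP->.
    have lt1 : 2 * i < size q by rewrite szq; lia.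
    have := gq _ lt1; rewrite nth_rcons hx.
    have -> : 2 * i < size c by rewrite sz; lia.
    by rewrite hE.
  have lt1 : (2 * i).+1 < size q by rewrite szq; lia.
  have := gq _ lt1; rewrite nth_rcons /= hE sz.
  (* For the last edge [ordS] wraps around to the initial vertex of the list. *)
  have [li|li] := eqVneq i.+1 l.
    have Ey : nth (inl x0) q 0 = inl y.
      by rewrite -hy; congr nth; rewrite /= li modnn.
    have -> : ((2 * i).+1 < 2 * l - 1) = false by lia.
    have -> : (2 * i).+1 == 2 * l - 1 by lia.
    by case: Ey => <-.
  have Ey : nth (inl x0) c (2 * i).+1 = inl y.
    have -> : nth (inl x0) c (2 * i).+1 = nth (inl x0) q (2 * i).+2 by [].
    by rewrite -hy; congr nth; rewrite /= modn_small; lia.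
  have -> : (2 * i).+1 < 2 * l - 1 by lia.
  by rewrite Ey.
Qed.

End Incidence.

(** * Counting the edges at a vertex *)

Lemma two_members (A : finType) (B : {set A}) (a : A) :
  1 < #|B| -> exists2 b, b \in B & b != a.
Proof.
move=> B2; have /card_gt0P[b] : 0 < #|B :\ a| by have := cardsD1 a B; lia.
by rewrite !inE => /andP[ba bB]; exists b.
Qed.

Lemma disjoint_of (A : finType) (B C : {set A}) :
  (forall x, x \in B -> x \notin C) -> [disjoint B & C].
Proof. by move=> h; apply/pred0P => x /=; apply/negP => /andP[/h/negP]. Qed.

Section Incidence.

Variables (T : finType) (H : {set {set T}}).

Local Notation E := {e : {set T} | e \in H}.
Local Notation node := (T + E)%type.
Local Notation g := (@incidence_graph T H).
Local Notation isV := (@isV T H).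
Local Notation Vs := (@Vs T H).
Local Notation Es := (@Es T H).

Definition edges_at (y : T) : {set E} := [set e : E | y \in val e].

Lemma card_edges_at y : #|edges_at y| = degree H y.
Proof.
rewrite /degree -(card_imset _ val_inj); apply: eq_card => e; rewrite !inE.
apply/imsetP/andP => [[f /[!inE] yf ->]|[eH ye]]; first by split=> //; apply: valP.
by exists (exist _ e eH); rewrite ?inE.
Qed.

Section Links.

Variables (X : {set T}) (F : {set E}).

(* An edge of [F] that is not thin is determined by its thick vertices, and a thin
   edge owns a vertex: both kinds take up room on the cycle. *)
Definition thick : {set T} := [set x in X | 1 < #|[set f in F | x \in val f]|].
Definition thin : {set E} := [set f in F | [exists x in X, (x \in val f) && (x \notin thick)]].

Lemma thickP x f : x \in thick -> exists f', [/\ f' \in F, x \in val f' & f' != f].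
Proof.
by rewrite inE => /andP[_ /(two_members f)[f']]; rewrite inE => /andP[]; exists f'.
Qed.

Lemma thin_unique x f f' : x \in X -> x \notin thick ->
  f \in F -> x \in val f -> f' \in F -> x \in val f' -> f = f'.
Proof.
move=> xs; rewrite !inE xs /= -leqNgt => /card_le1_eqP h fF xf fF' xf'.
by apply: h; rewrite !inE ?fF ?fF'.
Qed.

Lemma thick_mem x : x \in thick -> exists2 f, f \in F & x \in val f.
Proof.
rewrite inE => /andP[_ h]; have /card_gt0P[f] : 0 < #|[set f in F | x \in val f]| by lia.
by rewrite inE => /andP[]; exists f.
Qed.

Lemma thick_sub : thick \subset X.
Proof. by apply/subsetP => x /[!inE] /andP[]. Qed.

(** A thin edge is represented by one of its vertices that is not thick; such a vertex lies in no
    other edge of [F], so representatives are distinct. Any two members of [W] belong to two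
    different edges, which is what a detour through [y] requires. *)
Lemma thin_reps : exists W : {set T}, [/\ W \subset X, #|W| = #|thick| + #|thin|,
  (forall x, x \in W -> exists2 f, f \in F & x \in val f) &
  forall x x', x \in W -> x' \in W -> x != x' ->
    exists f f', [/\ f \in F, f' \in F, f != f', x \in val f & x' \in val f']].
Proof.
have thick2 x x' f' : x \in thick -> f' \in F -> x' \in val f' ->
    exists f f', [/\ f \in F, f' \in F, f != f', x \in val f & x' \in val f'].
  by move=> xt f'F xf'; have [f [fF xf ff']] := thickP f' xt; exists f, f'.
have [t0|[f0 f0t]] := set_0Vmem thin.
  exists thick; rewrite t0 cards0 addn0; split=> //; [exact: thick_sub|exact: thick_mem|].
  by move=> x x' xt /thick_mem[f' f'F xf'] _; apply: thick2 xf'.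
have {f0 f0t} [x0] : exists x : T, true.
  by move: f0t; rewrite inE => /andP[_ /existsP[x _]]; exists x.
pose rep (f : E) := odflt x0 [pick x in X | (x \in val f) && (x \notin thick)].
have repP : {in thin, forall f, [/\ rep f \in X, rep f \in val f & rep f \notin thick]}.
  move=> f; rewrite inE => /andP[_ /existsP[x xP]]; rewrite /rep.
  by case: pickP => [z /and3P[]|/(_ x)] //; rewrite xP.
have repI : {in thin &, injective rep}.
  move=> f f' ft ft' Er; have [rX rf rt] := repP f ft; have [_ rf' _] := repP f' ft'.
  move: ft ft'; rewrite !inE => /andP[fF _] /andP[fF' _].
  by apply: (thin_unique rX rt) => //; rewrite Er.
have thinF f : f \in thin -> f \in F by rewrite inE => /andP[].
exists (thick :|: rep @: thin).
have memW x : x \in thick :|: rep @: thin -> exists2 f, f \in F & x \in val f.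
  by rewrite inE => /orP[/thick_mem//|/imsetP[f ft ->]]; have [] := repP f ft; exists f; auto.
split=> //.
- rewrite subUset thick_sub; apply/subsetP => x /imsetP[f ft ->].
  by have [] := repP f ft.
- rewrite cardsU card_in_imset // (eqP (_ : thick :&: _ == set0)) ?cards0 ?subn0 //.
  rewrite setI_eq0 disjoint_sym; apply: disjoint_of => x /imsetP[f ft ->].
  by have [] := repP f ft.
- move=> x x' xW x'W xx'; have [f fF xf] := memW x xW; have [f' fF' xf'] := memW x' x'W.
  case: (boolP (x \in thick)) => [xt|nxt]; first exact: thick2 xf'.
  case: (boolP (x' \in thick)) => [xt|nxt'].
    by have [f2 [f2F xf2]] := thickP f xt; rewrite eq_sym => f2f'; exists f, f2.
  move: xW x'W; rewrite !in_setU (negPf nxt) (negPf nxt') /= => /imsetP[h ht Ex] /imsetP[h' ht' Ex'].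
  have [_ rh _] := repP h ht; have [_ rh' _] := repP h' ht'.
  exists h, h'; rewrite Ex Ex' !thinF //; split=> //.
  by apply: contraNneq xx' => Eh; rewrite Ex Ex' Eh.
Qed.

(** Apart from [y], an edge that is not thin has all its vertices in [A :|: thick], so deleting [y]
    encodes it as an [r.-1]-subset of that set. In the case of equality every such subset is the
    code of an edge. *)
Lemma card_thick_thin (A : {set T}) y r : y \notin A -> y \notin X ->
    {in F, forall f : E, [/\ y \in val f, #|val f| = r & val f \subset y |: (A :|: X)]} ->
  #|F| <= 'C(#|A :|: thick|, r.-1) + #|thin| /\
  (#|F| = 'C(#|A :|: thick|, r.-1) -> thin = set0 -> forall B : {set T},
    B \subset A :|: thick -> #|B| = r.-1 -> exists2 f, f \in F & val f = y |: B).
Proof.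
move=> yA yX FP.
pose res (f : E) : {set T} := val f :\ y.
have resI : {in F &, injective res}.
  move=> f f' fF fF' Er; apply: val_inj; have [yf _ _] := FP f fF; have [yf' _ _] := FP f' fF'.
  by rewrite -(setD1K yf) -(setD1K yf') -/(res f) Er.
have resS : res @: (F :\: thin) \subset [set B : {set T} | B \subset A :|: thick & #|B| == r.-1].
  apply/subsetP => _ /imsetP[f /setDP[fF nft] ->]; have [yf cf sf] := FP f fF.
  rewrite inE; apply/andP; split; last by have := cardsD1 y (val f); rewrite yf cf => ->.
  apply/subsetP => x /setD1P[xy xf]; have := subsetP sf x xf.
  rewrite !in_setU in_set1 (negPf xy) /= => /orP[->//|xX]; apply/orP; right.
  move: nft; rewrite inE fF /= negb_exists => /forallP/(_ x).
  by rewrite xX xf /= negbK.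
have cD : #|F :\: thin| = #|res @: (F :\: thin)|.
  by rewrite card_in_imset // => f f' /setDP[fF _] /setDP[fF' _]; apply: resI.
have cF : #|F| = #|F :\: thin| + #|thin|.
  rewrite -(cardsID thin F) addnC; congr (_ + _); apply: eq_card => f; rewrite !inE.
  by case: (f \in F).
split.
  rewrite cF cD leq_add2r -[X in _ <= X](cards_draws (A :|: thick) r.-1).
  exact: subset_leq_card.
move=> EF t0 B sB cB.
have Eim : res @: (F :\: thin) = [set B : {set T} | B \subset A :|: thick & #|B| == r.-1].
  apply/eqP; rewrite eqEcard resS -cD cards_draws -EF.
  by rewrite t0 setD0 /=.
have : B \in res @: (F :\: thin) by rewrite Eim inE sB cB eqxx.
case/imsetP => f /setDP[fF _] EB; exists f => //.
by have [yf _ _] := FP f fF; rewrite EB /res setD1K.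
Qed.

End Links.

(** * Exchanges at a vertex off a longest cycle *)

Section LongestCycle.

Variables (N : nat) (s : seq node).
Hypotheses (maxN : forall s : seq node, ucyc g s -> size s <= N) (szN : size s = N) (cy : ucyc g s).
Hypothesis gt2 : 2 < size s.

Local Notation nx := (next s).

Definition on_edges y := edges_at y :&: Es s.
Definition off_edges y := edges_at y :\: Es s.

Lemma card_on_off y : #|on_edges y| + #|off_edges y| = degree H y.
Proof. by rewrite -card_edges_at cardsID. Qed.

Variable y : T.
Hypothesis ys : inl y \notin s.

Lemma off_edgesP f : f \in off_edges y -> (y \in val f) /\ (inr f \notin s).
Proof. by rewrite !inE => /andP[]. Qed.

Lemma on_edgesP f : f \in on_edges y -> (y \in val f) /\ (inr f \in s).
Proof. by rewrite !inE => /andP[]. Qed.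

(** Otherwise [f, y, f'] could replace the single edge between [x] and [x']. *)
Lemma no_next2 x x' f f' : x \in Vs s -> x != x' ->
  f \in off_edges y -> f' \in off_edges y -> f != f' -> x \in val f -> x' \in val f' ->
  nx (nx (inl x)) != inl x'.
Proof.
rewrite inE => xs xx' /off_edgesP[yf fs] /off_edgesP[yf' fs'] ff' xf xf'.
apply/eqP => E2.
suff : size [:: inr f; inl y; inr f' : node] <= 1 by [].
apply: (ear_next2 maxN szN cy xs gt2); first by rewrite E2 /= xf yf yf' xf'.
  by rewrite /= !inE /= andbT; apply: contra ff' => /eqP[->].
by move=> u; rewrite !inE => /or3P[] /eqP->.
Qed.

Lemma no_next_off_on x f e : x \in Vs s -> f \in off_edges y -> x \in val f ->
  e \in on_edges y -> nx (inl x) != inr e.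
Proof.
rewrite inE => xs /off_edgesP[yf fs] xf /on_edgesP[ye es]; apply/eqP => E1.
suff : [:: inr f; inl y : node] = [::] by [].
apply: (ear_next maxN szN cy xs); rewrite ?E1 //= ?xf ?yf ?ye //.
by move=> u; rewrite !inE => /orP[] /eqP->.
Qed.

Lemma no_next_on_off x f e : x \in Vs s -> f \in off_edges y -> x \in val f ->
  e \in on_edges y -> nx (inr e) != inl x.
Proof.
rewrite inE => xs /off_edgesP[yf fs] xf /on_edgesP[ye es]; apply/eqP => E1.
suff : [:: inl y; inr f : node] = [::] by [].
apply: (ear_next maxN szN cy es); rewrite ?E1 //= ?xf ?yf ?ye //.
by move=> u; rewrite !inE => /orP[] /eqP->.
Qed.

Lemma nx_isV u : u \in s -> isV (nx u) = ~~ isV u.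
Proof. by move=> us; apply: (@inc_parity T H); apply: next_edge. Qed.

Lemma nx_E u : u \in s -> ~~ isV u -> exists2 x, nx u = inl x & x \in Vs s.
Proof.
move=> us uE; have := nx_isV us; rewrite uE; case Ex: (nx u) => [x|//] _.
by exists x => //; rewrite inE -Ex mem_next.
Qed.

Lemma nx_V u : u \in s -> isV u -> exists2 e, nx u = inr e & e \in Es s.
Proof.
move=> us uV; have := nx_isV us; rewrite uV; case Ex: (nx u) => [//|e] _.
by exists e => //; rewrite inE -Ex mem_next.
Qed.

(* A vertex of [W] linked to [y] claims itself and the vertex two steps later, an edge
   at [y] the vertex after it; in a longest cycle no vertex is claimed twice. *)
Definition claim1 (W : {set T}) : {set node} := inl @: W.
Definition claim2 (W : {set T}) : {set node} := (fun x => nx (nx (inl x))) @: W.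
Definition claim3 (D : {set E}) : {set node} := (fun e => nx (inr e)) @: D.

(** All claimed nodes are vertices of the cycle: two steps keep the side of the incidence graph, one
    step from an edge leads to a vertex. [R] makes room for cycle vertices outside all claims. *)
Lemma card_claims (W R : {set T}) : W \subset Vs s -> R \subset Vs s ->
    [disjoint claim1 W & claim2 W] -> [disjoint claim1 W & claim3 (on_edges y)] ->
    [disjoint claim2 W & claim3 (on_edges y)] ->
    [disjoint claim1 R & claim1 W :|: claim2 W :|: claim3 (on_edges y)] ->
  2 * #|W| + #|on_edges y| + #|R| <= #|Vs s| /\
  (2 * #|W| + #|on_edges y| = #|Vs s| ->
   claim1 W :|: claim2 W :|: claim3 (on_edges y) = claim1 (Vs s)).
Proof.
move=> /subsetP sW /subsetP sR d12 d13 d23 dR.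
have inj : injective (nx : node -> node) by apply: next_inj cy.
have c1 X : #|claim1 X| = #|X| by apply/card_imset/inl_inj.
have c2 : #|claim2 W| = #|W|.
  by apply: card_imset => x x' E; apply/inl_inj/inj/inj.
have c3 : #|claim3 (on_edges y)| = #|on_edges y|.
  by apply: card_imset => x x' E; apply/inr_inj/inj.
have c123 : #|claim1 W :|: claim2 W :|: claim3 (on_edges y)| = 2 * #|W| + #|on_edges y|.
  rewrite cardsU (cardsU (claim1 W)) (eqP (_ : (claim1 W :|: claim2 W) :&: _ == set0)).
    by rewrite (eqP (_ : claim1 W :&: claim2 W == set0)) ?setI_eq0 // !cards0 c1 c2 c3; clear; lia.
  by rewrite setIUl setU_eq0 !setI_eq0 d13.
have sub : claim1 W :|: claim2 W :|: claim3 (on_edges y) \subset claim1 (Vs s).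
  apply/subsetP => u; rewrite !inE -orbA => /or3P[] /imsetP[x xW ->].
  - by apply: imset_f; apply: sW.
  - have xs : inl x \in s by have := sW x xW; rewrite inE.
    have [e -> es] := nx_V xs isT; have {}es : inr e \in s by rewrite inE in es.
    by have [z -> zs] := nx_E es isT; apply: imset_f.
  - have [_ es] := on_edgesP xW.
    by have [z -> zs] := nx_E es isT; apply: imset_f.
split; last by move=> Ec; apply/eqP; rewrite eqEcard sub c123 c1 Ec /=.
rewrite -c123 -(c1 R) -(c1 (Vs s)); move: dR; rewrite disjoint_sym -setI_eq0 => /eqP dR.
have := cardsU (claim1 W :|: claim2 W :|: claim3 (on_edges y)) (claim1 R).
rewrite dR cards0 subn0 => <-; apply: subset_leq_card; rewrite subUset sub /=.
by apply: imsetS; apply/subsetP.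
Qed.

Lemma claims_disjoint (W : {set T}) :
    W \subset Vs s -> (forall x, x \in W -> exists2 f, f \in off_edges y & x \in val f) ->
    (forall x x', x \in W -> x' \in W -> x != x' -> exists f f',
      [/\ f \in off_edges y, f' \in off_edges y, f != f', x \in val f & x' \in val f']) ->
  [/\ [disjoint claim1 W & claim2 W], [disjoint claim1 W & claim3 (on_edges y)]
    & [disjoint claim2 W & claim3 (on_edges y)]].
Proof.
move=> /subsetP sW h1 h2; split; apply: disjoint_of => u /imsetP[x xW ->];
  apply/imsetP => -[z zW Ez]; have [f fF xf] := h1 x xW.
- have [Exz|xz] := eqVneq x z.
    have xs : inl x \in s by have := sW x xW; rewrite inE.
    by have := next2_neq cy xs gt2; rewrite Exz -Ez Exz eqxx.
  have [f1 [f2 [h3 h4 h5 h6 h7]]] := h2 x z xW zW xz.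
  have := no_next2 (sW z zW) (_ : z != x) h4 h3 (_ : f2 != f1) h7 h6.
  by rewrite -Ez eqxx; rewrite ![_ == x]eq_sym ![f2 == _]eq_sym => /(_ xz h5).
- have := no_next_on_off (sW x xW) fF xf zW; by rewrite -Ez eqxx.
- have := no_next_off_on (sW x xW) fF xf zW; have /next_inj inj := cy.
  by rewrite (inj _ _ Ez) eqxx.
Qed.

Section Near.

Variable r : nat.
Hypotheses (r3 : 2 < r) (unif : uniform r H).
Hypothesis near : forall f, f \in off_edges y -> val f \subset y |: Vs s.

Local Notation K := (thick (Vs s) (off_edges y)).
Local Notation S := (thin (Vs s) (off_edges y)).

Lemma yVs : y \notin Vs s. Proof. by rewrite inE. Qed.

Lemma card_edge (e : E) : #|val e| = r.
Proof. by apply/eqP; move/forallP: unif => /(_ (val e)) /implyP; apply; apply: valP. Qed.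

Lemma near_edges : {in off_edges y, forall f : E,
  [/\ y \in val f, #|val f| = r & val f \subset y |: (set0 :|: Vs s)]}.
Proof.
by move=> f fF; rewrite set0U card_edge near //; split=> //; case: (off_edgesP fF).
Qed.

Lemma near_card : #|off_edges y| <= 'C(#|K|, r.-1) + #|S|.
Proof.
have y0 : y \notin set0 by rewrite inE.
by have [] := card_thick_thin y0 yVs near_edges; rewrite set0U.
Qed.

Lemma near_count : 2 * #|K| + 2 * #|S| + #|on_edges y| <= #|Vs s|.
Proof.
have [W [sW cW h1 h2]] := thin_reps (Vs s) (off_edges y).
have [d12 d13 d23] := claims_disjoint sW h1 h2.
have [] := @card_claims W set0 sW (sub0set _) d12 d13 d23; last first.
  by rewrite cW cards0 => h _; move: h; clear; lia.
by rewrite /claim1 imset0; apply: disjoint_of => u; rewrite inE.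
Qed.

(** Without thick vertices, a cycle vertex lies in at most one edge of [off_edges y]. As [r >= 3],
    each edge of [S] has two cycle vertices of its own: one goes into [W] and claims two places, the
    other one goes into [R]. *)
Lemma near_count3 : K = set0 -> 2 < #|Vs s| -> 3 * #|S| + #|on_edges y| <= #|Vs s|.
Proof.
move=> K0 c3.
have solo x f f' : f \in off_edges y -> f' \in off_edges y -> x \in Vs s ->
    x \in val f -> x \in val f' -> f = f'.
  by move=> fF f'F xs xf xf'; apply: (thin_unique xs) fF xf f'F xf'; rewrite K0 inE.
have [S0|[f0 f0S]] := set_0Vmem S.
  by have := near_count; rewrite K0 S0 !cards0.
have s6 : 4 < size s by rewrite (ucyc_size cy); lia.
have pairP f : f \in S -> exists p : T * T, [&& p.1 \in val f, p.2 \in val f, p.1 \in Vs s,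
    p.2 \in Vs s, p.1 != p.2 & nx (nx (inl p.1)) != inl p.2].
  rewrite inE => /andP[fF _]; have [yf cf] := near_edges fF; rewrite set0U => /subsetP sf.
  have /card_gt1P[a [b [/setD1P[ay af] /setD1P[by_ bf] ab]]] : 1 < #|val f :\ y|.
    by have := cardsD1 y (val f); rewrite yf cf; move: r3; clear; lia.
  have := sf a af; have := sf b bf; rewrite !in_setU1 (negPf ay) (negPf by_) /= => bs as_.
  (* The second vertex must escape the claim of the first. If [b] comes two steps after [a], the
     pair is reversed: with more than four nodes [a] cannot come two steps after [b] as well. *)
  have [Eb|nb] := eqVneq (nx (nx (inl a))) (inl b); last by exists (a, b); rewrite af bf as_ bs ab.
  exists (b, a); rewrite af bf as_ bs eq_sym ab /= -Eb.
  by apply: next4_neq cy _ s6; rewrite inE in as_.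
have [[x0 _] _] := pairP _ f0S.
pose rep (f : E) := odflt (x0, x0) [pick p : T * T | [&& p.1 \in val f, p.2 \in val f,
  p.1 \in Vs s, p.2 \in Vs s, p.1 != p.2 & nx (nx (inl p.1)) != inl p.2]].
have {pairP}repP f : f \in S -> [/\ f \in off_edges y, (rep f).1 \in val f, (rep f).2 \in val f,
    (rep f).1 \in Vs s & [/\ (rep f).2 \in Vs s, (rep f).1 != (rep f).2 &
    nx (nx (inl (rep f).1)) != inl (rep f).2]].
  move=> fS; have [p pP] := pairP f fS; rewrite /rep; case: pickP => [q /and5P[]|/(_ p)].
    by move: fS; rewrite inE => /andP[-> _] h1 h2 h3 h4 /andP[].
  by rewrite pP.
pose W := [set (rep f).1 | f in S]; pose R := [set (rep f).2 | f in S].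
have repI1 : {in S &, injective (fun f => (rep f).1)}.
  move=> f f' /repP[fF r1 _ rs _] /repP[f'F r1' _ _ _] Er.
  by apply: (solo _ _ _ fF f'F rs r1); rewrite Er.
have repI2 : {in S &, injective (fun f => (rep f).2)}.
  move=> f f' /repP[fF _ r2 _ [rs _ _]] /repP[f'F _ r2' _ _] Er.
  by apply: (solo _ _ _ fF f'F rs r2); rewrite Er.
have sW : W \subset Vs s by apply/subsetP => _ /imsetP[f /repP[_ _ _ rs _] ->].
have sR : R \subset Vs s by apply/subsetP => _ /imsetP[f /repP[_ _ _ _ [rs _ _]] ->].
have [d12 d13 d23] : [/\ [disjoint claim1 W & claim2 W],
    [disjoint claim1 W & claim3 (on_edges y)] & [disjoint claim2 W & claim3 (on_edges y)]].
  apply: claims_disjoint sW _ _ => [x /imsetP[f /repP[fF r1 _ _ _] ->]|]; first by exists f.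
  move=> x x' /imsetP[f /repP[fF r1 _ _ _] ->] /imsetP[f' /repP[f'F r1' _ _ _] ->] ne.
  by exists f, f'; split=> //; apply: contraNneq ne => ->.
have [] := @card_claims W R sW sR d12 d13 d23; last first.
  have -> : #|W| = #|S| by apply: card_in_imset.
  have -> : #|R| = #|S| by apply: card_in_imset.
  by case=> h _; move: h; clear; lia.
apply: disjoint_of => u /imsetP[_ /imsetP[f fS ->] ->].
have [fF r1 r2 rs [rs2 ne ne2]] := repP f fS.
rewrite !in_setU !negb_or; apply/andP; split; first (apply/andP; split); apply/imsetP => -[].
- move=> _ /imsetP[f' f'S ->] [Er]; have [f'F r1' _ _ _] := repP f' f'S.
  by case/negP: ne; rewrite Er; rewrite (solo _ f f' fF f'F rs2) // Er.
- move=> _ /imsetP[f' f'S ->] Er; have [f'F r1' _ rs' _] := repP f' f'S.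
  have [Ef|ff'] := eqVneq f f'; first by case/negP: ne2; rewrite {1}Ef -Er.
  have ne' : (rep f').1 != (rep f).2.
    apply: contraNneq ff' => Er2; apply/eqP.
    by apply: (solo _ _ _ fF f'F rs2 r2); rewrite -Er2.
  have := no_next2 rs' ne' f'F fF _ r1' r2; rewrite -Er eqxx eq_sym ff' => h.
  by have := h isT.
- move=> e eD Er; have := no_next_on_off rs2 fF r2 eD; by rewrite -Er eqxx.
Qed.

End Near.

End LongestCycle.
End Incidence.

(** * No edge leaves a longest cycle *)

Section Incidence.

Variables (T : finType) (H : {set {set T}}).

Local Notation E := {e : {set T} | e \in H}.
Local Notation node := (T + E)%type.
Local Notation g := (@incidence_graph T H).
Local Notation Vs := (@Vs T H).
Local Notation Es := (@Es T H).
Local Notation edges_at := (@edges_at T H).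

Variables (k r N : nat).
Hypotheses (r3 : 2 < r) (rk : r <= k - 2) (unif : uniform r H).
Hypothesis mindeg : forall y, 'C(k - 1, r - 1) + 1 <= degree H y.
Hypothesis maxN : forall s : seq node, ucyc g s -> size s <= N.
Hypothesis leN : N <= 2 * (2 * k - 1).
Hypothesis near : forall (s : seq node) y f, ucyc g s -> size s = N -> inl y \notin s ->
  f \in off_edges s y -> val f \subset y |: Vs s.

Lemma degree_gt6 : 7 <= 'C(k - 1, r - 1) + 1.
Proof.
have := @bin2_le_bin (k - 1) (r - 1) _ _; have := bin2_double (k - 1).
by move=> h1 /(_ ltac:(lia) ltac:(lia)); nia.
Qed.

(** On a degenerate cycle [y |: Vs s] is too small to hold an edge of [off_edges s y], and at most
    one edge lies on the cycle, whereas [y] has degree at least seven. *)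
Lemma longest_gt2 (s : seq node) y : ucyc g s -> size s = N -> inl y \notin s -> 2 < size s.
Proof.
move=> cy sz ys; rewrite ltnNge; apply/negP => le2.
have c1 : #|Vs s| <= 1 by have := ucyc_size cy; lia.
have off0 : off_edges s y = set0.
  apply/setP => f; rewrite in_set0; apply/negP => fF.
  have := subset_leq_card (near cy sz ys fF); rewrite (card_edge unif) cardsU1.
  by case: (y \notin _) => /=; move: r3 c1; clear; lia.
have := mindeg y; rewrite -(card_on_off s) off0 cards0.
have : #|on_edges s y| <= #|Es s| by apply/subset_leq_card/subsetIr.
by rewrite -ucyc_card //; move: c1 degree_gt6; clear; lia.
Qed.

Local Notation K s y := (thick (Vs s) (off_edges s y)).
Local Notation S s y := (thin (Vs s) (off_edges s y)).

Lemma near_cases (s : seq node) y : ucyc g s -> size s = N -> inl y \notin s ->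
  [/\ #|K s y| = k - 1, S s y = set0, #|on_edges s y| = 1 & #|Vs s| = 2 * k - 1] \/
  [/\ k <= 6 & 'C(k - 1, r - 1) <= #|on_edges s y|].
Proof.
move=> cy sz ys; have gt2 := longest_gt2 cy sz ys.
have hc := near_count maxN sz cy gt2 ys.
have hf := near_card ys unif (fun f => near (f:=f) cy sz ys).
have h3 := near_count3 maxN sz cy gt2 ys r3 unif (fun f => near (f:=f) cy sz ys).
have hd := mindeg y; rewrite -(card_on_off s) in hd.
have szc := ucyc_size cy.
have Er : r.-1 = r - 1 by rewrite subn1.
rewrite Er in hf.
have h0 : 0 < #|K s y| -> 2 <= 'C(#|K s y|, r - 1) + #|S s y|.
  case/card_gt0P => x; rewrite inE => /andP[_ h]; apply: leq_trans hf; apply: leq_trans h _.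
  by apply/subset_leq_card/subsetP => f; rewrite inE => /andP[].
have [] := @cycle_count_cases (k - 1) (r - 1) #|K s y| #|S s y| #|on_edges s y| #|Vs s|.
- by move: r3; clear; lia.
- by move: rk r3; clear; lia.
- by move: szc sz leN r3 rk; clear; lia.
- exact: hc.
- by move: hd hf; clear; lia.
- exact: h0.
- move=> K0; have {}K0 : K s y = set0 by apply: cards0_eq.
  apply: h3 => //; move: hc hd hf degree_gt6; rewrite K0 cards0 (@bin_small 0); first by clear; lia.
  by move: r3; clear; lia.
- by case=> h1 /cards0_eq h2 h4 h5; left; split=> //; move: h5 rk r3; clear; lia.
- by case=> _ h1 h2; right; split=> //; move: h1; clear; lia.
Qed.

Lemma near_on_edge (s : seq node) y : ucyc g s -> size s = N -> inl y \notin s ->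
  exists e, e \in on_edges s y.
Proof.
move=> cy sz ys; apply/card_gt0P; case: (near_cases cy sz ys) => [[_ _ -> _]//|[_]].
by have := degree_gt6; clear; lia.
Qed.

(** The claims exhaust the cycle. A vertex [x] that is neither thick nor in the only cycle edge [ed]
    at [y] then lies between two thick vertices and can be exchanged for [y]. The new longest cycle
    has an edge at [x], and this edge is a chord of the old cycle along which a longer one is
    formed. *)
Lemma near_not_tight (s : seq node) y : ucyc g s -> size s = N -> inl y \notin s ->
  #|K s y| = k - 1 -> S s y = set0 -> #|on_edges s y| = 1 -> #|Vs s| = 2 * k - 1 -> False.
Proof.
move=> cy sz ys cK S0 cD cV; have gt2 := longest_gt2 cy sz ys.
have [ed Ded] : exists ed, on_edges s y = [set ed] by apply/cards1P; rewrite cD.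
have [yed eds] : (y \in val ed) /\ (inr ed \in s).
  by apply: (@on_edgesP _ _ s); rewrite Ded set11.
have [d12 d13 d23] : [/\ [disjoint claim1 H (K s y) & claim2 s (K s y)],
    [disjoint claim1 H (K s y) & claim3 s (on_edges s y)]
  & [disjoint claim2 s (K s y) & claim3 s (on_edges s y)]].
  apply: (claims_disjoint maxN sz cy gt2 ys (thick_sub _ _)); first exact: thick_mem.
  move=> x x' xK /thick_mem[f' f'F xf'] _.
  by have [f [fF xf ff']] := thickP f' xK; exists f, f'.
have d0 : [disjoint claim1 H set0 & claim1 H (K s y) :|: claim2 s (K s y) :|:
    claim3 s (on_edges s y)].
  by rewrite /claim1 imset0; apply: disjoint_of => u; rewrite inE.
have [_ cover] := @card_claims _ _ s cy y (K s y) set0 (thick_sub _ _) (sub0set _) d12 d13 d23 d0.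
have {cover}cover x : x \in Vs s -> [\/ x \in K s y,
    exists2 a, a \in K s y & inl x = next s (next s (inl a)) | inl x = next s (inr ed)].
  move=> xs; have : inl x \in claim1 H (Vs s) by apply: imset_f.
  rewrite -cover; last by rewrite cK cD cV; move: r3 rk; clear; lia.
  rewrite Ded !in_setU -orbA => /or3P[] /imsetP[z zK].
  - by case=> ->; constructor 1.
  - by move=> ->; constructor 2; exists z.
  - by move: zK; rewrite inE => /eqP-> ->; constructor 3.
have onK x f : x \in Vs s -> f \in off_edges s y -> x \in val f -> x \in K s y.
  move=> xs fF xf; apply: contraT => nK; have : f \in S s y.
    by rewrite inE fF; apply/existsP; exists x; rewrite xs xf nK.
  by rewrite S0 inE.
have inj := next_inj cy.
have memV x : x \in Vs s -> inl x \in s by rewrite inE.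
(* There are [k - 1] thick vertices and at most [r - 1] cycle vertices in [ed], out of
   [2 * k - 1]. *)
have [x [xs xK xed]] : exists x, [/\ x \in Vs s, x \notin K s y & x \notin val ed].
  have /card_gt0P[x] : 0 < #|Vs s :\: (K s y :|: (val ed :\ y))|.
    have c1 := cardsD1 y (val ed); rewrite yed (card_edge unif) in c1.
    have c2 := cardsU (K s y) (val ed :\ y).
    have c3 := cardsD (Vs s) (K s y :|: (val ed :\ y)).
    have c4 := subset_leq_card (subsetIr (Vs s) (K s y :|: (val ed :\ y))).
    by move: c1 c2 c3 c4; rewrite cV cK; move: r3 rk; clear; lia.
  rewrite !in_setD in_setU !negb_or in_setD1 negb_and negbK -andbA => /and3P[nK /orP[/eqP->|ned] xs].
    by move: xs; rewrite inE (negPf ys).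
  by exists x.
have [a aK Ea] : exists2 a, a \in K s y & inl x = next s (next s (inl a)).
  case: (cover x xs) => [xK'|//|Ex]; first by rewrite xK' in xK.
  by have := next_edge cy eds; rewrite -Ex /= (negPf xed).
have as_ := subsetP (thick_sub _ _) a aK.
have [e1 Ee1 e1s] := nx_V cy (memV _ as_) isT; have [e2 Ee2 e2s] := nx_V cy (memV _ xs) isT.
have e2s' : inr e2 \in s by rewrite inE in e2s.
have [b Eb bs] := nx_E cy e2s' isT.
(* No other claim is possible: [x] is not thick, and [e2 = ed] would put [x] into [ed]. *)
have bK : b \in K s y.
  case: (cover b bs) => [//|[a' a'K]|]; rewrite -Eb -Ee2.
    by move/inj/inj => [Ex]; rewrite Ex a'K in xK.
  move/inj => Ex; have := next_edge cy (memV _ xs); rewrite Ex /= => xed'.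
  by rewrite xed' in xed.
have gt4 : 4 < size s by rewrite (ucyc_size cy) cV; move: r3 rk; clear; lia.
have [rest []] := ucyc_spine cy (memV _ as_) gt4.
rewrite -Ea Ee1 Ee2 Eb; set l := [:: _, _, _, _, _ & rest] => cl pl nl.
have [f2 f2F bf2] := thick_mem bK.
have [f1 [f1F af1 f12]] := thickP f2 aK.
have notl u : (u \notin l) = (u \notin s) by rewrite (perm_mem pl).
have off_l f : f \in off_edges s y -> inr f \notin l by move=> /off_edgesP[]; rewrite notl.
have yl : inl y \notin l by rewrite notl.
have ins3 f f' : f \in off_edges s y -> f' \in off_edges s y -> f != f' ->
    uniq ([:: inr f; inl y; inr f'] : seq node) /\
    (forall u : node, u \in [:: inr f; inl y; inr f'] -> u \notin l).
  move=> fF f'F ff'; split; first by rewrite /= !inE /= andbT; apply: contra ff' => /eqP[->].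
  by move=> u; rewrite !inE => /or3P[] /eqP->; rewrite ?yl ?off_l.
have [yf1 _] := off_edgesP f1F; have [yf2 _] := off_edgesP f2F.
have [u12 n12] := ins3 _ _ f1F f2F f12.
have cy' : ucyc g [:: inl a, inr f1, inl y, inr f2, inl b & rest].
  by apply: (ucyc_replace cl _ u12 n12); rewrite /= af1 yf1 yf2 bf2.
have sz' : size [:: inl a, inr f1, inl y, inr f2, inl b & rest] = N.
  by rewrite -sz -(perm_size pl).
have ul : uniq l by case/andP: cl.
have xs' : inl x \notin [:: inl a, inr f1, inl y, inr f2, inl b & rest].
  have xy : inl x != inl y :> node by apply: contraTneq (memV _ xs) => ->; rewrite (negPf ys).
  have := ul; rewrite /l /= => /and4P[na _ nx _].
  have xa : inl x != inl a :> node.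
    by apply: contraNneq na => ->; rewrite !inE eqxx ?orbT.
  move: nx; rewrite !inE !negb_or => /and3P[_ xb xr].
  by rewrite xa xy xb xr.
(* No edge of [off_edges s y] contains [x], so [e] is neither [f1] nor [f2] and lies on the old
   cycle too. *)
have [e eD] := near_on_edge cy' sz' xs'.
have [xe es] := on_edgesP eD.
have xf f : f \in off_edges s y -> x \notin val f.
  by move=> fF; apply: contra xK; apply: onK.
have ne f : f \in off_edges s y -> e != f by move/xf; apply: contraNneq => <-.
have erest : inr e \in rest.
  move: es; rewrite !inE /= => /or3P[/eqP[Ef]|/eqP[Ef]|//].
    by have := ne _ f1F; rewrite Ef eqxx.
  by have := ne _ f2F; rewrite Ef eqxx.
have [r1 [r2 Er]] : exists r1 r2, rest = r1 ++ inr e :: r2.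
  by case/splitPr: erest => r1 r2; exists r1, r2.
have es' : inr e \in s by rewrite -(perm_mem pl) !inE erest !orbT.
have [q Eq qs] := nx_E cy es' isT.
pose P : seq node := [:: inr e1; inl x; inr e2; inl b] ++ r1.
have lP : l = inl a :: P ++ inr e :: r2 by rewrite /l Er.
have ulP : uniq (inl a :: P ++ inr e :: r2) by rewrite -lP.
have qE : head (inl a) r2 = inl q.
  rewrite -Eq -nl lP; case: (r2) ulP => [|q0 r2'] ulP.
    by have := next_last ulP; rewrite last_cat [last _ [:: _]]/= => ->.
  by rewrite -cat_cons next_cat.
have pE : next s (last (inl b) r1) = inr e.
  have <- : last (inl a) P = last (inl b) r1 by rewrite /P last_cat.
  rewrite -nl lP; case/lastP: (P) ulP => [|P' p] ulP; first by rewrite (@next_cat _ [::]).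
  by rewrite cat_rcons -cat_cons in ulP *; rewrite last_rcons next_cat.
have szN A : ucyc g A -> size A = (size l).+2 -> False.
  by move=> /maxN le EA; move: le; rewrite EA (perm_size pl) sz; clear; lia.
have cl' := cl; rewrite /l Er in cl'; rewrite /l Er in ins3.
have gxe : g (inl x) (inr e) by [].
(* The neighbours of [e] on the cycle are [p] and [q]. Since [x] is in [e] but not in [ed], whatever
   claims [q] makes [q] or [p] thick. *)
have [qK|pK] : q \in K s y \/ exists2 p, p \in K s y & last (inl b) r1 = inl p.
  case: (cover q qs) => [qK|[a' a'K]|]; rewrite -?Eq; first by left.
    by move/inj => Ee; right; exists a' => //; apply: inj; rewrite pE Ee.
  by move/inj => [Ee]; rewrite -Ee xe in xed.
- have [f' [f'F qf' f'2]] := thickP f2 qK; rewrite eq_sym in f'2.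
  have [uu nn] := ins3 _ _ f2F f'F f'2; have [yf' _] := off_edgesP f'F.
  have := @ucyc_cross1 _ _ (@inc_sym T H) _ _ _ _ _ _ _ _ _ _ _ cl' gxe _ uu nn.
  rewrite qE /= bf2 yf2 yf' qf' => /(_ isT)/szN; apply.
  by rewrite /l Er /= ?size_cat /= ?size_cat ?size_rev /= ?size_cat /=; clear; lia.
- case: pK => p pK Ep; have [f' [f'F pf' f'1]] := thickP f1 pK; rewrite eq_sym in f'1.
  have [uu nn] := ins3 _ _ f1F f'F f'1; have [yf' _] := off_edgesP f'F.
  have := @ucyc_cross2 _ _ (@inc_sym T H) _ _ _ _ _ _ _ _ _ _ _ cl' gxe _ uu nn.
  rewrite Ep /= af1 yf1 yf' pf' => /(_ isT)/szN; apply.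
  by rewrite /l Er /= ?size_cat /= ?size_cat ?size_rev /= ?size_cat /=; clear; lia.
Qed.

Lemma leq_cardI (A : finType) (B C D : {set A}) : B \subset D -> C \subset D ->
  #|B| + #|C| <= #|D| + #|B :&: C|.
Proof.
by move=> sB sC; rewrite -cardsUI leq_add2r; apply: subset_leq_card; rewrite subUset sB.
Qed.

Section Ends.

Variables (s : seq node) (y : T).
Hypotheses (cy : ucyc g s) (gt2 : 2 < size s) (ys : inl y \notin s).

Lemma edge_ends (e : E) : inr e \in s -> exists p q, [/\ p \in Vs s, q \in Vs s, p != q
  & [/\ next s (inl p) = inr e, next s (inr e) = inl q, p \in val e & q \in val e]].
Proof.
move=> es; have [q Eq qs] := nx_E cy es isT.
have us : prev s (inr e) \in s by rewrite mem_prev.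
have nu : next s (prev s (inr e)) = inr e by rewrite next_prev //; case/andP: cy.
case Eu: (prev s (inr e)) us nu => [p|f] us nu; last by have := nx_isV cy us; rewrite nu.
exists p, q; split=> //; first by rewrite inE.
  by have := next2_neq cy us gt2; rewrite nu Eq; apply: contra => /eqP->.
split=> //; first by have := next_edge cy us; rewrite nu.
by have := next_edge cy es; rewrite Eq.
Qed.

Definition ends (z : T) : {set E} :=
  [set e | (next s (inr e) == inl z) || (next s (inl z) == inr e)].

Lemma card_ends z : #|ends z| <= 2.
Proof.
have -> : ends z = [set e : E | next s (inr e) == inl z] :|: [set e : E | next s (inl z) == inr e].
  by apply/setP => e; rewrite !inE.
rewrite cardsU; apply: leq_trans (leq_subr _ _) _; apply: (@leq_add _ _ 1 1).
  apply/card_le1_eqP => e f; rewrite !inE => /eqP Ee /eqP Ef.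
  by apply/inr_inj/(next_inj cy); rewrite Ee Ef.
by apply/card_le1_eqP => e f; rewrite !inE => /eqP -> /eqP[].
Qed.

(** A cycle edge contains its two neighbours on the cycle; they are outside [Z] when it is an end of
    no vertex of [Z]. With [y] they make up the summand 3. *)
Lemma edge_large (Z : {set T}) (e : E) : Z \subset Vs s -> inr e \in s -> y \in val e ->
  Z \subset val e -> (forall z, z \in Z -> e \notin ends z) -> #|Z| + 3 <= r.
Proof.
move=> sZ es ye sZe nends; have [p [q [ps qs pq [np nq pe qe]]]] := edge_ends es.
rewrite -(card_edge unif e).
have -> : #|Z| + 3 = #|y |: (p |: (q |: Z))|.
  have qZ : q \notin Z by apply/negP => /nends; rewrite inE nq eqxx.
  have pZ : p \notin Z by apply/negP => /nends; rewrite inE np eqxx orbT.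
  have yV x : x \in Vs s -> y != x.
    by move=> xs; apply: contraTneq xs => <-; rewrite inE.
  rewrite !cardsU1 !inE (negPf pq) (negPf qZ) (negPf pZ) (negPf (yV p ps)) (negPf (yV q qs)) /=.
  have -> : y \notin Z by apply/negP => /(subsetP sZ)/yV; rewrite eqxx.
  by clear; lia.
by apply: subset_leq_card; rewrite !subUset !sub1set ye pe qe sZe.
Qed.

End Ends.

(** So many cycle edges contain [y] that some cycle vertices have both neighbours among them. Such a
    vertex can be exchanged for [y], hence lies in as many cycle edges as [y] must, and edges shared
    by [y] and these vertices turn out to be too large. *)
Lemma near_not_big (s : seq node) y : ucyc g s -> size s = N -> inl y \notin s ->
  k <= 6 -> 'C(k - 1, r - 1) <= #|on_edges s y| -> False.
Proof.
move=> cy sz ys k6 Dy; have gt2 := longest_gt2 cy sz ys.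
have szc := ucyc_size cy; have cE := ucyc_card cy.
pose D := on_edges s y; pose B := 'C(k - 1, r - 1).
have sD : D \subset Es s by apply: subsetIr.
have inj := next_inj cy.
(* The vertices whose two neighbours on the cycle both contain [y]; the exchange for [y] leaves the
   edges of the cycle unchanged. *)
pose P := [set z in Vs s | [exists e in D, exists e' in D,
  (next s (inr e) == inl z) && (next s (inl z) == inr e')]].
have bigP z : z \in P -> B <= #|edges_at z :&: Es s|.
  rewrite inE => /andP[zs /existsP[e /andP[eD /existsP[e' /and3P[e'D /eqP Ez /eqP Ee']]]]].
  have [ye es] := on_edgesP eD; have [ye' es'] := on_edgesP e'D.
  have gt4 : 4 < size s.
    have := subset_leq_card sD; rewrite -cE; move: Dy degree_gt6 szc; rewrite /D; clear; lia.
  have [rest []] := ucyc_spine cy es gt4; rewrite Ez Ee'.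
  set l := [:: _, _, _, _, _ & rest] => cl pl nl.
  pose l' : seq node := [:: inr e, inl y & behead (behead l)].
  have yl : inl y \notin l by rewrite (perm_mem pl).
  have ul : uniq l by case/andP: cl.
  have cl' : ucyc g l'.
    case/andP: (cl) => cyc _; apply/andP; split; first by move: cyc; rewrite /= ye ye' => /and3P[].
    apply: (uniq_insert ul (_ : uniq [:: inl y])) => //; first by move=> u; rewrite inE => /eqP->.
    by exists [:: inl z]; rewrite /l' /l; perm_by_count.
  have sl' : size l' = N by rewrite -sz -(perm_size pl).
  have zy : z != y by apply: contraTneq zs => ->; rewrite inE.
  have zl' : inl z \notin l'.
    move: ul; rewrite /l /= => /and3P[_ nz _].
    rewrite /l' !inE /= !negb_or in nz *; case/and3P: nz => n1 n2 n3.
    by rewrite n1 n2 n3 !andbT; apply: contra zy => /eqP[->].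
  have El' : Es l' = Es s.
    by apply/setP => f; rewrite !inE -(perm_mem pl) !inE.
  have Dz : on_edges l' z = edges_at z :&: Es s by rewrite /on_edges El'.
  case: (near_cases cl' sl' zl') => [[_ _ D1 _]|[_]]; last by rewrite Dz.
  have : 1 < #|on_edges l' z|.
    apply/card_gt1P; exists e, e'; split.
    - by rewrite Dz !inE es -[z \in _]/(g (inr e) (inl z)) -Ez next_edge.
    - by rewrite Dz !inE es' -[z \in _]/(g (inl z) (inr e')) -Ee' next_edge //; rewrite inE in zs.
    - by move: ul => /= /andP[]; rewrite !inE !negb_or => /and3P[_ + _] _; apply: contra => /eqP->.
  by rewrite D1.
have cP : 2 * #|D| <= #|Es s| + #|P|.
  pose D2 : {set node} := (fun e => next s (next s (inr e))) @: D.
  have cD2 : #|D2| = #|D| by apply: card_imset => e f E2; apply/inr_inj/inj/inj.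
  have cD1 : #|[set (inr e : node) | e in D]| = #|D| by apply/card_imset/inr_inj.
  have cEs : #|[set (inr e : node) | e in Es s]| = #|Es s| by apply/card_imset/inr_inj.
  have s1 : D2 \subset [set (inr e : node) | e in Es s].
    apply/subsetP => _ /imsetP[e /on_edgesP[_ es] ->].
    have [z Ez zs] := nx_E cy es isT; rewrite Ez; rewrite inE in zs.
    by have [f -> fs] := nx_V cy zs isT; apply: imset_f.
  have s2 : [set (inr e : node) | e in D] \subset [set (inr e : node) | e in Es s] by apply: imsetS.
  have := leq_cardI s1 s2; rewrite cD1 cD2 cEs => h.
  suff : #|D2 :&: [set (inr e : node) | e in D]| <= #|P| by move: h; clear; lia.
  have cPi : #|[set next s (inl z) | z in P]| = #|P|.
    by apply: card_imset => e f E2; apply/inl_inj/inj.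
  rewrite -cPi; apply: subset_leq_card; apply/subsetP => u /setIP[/imsetP[e eD ->] /imsetP[f fD Ef]].
  have [_ es] := on_edgesP eD; have [z Ez zs] := nx_E cy es isT.
  rewrite Ez; apply: imset_f; rewrite inE zs; apply/existsP; exists e; rewrite eD /=.
  by apply/existsP; exists f; rewrite fD Ez eqxx -Ef Ez eqxx.
have leE : #|Es s| <= 2 * k - 1 by rewrite -cE; move: szc sz leN; clear; lia.
have km : (k == 5) || (k == 6) by move: k6 r3 rk; clear; lia.
(* The case [k = 5] forces [r = 3]; for [k = 6], both [r = 3] and [r = 4] give the same binomial. *)
have Eb : (k == 5) && (r == 3) && (B == 6) || (k == 6) && (r <= 4) && (B == 10).
  rewrite /B; case/orP: km => /eqP Ek; rewrite Ek; move: rk r3; rewrite Ek.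
    by case: (r) => [|[|[|[|r']]]] //; clear; lia.
  by case: (r) => [|[|[|[|[|r']]]]] //; clear; lia.
have leB : B <= #|D| := Dy.
have PV z : z \in P -> z \in Vs s by rewrite inE => /andP[].
have Dsub z : D :&: (edges_at z :&: Es s) = D :&: edges_at z.
  by apply/setP => e; rewrite !inE; case: (inr e \in s); rewrite ?andbT ?andbF.
have [z1 z1P] : exists z, z \in P.
  by apply/card_gt0P; move: cP leE leB Eb; clear; lia.
have h1 := leq_cardI sD (subsetIr (edges_at z1) (Es s)).
have b1 := bigP _ z1P; rewrite Dsub in h1.
have e1 := card_ends cy z1.
have mem1 (e : E) : e \in D -> [/\ y \in val e & inr e \in s] by move/on_edgesP => [].
(* A common cycle edge of [y] and [z1] that is not next to [z1] has at least four vertices. For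
   [r = 4] a second vertex [z2] of [P] later yields an edge with five. *)
have r4 : r = 4.
  have /card_gt0P[e] : 0 < #|(D :&: edges_at z1) :\: ends s z1|.
    have := cardsD (D :&: edges_at z1) (ends s z1).
    have := subset_leq_card (subsetIr (D :&: edges_at z1) (ends s z1)).
    by move: h1 b1 e1 leE leB Eb; clear; lia.
  case/setDP => /setIP[/mem1[ye es] z1e] ne.
  have := @edge_large s y cy gt2 ys [set z1] e.
  rewrite sub1set (PV _ z1P) sub1set cards1; rewrite inE in z1e => /(_ isT es ye z1e).
  have nends z : z \in [set z1] -> e \notin ends s z by rewrite inE => /eqP->.
  by move=> /(_ nends); move: Eb rk; clear; lia.
have [z2 z2P z21] : exists2 z, z \in P & z != z1.
  by apply: two_members; move: cP leE leB Eb r4; clear; lia.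
have b2 := bigP _ z2P; have e2 := card_ends cy z2.
have sub12 : D :&: edges_at z1 \subset Es s by apply: subset_trans (subsetIl _ _) sD.
have h2 := leq_cardI sub12 (subsetIr (edges_at z2) (Es s)).
have /card_gt0P[e] : 0 < #|(D :&: edges_at z1 :&: edges_at z2) :\: (ends s z1 :|: ends s z2)|.
  have <- : D :&: edges_at z1 :&: (edges_at z2 :&: Es s) = D :&: edges_at z1 :&: edges_at z2.
    by apply/setP => e; rewrite !inE; case: (inr e \in s); rewrite ?andbT ?andbF.
  set X := _ :&: _ :&: _; have := cardsD X (ends s z1 :|: ends s z2).
  have := subset_leq_card (subsetIr X (ends s z1 :|: ends s z2)).
  have := cardsU (ends s z1) (ends s z2).
  by move: h1 h2 b1 b2 e1 e2 leE leB Eb r4; rewrite -/X; clear; lia.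
case/setDP => /setIP[/setIP[/mem1[ye es] z1e] z2e].
rewrite in_setU negb_or => /andP[n1 n2].
have := @edge_large s y cy gt2 ys [set z1; z2] e.
rewrite !subUset !sub1set (PV _ z1P) (PV _ z2P) cards2 eq_sym z21.
rewrite inE in z1e; rewrite inE in z2e; rewrite z1e z2e => /(_ isT es ye isT).
have nends z : z \in [set z1; z2] -> e \notin ends s z by rewrite in_set2 => /orP[] /eqP->.
by move=> /(_ nends); rewrite r4.
Qed.

Lemma near_empty (s : seq node) y : ucyc g s -> size s = N -> inl y \in s.
Proof.
move=> cy sz; apply/negPn/negP => ys.
case: (near_cases cy sz ys) => [[h1 h2 h3 h4]|[h1 h2]].
  exact: near_not_tight h1 h2 h3 h4.
exact: near_not_big h1 h2.
Qed.

End Incidence.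

(** * Links of a lollipop to its cycle *)

Section Incidence.

Variables (T : finType) (H : {set {set T}}).

Local Notation E := {e : {set T} | e \in H}.
Local Notation node := (T + E)%type.
Local Notation g := (@incidence_graph T H).
Local Notation isV := (@isV T H).
Local Notation Vs := (@Vs T H).
Local Notation Es := (@Es T H).
Local Notation gC := (@inc_sym T H).

Variables (N L : nat).
Hypothesis maxN : forall s : seq node, ucyc g s -> size s <= N.
Hypothesis maxL : forall (a : node) (c t : seq node), lolli g a c t -> size (a :: c) = N ->
  isV (last a t) -> size t <= L.

Definition best (a : node) (c t : seq node) (y : T) :=
  [/\ lolli g a c t, size (a :: c) = N, last a t = inl y & size t = L].

Section Best.

Variables (a : node) (c t : seq node) (y : T).
Hypotheses (bt : best a c t y) (L0 : 0 < L).

Definition out_edges : {set E} := off_edges (a :: c) y :\: Es t.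

(* The index bounds hold for every edge off the lollipop, by rerouting the cycle
   through the tail; the point is to have them for tail edges as well. *)
Definition good (f : E) := forall w, w \in val f ->
  inl w \in a :: c ++ t /\
  (inl w \in c -> [/\ isV a, L < index (inl w : node) c & L + index (inl w : node) c < (size c).-1]).

Lemma out_edgesP f : f \in out_edges -> [/\ y \in val f, inr f \notin a :: c & inr f \notin t].
Proof. by case/setDP => /off_edgesP[yf fc]; rewrite in_Es. Qed.

Lemma out_edgesI (f : E) : y \in val f -> inr f \notin a :: c -> inr f \notin t -> f \in out_edges.
Proof.
move=> yf fc ft; rewrite in_setD in_Es ft /=.
by rewrite in_setD in_Es fc inE.
Qed.

Lemma best_y_notin : inl y \notin a :: c.
Proof.
have [lol _ ly szt] := bt; apply: (lolli_notin lol); rewrite -ly.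
by move: szt L0; case: (t) => [<-|b t' _ _] //; rewrite /= mem_last.
Qed.

Lemma out_good f : f \in out_edges -> good f.
Proof.
move=> fO; have [yf fc ft] := out_edgesP fO; have [lol szN ly szt] := bt.
have fact : inr f \notin a :: c ++ t by rewrite -cat_cons mem_cat negb_or fc.
move=> w wf; have wact : inl w \in a :: c ++ t.
  apply: contraT => nw; have lol' : lolli g a c (t ++ [:: inr f; inl w]).
    by apply: lolli_extend lol _ _ _ _ _; rewrite ?ly.
  have := maxL lol' szN; rewrite last_cat size_cat /= szt => /(_ isT).
  by clear; lia.
split=> // wc.
have [h1 h2] : size t + size [:: inr f : node] <= index (inl w : node) c /\
    size t + size [:: inr f : node] + index (inl w : node) c < size c.
  apply: (tail_link_index gC maxN szN lol wc); rewrite ?ly //= ?yf ?wf //.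
  by move=> u; rewrite inE => /eqP->.
split; rewrite -?szt; [|by move: h1 => /=; clear; lia|by move: h2 => /=; clear; lia].
(* If [a] were an edge, the cycle could be left at [w] instead: [f] followed by the reversed tail
   has [L + 1] nodes and ends at the first node of [t], a vertex. *)
apply: contraT => aE; have /and4P[cy pt ut /allP dt] := lol.
have wac : inl w \in a :: c by rewrite inE wc orbT.
have [c2 cy2 pc2] := ucyc_from cy wac.
case/lastP Et: t => [|t0 z]; first by move: szt L0; rewrite Et /= => <-.
have zy : z = inl y by rewrite -ly Et last_rcons.
have lol' : lolli g (inl w) c2 (inr f :: rev t).
  apply/and4P; split=> //.
  - rewrite Et rev_rcons zy /= wf yf /=.
    move: pt; rewrite Et zy; case: (t0) => [//|b t1] /= /andP[_].
    by rewrite path_rcons_rev ?rev_cons //; exact: gC.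
  - by rewrite cons_uniq rev_uniq mem_rev ft ut.
  - by apply/allP => u; rewrite inE mem_rev /= (perm_mem pc2) => /orP[/eqP->|/dt].
have := maxL lol'; rewrite -szN -(perm_size pc2) => /(_ erefl) h.
suff hl : isV (last (inl w) (inr f :: rev t)) by have := h hl; rewrite /= size_rev szt; clear; lia.
move: pt szt L0; case: (t) => [|b t1] /=; first by move=> _ <-.
case/andP=> /inc_parity Eb _ _ _; rewrite rev_cons last_rcons.
by move: aE; rewrite -Eb.
Qed.

Lemma on_index e : e \in on_edges (a :: c) y -> inr e \in c ->
  L <= index (inr e : node) c /\ L + index (inr e : node) c < size c.
Proof.
move=> /on_edgesP[ye _] ec; have [lol szN ly szt] := bt; rewrite -szt.
have := @tail_link_index _ _ gC N a c t (inr e) [::] maxN szN lol ec.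
by rewrite ly /= ye addn0; apply.
Qed.

Lemma best_rotate s1 e t2 (f : E) : t = s1 ++ inr e :: t2 -> y \in val f ->
    g (last a s1) (inr f) -> f = e \/ f \in out_edges ->
  exists x t3, [/\ t2 = inl x :: t3, x \in val e, best a c (s1 ++ inr f :: rev t2) x
    & Vs (s1 ++ inr f :: rev t2) = Vs t].
Proof.
move=> Et yf gf fO; have [lol szN ly szt] := bt.
case: t2 Et => [|b t3] Et; first by move: ly; rewrite Et last_cat.
have /and4P[_ pt _ _] := lol.
have geb : g (inr e) b by move: pt; rewrite Et cat_path => /and3P[_ _ /andP[]].
case: b geb Et => // x xe Et; exists x, t3; split=> //; last first.
  apply/setP => w; rewrite !in_Vs Et !(mem_cat, inE) mem_rev !inE /=.
  done.
split=> //.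
- rewrite Et in lol; apply: (lolli_rotate gC lol) => //.
    by move: ly; rewrite Et last_cat /= => ->.
  case: fO => [->|/out_edgesP[_ fc ft]]; [by left | right].
  by rewrite -cat_cons mem_cat negb_or fc /= -Et.
- by rewrite last_cat /= rev_cons last_rcons.
- by rewrite -szt Et !size_cat /= size_rev.
Qed.

End Best.

(** * Positions of the links on the cycle *)

Section Count.

Variables (a : node) (c t : seq node) (y : T).
Hypotheses (bt : best a c t y) (L0 : 0 < L).

(** Rotating with the outside edge [f] takes [e] off the tail, so that [out_good] applies to it at
    the new end. The tail keeps its vertices, hence the conclusion carries back. *)
Lemma rot_good s1 (e : E) t2 (f : E) : t = s1 ++ inr e :: t2 -> y \in val e ->
  f \in out_edges a c t y -> g (last a s1) (inr f) -> good a c t e.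
Proof.
move=> Et ye fO gf; have [yf fc ft] := out_edgesP fO.
have [x [t3 [Et2 xe bt' EV]]] := best_rotate bt Et yf gf (or_intror fO).
have [lol szN ly szt] := bt; have /and4P[_ _ ut _] := lol.
have eO : e \in out_edges a c (s1 ++ inr f :: rev t2) x.
  have et : inr e \in t by rewrite Et mem_cat inE eqxx orbT.
  apply: (out_edgesI xe (lolli_notin lol et)); rewrite mem_cat inE mem_rev.
  move: ut; rewrite Et (perm_uniq (perm_middle _ _ _)) /= mem_cat => /andP[+ _].
  rewrite !negb_or => /andP[-> ->]; rewrite andbT /=.
  by apply: contra ft => /eqP[<-].
move=> w we; have [h1 h2] := out_good bt' L0 eO we.
split=> //; move: h1; rewrite -!cat_cons !(mem_cat _ (a :: c)).
by rewrite -(in_Vs (_ ++ _)) EV in_Vs.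
Qed.

Lemma size_c_odd : size c = (2 * #|Vs (a :: c)|).-1 /\ 0 < #|Vs (a :: c)|.
Proof.
have [/and4P[cy _ _ _] _ _ _] := bt; have := ucyc_size cy; rewrite /=.
by clear; lia.
Qed.

Lemma parity_c u : u \in c -> odd (index u c + L) = isV u.
Proof.
move=> uc; have [/and4P[/andP[cy _] pt _ _] _ ly szt] := bt.
have pc : path g a c by move: cy; rewrite /= rcons_path => /andP[].
have := index_parity pc uc; have := path_parity pt; rewrite ly szt oddD.
by case: (isV a); case: (odd L); case: (odd _); case: (isV u).
Qed.

Lemma chord_off u v w : u \in c -> v \in c -> index u c < index v c ->
  path g u (rcons w v) -> uniq w -> (forall z, z \in w -> z \notin a :: c) ->
  size w + index u c < index v c.
Proof.
by have [/and4P[cy _ _ _] szN _ _] := bt; apply: (chord_index maxN szN cy).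
Qed.

Definition inner_edges : {set E} := on_edges (a :: c) y :&: Es c.

(* Links to the cycle have positions of fixed parity between [L] and [size c - L]. *)
Definition cpos (z : node) := (index z c - L)./2.

Lemma cpos_V x f : good a c t f -> x \in val f -> inl x \in c ->
  index (inl x : node) c = L + 1 + 2 * cpos (inl x) /\ cpos (inl x) + 1 + L < #|Vs (a :: c)|.
Proof.
move=> fg xf xc; have [Ec c0] := size_c_odd; have [_ /(_ xc)[_ l1 l2]] := fg x xf.
have od : odd (index (inl x : node) c + L) by rewrite parity_c.
move: od l1 l2 Ec xc; rewrite /cpos; move: (index (inl x : node) c) (size c) #|_|.
by clear => i n m od l1 l2 Ec xc; split=> //; lia.
Qed.

Lemma cpos_E e : e \in inner_edges -> [/\ inr e \in c,
  index (inr e : node) c = L + 2 * cpos (inr e) & cpos (inr e) + L < #|Vs (a :: c)|].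
Proof.
have [Ec c0] := size_c_odd.
case/setIP => eD; rewrite in_Es => ec; have [l1 l2] := on_index bt eD ec.
have od : ~~ odd (index (inr e : node) c + L) by rewrite parity_c.
move: od l1 l2 Ec ec; rewrite /cpos; move: (index (inr e : node) c) (size c) #|_|.
by clear => i n m od l1 l2 Ec ec; split=> //; lia.
Qed.

(** Counterpart of [card_claims] for a lollipop. A vertex takes two consecutive positions, because
    the detour [f, y, f'] between two of them has three nodes. If there were no link, [L] could
    exceed the number of cycle vertices; hence the last hypothesis. *)
Lemma count_links (W : {set T}) : W \subset Vs c ->
    (forall x, x \in W -> exists f, [/\ f \in off_edges (a :: c) y, x \in val f & good a c t f]) ->
    (forall x x', x \in W -> x' \in W -> x != x' -> exists f f',
      [/\ f \in off_edges (a :: c) y, f' \in off_edges (a :: c) y, f != f', x \in val f & x' \in val f']) ->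
    0 < #|W| + #|inner_edges| ->
  L + 2 * #|W| + #|inner_edges| <= #|Vs (a :: c)| /\
  (L + 2 * #|W| + #|inner_edges| = #|Vs (a :: c)| -> forall i, i + L < #|Vs (a :: c)| ->
    (exists2 x, x \in W & i = cpos (inl x) \/ i = (cpos (inl x)).+1) \/
    (exists2 e, e \in inner_edges & i = cpos (inr e))).
Proof.
move=> /subsetP sW h1 h2 pos; have [Ec c0] := size_c_odd.
have yac := best_y_notin bt L0.
have WV x : x \in W -> [/\ inl x \in c, index (inl x : node) c = L + 1 + 2 * cpos (inl x)
    & cpos (inl x) + 1 + L < #|Vs (a :: c)|].
  move=> xW; have xc : inl x \in c by have := sW x xW; rewrite in_Vs.
  by have [f [_ xf fg]] := h1 x xW; have [] := cpos_V fg xf xc.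
have DV := cpos_E.
move: cpos WV DV => u WV DV.
have VV x x' : x \in W -> x' \in W -> index (inl x : node) c < index (inl x' : node) c ->
    index (inl x : node) c + 3 < index (inl x' : node) c.
  move=> xW x'W lt; have [xc _ _] := WV x xW; have [x'c _ _] := WV x' x'W.
  have xx' : x != x' by apply: contraTneq lt => ->; rewrite ltnn.
  have [f [f' [/off_edgesP[yf fc] /off_edgesP[yf' fc'] ff' xf xf']]] := h2 x x' xW x'W xx'.
  rewrite addnC; apply: (@chord_off _ _ [:: inr f; inl y; inr f']) => //=.
  - by rewrite xf yf yf' xf'.
  - by rewrite !inE /= andbT; apply: contra ff' => /eqP[->].
  - by move=> z; rewrite !in_cons in_nil orbF => /or3P[] /eqP->.
have VE x e : x \in W -> e \in inner_edges ->
    u (inl x) != u (inr e) /\ (u (inl x)).+1 != u (inr e).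
  move=> xW eD; have [xc Ex _] := WV x xW; have [ec Ee _] := DV e eD.
  have [f [/off_edgesP[yf fc] xf _]] := h1 x xW.
  have [ye _] : y \in val e /\ inr e \in a :: c by case/setIP: eD => /on_edgesP.
  have lt1 : index (inl x : node) c < index (inr e : node) c ->
      2 + index (inl x : node) c < index (inr e : node) c.
    move=> lt; apply: (@chord_off _ _ [:: inr f; inl y]) => //=; rewrite ?xf ?yf ?ye //.
    by move=> z; rewrite !in_cons in_nil orbF => /orP[] /eqP->.
  have lt2 : index (inr e : node) c < index (inl x : node) c ->
      2 + index (inr e : node) c < index (inl x : node) c.
    move=> lt; apply: (@chord_off _ _ [:: inl y; inr f]) => //=; rewrite ?xf ?yf ?ye //.
    by move=> z; rewrite !in_cons in_nil orbF => /orP[] /eqP->.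
  by move: Ex Ee lt1 lt2; clear; lia.
pose l := [seq u (inl x) | x <- enum W] ++ [seq (u (inl x)).+1 | x <- enum W]
  ++ [seq u (inr e) | e <- enum inner_edges].
have injV x x' : x \in W -> x' \in W -> u (inl x) = u (inl x') -> x = x'.
  move=> xW x'W Eu; have [xc Ex _] := WV x xW; have [x'c Ex' _] := WV x' x'W.
  have : index (inl x : node) c = index (inl x' : node) c by rewrite Ex Ex' Eu.
  by move/(index_eq xc x'c) => [].
have ul : uniq l.
  rewrite /l !cat_uniq; apply/and5P; split.
  - by rewrite map_inj_in_uniq ?enum_uniq // => x x' /[!mem_enum]; apply: injV.
  - rewrite has_cat negb_or; apply/andP; split; apply/hasPn => i /mapP[z /[!mem_enum] zW ->];
      apply/mapP => -[x /[!mem_enum] xW] Eu; last first.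
      by have [] := VE x z xW zW; rewrite Eu eqxx.
    have [xc Ex _] := WV x xW; have [zc Ez _] := WV z zW.
    have := VV z x zW xW; move: Ex Ez Eu; clear; lia.
  - by rewrite map_inj_in_uniq ?enum_uniq // => x x' /[!mem_enum] xW x'W [/injV]; apply.
  - apply/hasPn => i /mapP[e /[!mem_enum] eD ->]; apply/mapP => -[x /[!mem_enum] xW Eu].
    by have [_] := VE x e xW eD; rewrite -Eu eqxx.
  - rewrite map_inj_in_uniq ?enum_uniq // => e e' /[!mem_enum] eD e'D Eu.
    have [ec Ee _] := DV e eD; have [e'c Ee' _] := DV e' e'D.
    have : index (inr e : node) c = index (inr e' : node) c by rewrite Ee Ee' Eu.
    by move/(index_eq ec e'c) => [].
have sl : {subset l <= iota 0 (#|Vs (a :: c)| - L)}.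
  move=> i; rewrite /l !mem_cat mem_iota => /or3P[] /mapP[z /[!mem_enum] zW ->].
  - by have [_ _] := WV z zW; move: (u (inl z)); clear; lia.
  - by have [_ _] := WV z zW; move: (u (inl z)); clear; lia.
  - by have [_ _] := DV z zW; move: (u (inr z)); clear; lia.
have size_l : size l = 2 * #|W| + #|inner_edges|.
  rewrite /l !size_cat !size_map -!cardE.
  by move: #|W| #|inner_edges|; clear; lia.
split.
  have := uniq_leq_size ul sl; rewrite size_iota size_l.
  by move: pos; move: #|W| #|inner_edges| #|Vs (a :: c)|; clear; lia.
move=> El i lt_i.
have [|_ Eil] := uniq_min_size ul sl.
  by rewrite size_iota size_l; move: El; move: #|W| #|inner_edges| #|Vs (a :: c)|; clear; lia.
have : i \in l by rewrite Eil mem_iota; move: lt_i; move: #|Vs (a :: c)|; clear; lia.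
rewrite /l !mem_cat => /or3P[] /mapP[z /[!mem_enum] zW ->].
- by left; exists z => //; left.
- by left; exists z => //; right.
- by right; exists z.
Qed.

End Count.

End Incidence.

(** * Short tails: all edges at the end are good *)

Lemma index_split (U : eqType) (a u : U) s1 t2 : uniq (a :: s1 ++ u :: t2) ->
  index (last a s1) (a :: s1 ++ u :: t2) = size s1 /\ index u (s1 ++ u :: t2) = size s1.
Proof.
rewrite -cat_cons cat_uniq => /and3P[us1 /hasPn dis _].
have /negbTE us : u \notin s1.
  by have := dis u (mem_head _ _); rewrite inE => /norP[].
by split; rewrite index_cat ?mem_last ?index_last // us /= eqxx addn0.
Qed.

Section Incidence.

Variables (T : finType) (H : {set {set T}}).

Local Notation E := {e : {set T} | e \in H}.
Local Notation node := (T + E)%type.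
Local Notation g := (@incidence_graph T H).
Local Notation isV := (@isV T H).
Local Notation Vs := (@Vs T H).
Local Notation Es := (@Es T H).

Variables (k r N L : nat).
Hypotheses (r3 : 2 < r) (rk : r <= k - 2) (unif : uniform r H).
Hypothesis mindeg : forall y, 'C(k - 1, r - 1) + 1 <= degree H y.
Hypothesis maxN : forall s : seq node, ucyc g s -> size s <= N.
Hypothesis leN : N <= 2 * (2 * k - 1).
Hypothesis maxL : forall (a : node) (c t : seq node), lolli g a c t -> size (a :: c) = N ->
  isV (last a t) -> size t <= L.
Hypotheses (L3 : 2 < L).

Local Notation best := (@best T H N L).

Section Tail.

Variables (a : node) (c t : seq node) (y : T).
Hypothesis bt : best a c t y.

Local Notation base := (Vs (a :: t) :\ y).
Local Notation good := (@good T H L a c t).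

Lemma best_tail : [/\ path g a t, last a t = inl y, size t = L, uniq (a :: t)
  & forall u, u \in t -> u \notin a :: c].
Proof.
have [lol _ ly szt] := bt; have /and4P[_ pt ut _] := lol.
by split=> // [|u ut']; rewrite ?cons_uniq ?ut ?(lolli_notin lol) // andbT; apply/negP => /(lolli_notin lol);
  rewrite mem_head.
Qed.

Lemma y_tail : inl y \in t.
Proof.
have [_ ly szt _ _] := best_tail; rewrite -ly; move: szt L3; case: (t) => [<-|b t'] //= _ _.
exact: mem_last.
Qed.

Lemma best_V : #|Vs (a :: c)| <= 2 * k - 1.
Proof.
by have [/and4P[cy _ _ _] szN _ _] := bt; have := ucyc_size cy; rewrite szN;
  move: leN r3 rk; move: #|_|; clear; lia.
Qed.

Lemma tail_sizes : [/\ #|base| = L./2, #|Es t| = L./2 & odd L = ~~ isV a].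
Proof.
have [pt ly szt uat _] := best_tail; have := path_countV pt; have := path_parity pt.
have ut : uniq t by case/andP: uat.
have c1 := card_Vs uat; have := card_VsEs ut; rewrite (card_Vs ut) (card_Es ut).
have yb : y \in Vs (a :: t) by rewrite in_Vs inE y_tail orbT.
have := cardsD1 y (Vs (a :: t)); rewrite yb c1 ly szt /=.
move: #|_ :\ y| (count isV t) (count _ t) => x1 x2 x3.
case: (isV a); case: (odd L) (odd_double_half L) => //=; clear => *; split=> //; lia.
Qed.

Lemma tail_cycle : [disjoint Vs (a :: t) & Vs c].
Proof.
have [_ _ _ _ dt] := best_tail; have [/and4P[/andP[_ +] _ _ _] _ _ _] := bt.
rewrite cons_uniq => /andP[ac _]; apply: disjoint_of => w; rewrite !in_Vs inE.
by case/orP => [/eqP->//|/dt]; rewrite inE negb_or => /andP[].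
Qed.

Lemma tail_before v : inl v \in t -> 0 < index (inl v : node) t ->
  exists s1 e t2, t = s1 ++ inr e :: inl v :: t2 /\ v \in val e.
Proof.
move=> /split_index1[s1 [t2 [Et <- _]]]; case/lastP: s1 Et => // s1 b Et _.
have [pt _ _ _ _] := best_tail; move: pt; rewrite Et cat_rcons cat_path => /and4P[_ _ gb _].
by case: b gb Et => [//|e] ve _; exists s1, e, t2.
Qed.

Lemma tail_edge (f : E) : inr f \in t -> exists s1 t2 q z,
  [/\ t = s1 ++ inr f :: inl z :: t2, last a s1 = inl q, q \in val f & z \in val f].
Proof.
have [pt ly _ _ _] := best_tail.
case/split_index1 => s1 [[|z t2] [Et _ _]]; move: pt ly; rewrite Et; first by rewrite last_cat.
rewrite cat_path /= => /and4P[_ gf gz _] _.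
case El: (last a s1) gf => [q|//] qf; case: z gz Et => [z|//] zf Et.
by exists s1, t2, q, z.
Qed.

Lemma inner_le : #|on_edges (a :: c) y| <= #|inner_edges a c y| + ~~ isV a.
Proof.
case Ea: a => [v|e] /=; rewrite ?addn0 ?addn1.
  apply/subset_leq_card/subsetP => f fD; rewrite in_setI fD in_Es.
  by case/on_edgesP: fD => _; rewrite inE.
have : on_edges (inr e :: c) y \subset e |: inner_edges (inr e) c y.
  apply/subsetP => f fD; rewrite in_setU1 in_setI fD in_Es /=.
  by case/on_edgesP: fD => _; rewrite inE => /predU1P[[->]|->]; rewrite ?eqxx ?orbT.
move/subset_leq_card; rewrite cardsU1; case: (e \notin _) => /=; clear; lia.
Qed.

Section Core.

Variable F : {set E}.
Hypotheses (sF : F \subset off_edges (a :: c) y) (gF : {in F, forall f : E, good f}).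

Local Notation K := (thick (Vs c) F).
Local Notation S := (thin (Vs c) F).

Lemma core_E : ~~ isV a -> K = set0 /\ S = set0.
Proof.
move=> aE.
have no f x : f \in F -> x \in val f -> x \in Vs c -> False.
  move=> fF xf; rewrite in_Vs => xc; have [_ /(_ xc)[aV]] := gF fF xf.
  by rewrite aV in aE.
split; apply/setP => u; rewrite !in_set0; apply/negP.
  move=> uK; have [f fF uf] := thick_mem uK.
  by apply: (no f u fF uf); apply: (subsetP (thick_sub _ _) _ uK).
by rewrite inE => /andP[uF /existsP[x /and3P[xc xu _]]]; apply: (no u x).
Qed.

Hypothesis L2k : L <= 2 * k - 2.

(** Halving [L] accounts for the one cycle edge that has no position in [c], namely [a] itself: if
    [a] is an edge, [L] is odd and no edge of [F] meets [c]. *)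
Lemma core_count : 2 * (L./2 + #|K|) + 2 * #|S| + #|on_edges (a :: c) y| <= 2 * k - 1.
Proof.
have [W [sW cW h1 h2]] := thin_reps (Vs c) F.
have [_ _ pL] := tail_sizes; have LL := odd_double_half L; rewrite pL in LL.
have KS : ~~ isV a -> #|K| = 0 /\ #|S| = 0 by case/core_E => -> ->; rewrite !cards0.
have Vk := best_V; have iD := inner_le.
have [pos|pos] := posnP (#|W| + #|inner_edges a c y|).
  move: pos cW L2k KS LL iD; move: #|K| #|S| #|W| #|_| #|on_edges _ _| => x1 x2 x3 x4 x5.
  by case: (isV a) => h0 h5 h6 h7; [|have [//|-> ->] := h7]; move: h0 h5 h6 r3 rk; clear; lia.
have [|||h3 _] := @count_links T H N L maxN a c t y bt (ltnW (ltnW L3)) W sW; last 2 first.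
- exact: pos.
- move: h3 cW Vk KS LL iD; move: #|K| #|S| #|W| #|inner_edges _ _ _| #|on_edges _ _| #|_| => x1 x2 x3 x4 x5 x6.
  by case: (isV a) => h0 h5 h6 h7; [|have [//|-> ->] := h7]; move: h0 h5 h6; clear; lia.
- by move=> x /h1[f fF xf]; exists f; split=> //; [apply: (subsetP sF)|apply: gF].
- move=> x x' xW x'W /(h2 x x' xW x'W)[f [f' [fF f'F ff' xf xf']]].
  by exists f, f'; split=> //; apply: (subsetP sF).
Qed.

Lemma core_edges (A : {set T}) : A \subset base ->
    (forall f w, f \in F -> w \in val f -> inl w \in a :: t -> w != y -> w \in A) ->
  #|F| <= 'C(#|A| + #|K|, r - 1) + #|S| /\
  (#|F| = 'C(#|A| + #|K|, r - 1) -> S = set0 -> forall B : {set T},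
    B \subset A :|: K -> #|B| = r - 1 -> exists2 f, f \in F & val f = y |: B).
Proof.
move=> /subsetP sA FA; have [_ _ _ uat dt] := best_tail; have yac := best_y_notin bt (ltnW (ltnW L3)).
have yA : y \notin A by apply/negP => /sA; rewrite setD11.
have yc : y \notin Vs c by rewrite in_Vs; apply: contra yac; rewrite inE orbC => ->.
have [|h1 h2] := @card_thick_thin _ _ (Vs c) F A y r yA yc.
  move=> f fF; have /off_edgesP[yf fc] := subsetP sF f fF.
  split=> //; first exact: (card_edge unif).
  apply/subsetP => w wf; have [wact _] := gF fF wf; rewrite in_setU1 in_setU in_Vs.
  have [//|wy] := eqVneq w y; move: wact; rewrite -cat_cons mem_cat inE -orbA orbCA orbC.
  by case/orP => [|->]; rewrite ?orbT // => h; rewrite (FA f) // inE.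
have dK : [disjoint A & K].
  apply: disjoint_of => w /sA/setD1P[_ wt]; apply/negP => /(subsetP (thick_sub _ _)) wc.
  by have := pred0P tail_cycle w; rewrite /= wt wc.
rewrite -subn1 in h1 h2.
by have <- : #|A :|: K| = #|A| + #|K| by rewrite cardsU (disjoint_setI0 dK) cards0 subn0.
Qed.

End Core.

Lemma tail_pos (f : E) : inr f \in t -> exists q z, [/\ q \in val f /\ z \in val f,
    inl q \in a :: t, inl z \in t, index (inl q : node) (a :: t) = index (inr f : node) t
  & index (inl z : node) t = (index (inr f : node) t).+1].
Proof.
have [_ _ _ uat _] := best_tail.
case/tail_edge => s1 [t2 [q [z [Et Eq qf zf]]]]; exists q, z.
move: uat; rewrite Et => uat; have [<- Ef] := index_split uat.
have := @index_split _ a (inl z) (rcons s1 (inr f)) t2; rewrite cat_rcons => /(_ uat)[_ Ez].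
split=> //.
- by rewrite -cat_cons mem_cat -Eq mem_last.
- by rewrite mem_cat !inE eqxx !orbT.
- by rewrite Ef -Eq.
- by rewrite Ez size_rcons Ef; have [<- _] := index_split uat.
Qed.

Lemma y_index : index (inl y : node) t = L.-1.
Proof.
have [_ ly szt uat _] := best_tail; have [_ ut] := andP uat.
by move: ly szt L3 ut; case: (t) => [_ <-//|b t'] ly szt _ ut;
  rewrite -ly -szt (index_last ut).
Qed.

(** As [y] has index [L.-1], the last hypothesis excludes the edge just before [y]. Any other tail
    edge at [y] has two tail neighbours different from [y], which fill it when [r = 3]. *)
Lemma path_val (f : E) : r = 3 -> y \in val f -> inr f \in t ->
    (index (inr f : node) t).+2 <> L ->
  exists q z, [/\ val f = y |: [set q; z], inl q \in a :: t, inl z \in t,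
    index (inl q : node) (a :: t) = index (inr f : node) t
  & index (inl z : node) t = (index (inr f : node) t).+1].
Proof.
move=> Er yf ft nl; have [_ _ szt uat dt] := best_tail.
have [q [z [[qf zf] qt zt Eq Ez]]] := tail_pos ft.
have zy : z != y.
  by apply: contra_notN nl => /eqP Ezy; rewrite -Ez Ezy y_index; move: L3; clear; lia.
have Ezt : index (inl z : node) (a :: t) = (index (inl z : node) t).+1.
  rewrite /=; case: eqP => // Ea; move: uat => /= /andP[+ _].
  by rewrite Ea zt.
have Eyt : index (inl y : node) (a :: t) = L.
  rewrite /= y_index; case: eqP => [Ea|_]; last by move: L3; clear; lia.
  by move: uat => /= /andP[+ _]; rewrite Ea y_tail.
have qz : q != z by apply/eqP => Eqz; move: Eq; rewrite Eqz Ezt Ez; clear; lia.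
have zt' : inl z \in t by [].
have lz : (index (inr f : node) t).+1 < L by rewrite -Ez -szt index_mem.
have qy : q != y by apply/eqP => Eqz; move: Eq lz; rewrite Eqz Eyt; clear; lia.
have Ef : val f = y |: [set q; z].
  apply/eqP; rewrite eq_sym eqEcard (card_edge unif) Er; apply/andP; split.
    by apply/subsetP => u; rewrite in_setU1 in_set2 => /or3P[] /eqP->.
  by rewrite cardsU1 in_set2 cards2 qz ![y == _]eq_sym (negbTE qy) (negbTE zy).
by exists q, z.
Qed.

Lemma path_good (f : E) : r = 3 -> y \in val f -> inr f \in t ->
  (index (inr f : node) t).+2 <> L -> good f.
Proof.
move=> Er yf ft nl; have [_ _ _ _ dt] := best_tail.
have [q [z [Ef qt zt _ _]]] := path_val Er yf ft nl.
have at' w : w \in val f -> inl w \in a :: t.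
  by rewrite Ef in_setU1 in_set2 => /or3P[] /eqP->; rewrite // inE ?zt ?y_tail orbT.
move=> w /at'; rewrite inE => wat; split.
  by rewrite inE mem_cat; case/orP: wat => ->; rewrite ?orbT.
move=> wc; case/orP: wat => [/eqP Ea|/dt]; last by rewrite inE wc orbT.
have [/and4P[/andP[_ +] _ _ _] _ _ _] := bt.
by rewrite -Ea /= wc.
Qed.

Lemma index_before_y (e : E) s1 : t = s1 ++ [:: inr e; inl y] -> (index (inr e : node) t).+2 = L.
Proof.
have [_ _ szt uat _] := best_tail; move=> Et; move: uat szt; rewrite Et => uat <-.
by have [_ ->] := index_split uat; rewrite size_cat addn2.
Qed.

Lemma index_tail u : u \in t -> index u (a :: t) = (index u t).+1.
Proof.
have [_ _ _ uat _] := best_tail; move: uat; rewrite [index u (a :: t)]/=.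
by case: eqP => // -> /= /andP[/negP h _] /h.
Qed.

Lemma tail_neq (e : E) s1 t2 q : t = s1 ++ inr e :: t2 -> last a s1 = inl q -> q != y.
Proof.
move=> Et Eq; have [_ _ szt uat _] := best_tail; apply/eqP => Eqy.
have et : index (inr e : node) t < L by rewrite -szt index_mem Et mem_cat mem_head orbT.
move: uat et; rewrite Et => /index_split[]; rewrite -Et Eq Eqy (index_tail y_tail) y_index => <- ->.
by move: L3; clear; lia.
Qed.

Lemma through_q (e f : E) s1 q : r = 3 -> t = s1 ++ [:: inr e; inl y] -> last a s1 = inl q ->
    {in out_edges a c t y, forall f : E, q \notin val f} ->
    f \in off_edges (a :: c) y -> q \in val f -> f != e ->
  inr f \in t /\ (index (inr f : node) t).+1 = index (inl q : node) t.
Proof.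
move=> Er Et Eq nq fO qf fe; have /off_edgesP[yf fac] := fO.
have ie := index_before_y Et; have [_ _ szt uat _] := best_tail.
have ft : inr f \in t by apply: contraT => ft; have := nq f (out_edgesI yf fac ft); rewrite qf.
have et : inr e \in t by rewrite Et mem_cat mem_head orbT.
have qe : index (inl q : node) (a :: t) = index (inr e : node) t.
  by move: uat; rewrite Et -Eq => /index_split[-> ->].
have nfe : index (inr f : node) t <> index (inr e : node) t.
  by move/(index_eq ft et) => [fe']; rewrite fe' eqxx in fe.
have nfL : (index (inr f : node) t).+2 <> L by move/eqP; rewrite -ie !eqSS => /eqP.
split; first exact: ft.
have [q' [z [Ef q't zt Eq' Ez]]] := path_val Er yf ft nfL.
move: qf; rewrite Ef in_setU1 in_set2 => /or3P[] /eqP Eqq.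
- move: qe; rewrite Eqq (index_tail y_tail) y_index; move: ie L3; clear; lia.
- by case: nfe; rewrite -Eq' -qe Eqq.
- by rewrite Eqq Ez.
Qed.

End Tail.

(** Edges through [q] are set aside; besides [e], only the tail edge preceding [q] can be one, and
    for [L = 3] there is no such edge. The other edges avoid [q], so [tail_deficit2] applies. *)
Lemma exc_count a c t y q (e : E) s1 : L <= 2 * k - 2 -> r = 3 -> best a c t y ->
    t = s1 ++ [:: inr e; inl y] -> last a s1 = inl q ->
    {in out_edges a c t y, forall f : E, q \notin val f} ->
  [/\ k = 5, 5 <= #|on_edges (a :: c) y| & L = 3 \/
    exists f : E, [/\ y \in val f, inr f \in t & (index (inr f : node) t).+1 = index (inl q : node) t]].
Proof.
move=> L2k Er bt Et Eq nq; have tq := through_q bt Er Et Eq nq.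
pose Q := [set f : E | q \in val f]; pose F := off_edges (a :: c) y :\: Q.
have sF : F \subset off_edges (a :: c) y by apply: subsetDl.
have et : inr e \in t by rewrite Et mem_cat mem_head orbT.
have qe : q \in val e.
  have [pt _ _ _ _] := best_tail bt; move: pt; rewrite Et cat_path Eq => /and3P[_].
  done.
have gF : {in F, forall f : E, @good T H L a c t f}.
  move=> f /setDP[fO]; rewrite inE => qf; have /off_edgesP[yf fac] := fO.
  have [ft|ft] := boolP (inr f \in t); last exact: (out_good maxN maxL bt (ltnW (ltnW L3)) (out_edgesI yf fac ft)).
  apply: (path_good bt) => // Ef; have : index (inr f : node) t = index (inr e : node) t.
    by move/eqP: (etrans Ef (esym (index_before_y bt Et))); rewrite !eqSS => /eqP.
  by move/(index_eq ft et) => [Efe]; rewrite Efe qe in qf.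
have hc := core_count bt sF gF L2k.
have qb : q \in Vs (a :: t) :\ y.
  rewrite in_setD1 in_Vs; apply/andP; split; [exact: (tail_neq bt Et Eq) | by rewrite Et -cat_cons mem_cat -Eq mem_last].
have [|h1 _] := @core_edges a c t y bt F sF gF ((Vs (a :: t) :\ y) :\ q) (subsetDl _ _).
  move=> f w /setDP[_]; rewrite inE => qf wf wt wy; rewrite !in_setD1 wy in_Vs wt !andbT.
  by apply: contraNneq qf => <-.
have [cb _ _] := tail_sizes bt.
have cA := cardsD1 q (Vs (a :: t) :\ y); rewrite qb cb in cA.
have cR := cardsID Q (off_edges (a :: c) y).
have Rsub f : f \in off_edges (a :: c) y :&: Q -> f = e \/
    inr f \in t /\ (index (inr f : node) t).+1 = index (inl q : node) t.
  case/setIP => fO; rewrite inE => qf.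
  by have [->|fe] := eqVneq f e; [left | right; apply: tq].
have R2 : #|off_edges (a :: c) y :&: Q| <= 1 \/ #|off_edges (a :: c) y :&: Q| <= 2 /\
    exists f : E, [/\ y \in val f, inr f \in t & (index (inr f : node) t).+1 = index (inl q : node) t].
  have [R0|[f]] := set_0Vmem ((off_edges (a :: c) y :&: Q) :\ e).
    left; apply: leq_trans (_ : #|[set e]| <= 1); last by rewrite cards1.
    by apply: subset_leq_card; rewrite -setD_eq0 R0.
  case/setD1P => fe fR; right; have [Efe|[ft Ef]] := Rsub f fR; first by rewrite Efe eqxx in fe.
  split; last by exists f; split=> //; case/setIP: fR => /off_edgesP[].
  apply: leq_trans (_ : #|[set e; f]| <= 2); last by rewrite cards2; case: (_ == _).
  apply/subset_leq_card/subsetP => f' /Rsub[->|[f't Ef']]; rewrite in_set2 ?eqxx //.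
  suff [->] : inr f' = inr f :> node by rewrite eqxx orbT.
  by apply: (index_eq f't ft); move/eqP: (etrans Ef' (esym Ef)); rewrite eqSS => /eqP.
have hd := mindeg y; rewrite -(card_on_off (a :: c)) -cR in hd.
have L3' : L./2 = 1 -> L = 3 by move: L3; clear; lia.
have noL3 : L = 3 -> #|off_edges (a :: c) y :&: Q| <= 1.
  move=> EL; case: R2 => // -[_ [f [yf ft Ef]]].
  have [_ _ _ uat _] := best_tail bt; have Ee := index_before_y bt Et.
  move: uat Ee; rewrite Et => /index_split[Eqa ->]; rewrite -Et Eq in Eqa *.
  move: Eqa Ef => /=; case: (_ == _) => [<-|]; rewrite EL; first by clear; lia.
  by clear; lia.
have [||||||k5 D5 bD] := @tail_deficit2 (k - 1) (L./2 + #|thick (Vs c) F|) #|thin (Vs c) F|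
  #|on_edges (a :: c) y| #|off_edges (a :: c) y :&: Q|.
- by move: rk r3; clear; lia.
- by move: L3; clear; lia.
- by move: hc rk r3; clear; lia.
- by case: R2 => [/leq_trans->//|[]].
- move=> h1'; apply: noL3; apply: L3'.
  by move: h1' L3; clear; lia.
- move: hd h1; rewrite Er -/F.
  have -> : L./2 + #|thick (Vs c) F| = (#|Vs (a :: t) :\ y :\ q| + #|thick (Vs c) F|).+1.
    by rewrite cA.
  rewrite -pred_Sn (_ : 3 - 1 = 2) //.
  by move=> h1 h2; apply: leq_trans h1 _; rewrite [leqRHS]addnC leq_add2l addnC leq_add2r.
split=> //; first by move: k5 r3 rk; clear; lia.
case: bD => [b2|h1']; last by left; apply: L3'; move: h1' L3; clear; lia.
by case: R2 => [|[_ ?]]; [rewrite b2 | right].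
Qed.

(* Exchanging the roles of [y] and [q] gives the same configuration, which only
   survives the counting when [k = 5]; then both ends have many edges on the cycle. *)
Definition exc a c t y q (e : E) := [/\ best a c t y,
  exists2 s1, t = s1 ++ [:: inr e; inl y] & last a s1 = inl q,
  {in out_edges a c t y, forall f : E, q \notin val f} & ~ @good T H L a c t e].

Lemma exc_swap a c t y q (e : E) : L <= 2 * k - 2 -> r = 3 -> exc a c t y q e ->
  exists a' c' t', perm_eq (a' :: c') (a :: c) /\ exc a' c' t' q y e.
Proof.
move=> L2k Er [bt [s1 Et Eq] nq ng].
have [_ D5 h] := exc_count L2k Er bt Et Eq nq.
have [pt ly szt uat dt] := best_tail bt.
have swap a' c' t' : perm_eq (a' :: c') (a :: c) -> perm_eq t' t -> best a' c' t' q ->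
    (exists2 s1, t' = s1 ++ [:: inr e; inl q] & last a' s1 = inl y) ->
    (@good T H L a' c' t' e -> @good T H L a c t e) -> exc a' c' t' q y e.
  move=> pc ptt bt' sp gg; split=> //; last by move/gg/ng.
  move=> f fO; have [qf fc ft] := out_edgesP fO; apply/negP => yf.
  suff /nq : f \in out_edges a c t y by rewrite qf.
  by apply: out_edgesI; rewrite -?(perm_mem pc) -?(perm_mem ptt).
(* For [L = 3] the reversed tail is attached at a cycle edge containing [y]. Otherwise the tail is
   rotated about its own edge [f], which precedes [q] and contains [y]. *)
case: h => [EL|[f [yf ft Ef]]].
  have Ets : t = [:: inl q; inr e; inl y].
    move: szt; rewrite EL Et size_cat addn2 => -[].
    by case: (s1) Eq => [|b []] //= ->.
  have aE : ~~ isV a by have [_ _ <-] := tail_sizes bt; rewrite EL.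
  have [e0 e0D] : exists e0, e0 \in on_edges (a :: c) y by apply/card_gt0P; apply: leq_trans D5.
  have [ye0 e0c] := on_edgesP e0D.
  have [lol szN _ _] := bt; have /and4P[cy _ _ _] := lol.
  have [c2 cy2 pc2] := ucyc_from cy e0c.
  have pe : perm_eq [:: inl y; inr e; inl q : node] t.
    by rewrite Ets -(perm_rev [:: _; _; _]).
  exists (inr e0), c2, [:: inl y; inr e; inl q]; split=> //; apply: swap => //.
  - split; rewrite ?EL -?szN ?(perm_size pc2) //; apply/and4P; split=> //.
    + by move: pt; rewrite Ets /= ye0 /= => /and3P[_ -> ->].
    + by move: uat; rewrite cons_uniq -(perm_uniq pe) => /andP[].
    + apply/allP => u; rewrite (perm_mem pe) -[predC _ u]/(u \notin inr e0 :: c2) (perm_mem pc2); exact: dt.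
  - by exists [:: inl y].
  - move=> ge w /ge; rewrite -!cat_cons !mem_cat (perm_mem pe) (perm_mem pc2).
    case=> h1 h2; split=> // wc; have : inl w \in inr e0 :: c2 by rewrite (perm_mem pc2) inE wc orbT.
    by rewrite inE /= => /h2[].
have [s1' [t2 [Et' _ _]]] := split_index1 ft.
have gf : g (last a s1') (inr f) by move: pt; rewrite Et' cat_path => /and3P[].
have [x [t3 [Et2 xf bt' _]]] := best_rotate bt Et' yf gf (or_introl (erefl _)).
have uat' := uat; rewrite Et' Et2 in uat'; have [_ Ef1] := index_split uat'.
have := @index_split _ a (inl x) (rcons s1' (inr f)) t3.
rewrite cat_rcons => /(_ uat')[_]; rewrite size_rcons => Ex1.
rewrite Et2 in Et'; rewrite -Et' in Ef1 Ex1.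
have xt : inl x \in t by rewrite Et' mem_cat !inE eqxx !orbT.
have qt : inl q \in t by rewrite -index_mem -Ef Ef1 -Ex1 index_mem.
have [Exq] : inl x = inl q :> node by apply: (index_eq xt qt); rewrite Ex1 -Ef Ef1.
subst x.
have Es1 : size s1 = (size s1').+2.
  have uat1 := uat; rewrite Et in uat1; have [<- _] := index_split uat1.
  by rewrite -Et Eq (index_tail bt qt) Ex1.
have Et3 : t3 = [:: inr e; inl y].
  have : drop (size s1) t = t3.
    by rewrite Et' Es1 -cat_rcons -cat_rcons drop_size_cat // !size_rcons.
  by rewrite Et drop_size_cat.
have En : s1' ++ inr f :: rev t2 = rcons (rcons s1' (inr f)) (inl y) ++ [:: inr e; inl q].
  by rewrite Et2 Et3 !cat_rcons.
have pe : perm_eq (s1' ++ inr f :: rev t2) t.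
  by rewrite Et' perm_cat2l perm_cons Et2 perm_rev.
exists a, c, (s1' ++ inr f :: rev t2); split=> //; apply: swap => //.
  by rewrite En; eexists; [reflexivity | rewrite last_rcons].
by move=> ge w /ge; rewrite -!cat_cons !(mem_cat _ (a :: c)) (perm_mem pe).
Qed.

(** For [k = 5] the cycle has at most nine edges, and [y] and [q] need five each. A common one would
    contain [y], [q] and its two cycle neighbours, too many for [r = 3]. *)
Lemma exc_false a c t y q (e : E) : L <= 2 * k - 2 -> r = 3 -> ~ exc a c t y q e.
Proof.
move=> L2k Er X; have [a' [c' [t' [pc X']]]] := exc_swap L2k Er X.
case: X X' => bt [s1 Et Eq] nq _ [bt' [s1' Et' Eq'] nq' _].
have [k5 D5 _] := exc_count L2k Er bt Et Eq nq.
have [_ D5' _] := exc_count L2k Er bt' Et' Eq' nq'.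
have ED x : on_edges (a' :: c') x = on_edges (a :: c) x.
  by apply/setP => f; rewrite !in_setI !in_Es (perm_mem pc).
have yac := best_y_notin bt (ltnW (ltnW L3)); have qac := best_y_notin bt' (ltnW (ltnW L3)).
rewrite (perm_mem pc) in qac; rewrite ED in D5'.
have [/and4P[cy _ _ _] _ _ _] := bt.
have cV := best_V bt; have D5V : 4 < #|Vs (a :: c)|.
  by apply: leq_trans D5 _; rewrite (ucyc_card cy); apply/subset_leq_card/subsetIr.
have dD : [disjoint on_edges (a :: c) y & on_edges (a :: c) q].
  apply: disjoint_of => f /on_edgesP[yf fc]; apply/negP => /on_edgesP[qf _].
  have gt2 : 2 < size (a :: c).
    rewrite (ucyc_size cy); apply: (@leq_trans (2 * 5)); first by [].
    by rewrite leq_mul2l D5V orbT.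
  have [p [p' [pV p'V pp' [_ _ pf p'f]]]] := edge_ends cy gt2 fc.
  have : #|y |: (q |: [set p; p'])| <= #|val f|.
    apply/subset_leq_card/subsetP => u; rewrite !in_setU1 in_set1.
    by case/or4P => /eqP->.
  rewrite (card_edge unif) Er !cardsU1 cards1 !in_setU1 !in_set1 (negbTE pp').
  have notV x z : inl x \notin a :: c -> z \in Vs (a :: c) -> x != z.
    by move=> xac; rewrite in_Vs; apply: contraTneq => <-.
  have [h1 h2 h3 h4] := And4 (notV _ _ yac pV) (notV _ _ yac p'V) (notV _ _ qac pV) (notV _ _ qac p'V).
  rewrite (negbTE h1) (negbTE h2) (negbTE h3) (negbTE h4) orbF.
  suff /negbTE-> : y != q by [].
  by rewrite eq_sym (tail_neq bt Et Eq).
have : #|on_edges (a :: c) y :|: on_edges (a :: c) q| <= #|Es (a :: c)|.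
  by apply/subset_leq_card; rewrite subUset !subsetIr.
rewrite -(ucyc_card cy) cardsU (disjoint_setI0 dD) cards0 subn0.
by move=> le; have := leq_trans (leq_add D5 D5') (leq_trans le cV); rewrite k5.
Qed.

Hypothesis L2k : L <= 2 * k - 2.

Lemma goodP a c t (f : E) : @good T H L a c t f \/ ~ @good T H L a c t f.
Proof.
pose b := [forall w, (w \in val f) ==> (inl w \in a :: c ++ t) && ((inl w \in c) ==>
  [&& isV a, L < index (inl w : node) c & L + index (inl w : node) c < (size c).-1])].
have bP : reflect (@good T H L a c t f) b.
  apply: (iffP forallP) => h w; [move=> wf; have /implyP/(_ wf)/andP[h1 /implyP h2] := h w|].
    by split=> // /h2/and3P.
  apply/implyP => wf; have [-> h2] := h w wf; apply/implyP => /h2[h3 h4 h5].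
  by apply/and3P.
by case: (bP); [left | right].
Qed.

(** By [rot_good], a tail edge can fail only if no outside edge meets its predecessor [q]. Then [q]
    is lost for the binomial, and the degree is out of reach: by [tail_deficit] for [r > 3], by
    [path_good] and [exc_false] for [r = 3]. *)
Lemma all_good a c t y (e : E) : best a c t y -> e \in off_edges (a :: c) y -> @good T H L a c t e.
Proof.
move=> bt eO; have [//|ng] := goodP a c t e.
have L0 := ltnW (ltnW L3); have /off_edgesP[ye eac] := eO.
have [et|et] := boolP (inr e \in t); last exact: (out_good maxN maxL bt L0 (out_edgesI ye eac et)).
have [s1 [t2 [q [z [Et Eq qe ze]]]]] := tail_edge bt et.
have nq : {in out_edges a c t y, forall f : E, q \notin val f}.
  move=> f fO; apply/negP => qf; apply: ng.
  by apply: (rot_good maxN maxL bt L0 Et ye fO); rewrite Eq.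
have [Er|r4] : r = 3 \/ 3 < r by move: r3; clear; lia.
  have [EL|nL] := eqVneq (index (inr e : node) t).+2 L; last first.
    by apply: (path_good bt Er ye et); apply/eqP.
  have t20 : t2 = [::].
    have [_ _ szt uat _] := best_tail bt; move: uat szt EL; rewrite Et => /index_split[_ ->] <-.
    by rewrite size_cat /= => /eqP; rewrite -addn2 eqn_add2l !eqSS; case: (t2).
  case: (@exc_false a c t y q e L2k Er); split=> //; exists s1 => //.
  have [_ ly _ _ _] := best_tail bt; move: ly; rewrite Et t20 last_cat /= => ->.
  done.
have sO : out_edges a c t y \subset off_edges (a :: c) y by apply: subsetDl.
have gO : {in out_edges a c t y, forall f : E, @good T H L a c t f}.
  by move=> f fO; apply: (out_good maxN maxL bt L0 fO).
have hc := core_count bt sO gO L2k.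
have qb : q \in Vs (a :: t) :\ y.
  rewrite in_setD1 in_Vs (tail_neq bt Et Eq) /=.
  by rewrite Et -cat_cons mem_cat -Eq mem_last.
have [|h1 _] := @core_edges a c t y bt _ sO gO ((Vs (a :: t) :\ y) :\ q) (subsetDl _ _).
  move=> f w fO wf wt wy; rewrite !in_setD1 wy in_Vs wt !andbT.
  by apply: contraTneq wf => ->; apply: nq.
have [cb cE _] := tail_sizes bt.
have cA := cardsD1 q (Vs (a :: t) :\ y); rewrite qb cb in cA.
have cR := cardsID (Es t) (off_edges (a :: c) y).
have hR : #|off_edges (a :: c) y :&: Es t| <= L./2 by rewrite -cE; apply/subset_leq_card/subsetIr.
have hd := mindeg y; rewrite -(card_on_off (a :: c)) -cR in hd.
have := @tail_deficit (k - 1) (r - 1) (L./2 + #|thick (Vs c) (out_edges a c t y)|)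
  #|thin (Vs c) (out_edges a c t y)| #|on_edges (a :: c) y| #|off_edges (a :: c) y :&: Es t|.
have -> : L./2 + #|thick (Vs c) (out_edges a c t y)| =
    (#|Vs (a :: t) :\ y :\ q| + #|thick (Vs c) (out_edges a c t y)|).+1 by rewrite cA.
rewrite -pred_Sn => h2; exfalso; move: hd; rewrite leqNgt => /negP; apply.
rewrite addn1 ltnS; apply: leq_trans (h2 _ _ _ _ _).
- rewrite [leqLHS]addnC leq_add2r addnC leq_add2r; exact: h1.
- by move: r4; clear; lia.
- by move: rk r3; clear; lia.
- by [].
- rewrite -addSn; have -> : #|Vs (a :: t) :\ y :\ q|.+1 = L./2 by rewrite cA.
  by move: hc r3 rk; clear; lia.
- apply: leq_trans hR _; rewrite cA; exact: leq_addr.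
Qed.

End Incidence.

(** * Short tails: the extremal configuration *)

Section Incidence.

Variables (T : finType) (H : {set {set T}}).

Local Notation E := {e : {set T} | e \in H}.
Local Notation node := (T + E)%type.
Local Notation g := (@incidence_graph T H).
Local Notation isV := (@isV T H).
Local Notation Vs := (@Vs T H).
Local Notation Es := (@Es T H).

Variables (k r N L : nat).
Hypotheses (r3 : 2 < r) (rk : r <= k - 2) (unif : uniform r H).
Hypothesis mindeg : forall y, 'C(k - 1, r - 1) + 1 <= degree H y.
Hypothesis maxN : forall s : seq node, ucyc g s -> size s <= N.
Hypothesis leN : N <= 2 * (2 * k - 1).
Hypothesis maxL : forall (a : node) (c t : seq node), lolli g a c t -> size (a :: c) = N ->
  isV (last a t) -> size t <= L.
Hypotheses (L3 : 2 < L) (L2k : L <= 2 * k - 2).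

Local Notation best := (@best T H N L).


Lemma set_between (A B : {set T}) m : A \subset B -> #|A| <= m <= #|B| ->
  exists C : {set T}, [/\ A \subset C, C \subset B & #|C| = m].
Proof.
elim: m => [|m IHm] sAB /andP[Am mB].
  by exists A; split=> //; apply/eqP; rewrite -leqn0.
have [Em|Em] := eqVneq #|A| m.+1; first by exists A.
have [|C [AC CB cC]] := IHm sAB; first by rewrite -ltnS ltn_neqAle Em Am ltnW.
have /card_gt0P[x /setDP[xB xC]] : 0 < #|B :\: C|.
  by rewrite cardsD (setIidPr CB) cC subn_gt0.
exists (x |: C); split; last by rewrite cardsU1 xC cC.
  exact: subset_trans AC (subsetUr _ _).
by rewrite subUset sub1set xB.
Qed.

Local Notation K a c y := (thick (Vs c) (off_edges (a :: c) y)).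
Local Notation core a c t y := ((Vs (a :: t) :\ y) :|: K a c y).

(** With all edges good, the count is exact and [y] forms an edge with every [(r - 1)]-subset of the
    core. If [a] were an edge, there would be no thick vertices, and [L./2 = k - 1] with [L] odd
    would exceed [2 * k - 2]. *)
Lemma tight a c t y : best a c t y ->
  [/\ isV a, L./2 + #|K a c y| = k - 1, #|core a c t y| = k - 1,
    #|on_edges (a :: c) y| = 1 /\
    (forall x f, f \in off_edges (a :: c) y -> x \in Vs c -> x \in val f -> x \in K a c y)
  & forall B : {set T}, B \subset core a c t y -> #|B| = r - 1 ->
    exists2 f, f \in off_edges (a :: c) y & val f = y |: B].
Proof.
move=> bt; have gO f : f \in off_edges (a :: c) y -> @good T H L a c t f.
  exact: (all_good r3 rk unif mindeg maxN leN maxL L3 L2k bt).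
have hc := core_count r3 rk maxN leN L3 bt (subxx _) gO L2k.
have [|h1 h2] := core_edges unif L3 bt (subxx _) gO (subxx _).
  by move=> f w _ _ wt wy; rewrite in_setD1 wy in_Vs.
have [cb cE pL] := tail_sizes L3 bt; rewrite cb in h1 h2.
have hd := mindeg y; rewrite -(card_on_off (a :: c)) in hd.
have off0 : 0 < #|off_edges (a :: c) y|.
  have [|s1 [e [t2 [Et ye]]]] := tail_before bt (y_tail L3 bt).
    by rewrite (y_index L3 bt); move: L3; clear; lia.
  have [_ _ _ _ dt] := best_tail bt; apply/card_gt0P; exists e.
  have /dt eac : inr e \in t by rewrite Et mem_cat mem_head orbT.
  by rewrite in_setD in_Es eac inE.
have [||||||hk S0 D1] := @tail_count_cases (k - 1) (r - 1) (L./2 + #|K a c y|)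
  #|thin (Vs c) (off_edges (a :: c) y)| #|on_edges (a :: c) y|.
- by move: r3; clear; lia.
- by move: r3 rk; clear; lia.
- by move: L3; clear; lia.
- by move: hc r3 rk; clear; lia.
- by apply: leq_trans hd _; rewrite addnC leq_add2r.
- exact: leq_trans off0 h1.
have aV : isV a.
  apply: contraT => aE; have [K0 _] := core_E gO aE; move: hk pL; rewrite K0 cards0 aE.
  by move: L2k L3; clear; lia.
have hoff : #|off_edges (a :: c) y| = 'C(L./2 + #|K a c y|, r - 1).
  apply/eqP; rewrite eqn_leq; move: h1 hd; rewrite S0 addn0 D1 [1 + _]addnC leq_add2r hk => -> ->.
  done.
split=> //.
- rewrite cardsU disjoint_setI0 ?cards0 ?subn0 ?cb //.
  apply: disjoint_of => w /setD1P[_ wt]; apply/negP => /(subsetP (thick_sub _ _)) wc.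
  by have := pred0P (tail_cycle bt) w; rewrite /= wt wc.
- split=> // x f fO xc xf; apply: contraT => xK.
  suff : f \in thin (Vs c) (off_edges (a :: c) y) by rewrite (cards0_eq S0) in_set0.
  by rewrite inE fO; apply/existsP; exists x; rewrite xc xf xK.
- by apply: h2 => //; apply: cards0_eq.
Qed.

Lemma through a c t y u : best a c t y -> u \in core a c t y ->
  'C(k - 2, r - 2) <= #|[set f in off_edges (a :: c) y | u \in val f]|.
Proof.
move=> bt uS; have [_ _ cS _ complete] := tight bt.
have cSu : #|core a c t y :\ u| = k - 2.
  by have := cardsD1 u (core a c t y); rewrite uS cS; move: r3 rk; clear; lia.
rewrite -cSu -cards_draws -[leqRHS](card_in_imset (f := fun f : E => val f)); last first.
  by move=> f f' _ _ /val_inj.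
have yS : y \notin core a c t y.
  rewrite in_setU setD11 /=; apply/negP => /(subsetP (thick_sub _ _)).
  by rewrite in_Vs => yc; have := best_y_notin bt (ltnW (ltnW L3)); rewrite inE yc orbT.
have inj : {in [set B : {set T} | B \subset core a c t y :\ u & #|B| == r - 2] &,
    injective (fun B : {set T} => y |: (u |: B))}.
  move=> B B'; rewrite !inE => /andP[sB _] /andP[sB' _] EB.
  have rem (C : {set T}) : C \subset core a c t y :\ u -> (y |: (u |: C)) :\ y :\ u = C.
    move=> sC; apply/setP => w; rewrite !in_setD1 !in_setU1.
    have [->|wu] := eqVneq w u; first by apply/esym/negbTE/negP => /(subsetP sC); rewrite setD11.
    have [->|//] := eqVneq w y; apply/esym/negbTE/negP => /(subsetP sC)/setD1P[_].
    exact/negP.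
  by rewrite -(rem B) // -(rem B') // EB.
rewrite -(card_in_imset inj); apply/subset_leq_card/subsetP => _ /imsetP[B + ->].
rewrite inE => /andP[sB /eqP cB].
have uB : u \notin B by apply/negP => /(subsetP sB); rewrite setD11.
have [||f fO Ef] := complete (u |: B).
- by rewrite subUset sub1set uS (subset_trans sB) // subsetDl.
- by rewrite cardsU1 uB cB; move: r3; clear; lia.
by apply/imsetP; exists f => //; rewrite inE fO Ef !in_setU1 eqxx orbT.
Qed.

(** Otherwise all edges through [y] and [q] off the cycle are tail edges other than [e]. These are
    fewer than [L./2], and for [r = 3] at most two, whereas [through] provides more. *)
Lemma rot_edge a c t y s1 e t2 q : best a c t y -> t = s1 ++ inr e :: t2 -> last a s1 = inl q ->
  exists f : E, [/\ y \in val f, q \in val f & f = e \/ f \in out_edges a c t y].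
Proof.
move=> bt Et Eq; have [_ hk _ _ _] := tight bt; have [_ _ szt uat _] := best_tail bt.
have et : inr e \in t by rewrite Et mem_cat mem_head orbT.
have qy := tail_neq L3 bt Et Eq.
have qS : q \in core a c t y.
  by rewrite in_setU in_setD1 qy in_Vs Et -cat_cons mem_cat -Eq mem_last.
pose X := [set f in off_edges (a :: c) y | q \in val f].
have [nX|[f /setIP[fX]]] := set_0Vmem (X :&: [set f | (f == e) || (f \in out_edges a c t y)]);
    last first.
  rewrite in_set => h; move: fX; rewrite in_set => /andP[/off_edgesP[yf _] qf].
  by exists f; split=> //; case/orP: h => [/eqP|]; [left|right].
have Xt f : f \in X -> f \in Es t :\ e.
  move=> fX; have := in_set0 f; rewrite -nX in_setI fX in_set /= => /negbT/norP[fe].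
  move: (fX); rewrite in_set => /andP[fO _]; rewrite in_setD1 fe /=.
  by rewrite in_setD fO andbT negbK.
have thr := through bt qS; rewrite -/X in thr.
have cX : #|X| < L./2.
  have [_ <- _] := tail_sizes L3 bt; rewrite (cardsD1 e (Es t)) in_Es et.
  by apply/subset_leq_card/subsetP.
have [Er|r4] : r = 3 \/ 3 < r by move: r3; clear; lia.
  exfalso; have X2 : #|X| <= 2.
    pose l := [seq index (inr f : node) t | f <- enum X].
    have -> : #|X| = size l by rewrite size_map -cardE.
    apply: (@uniq_leq_size _ _ [:: L - 2; (index (inl q : node) t).-1]).
      rewrite map_inj_in_uniq ?enum_uniq // => f f'; rewrite !mem_enum.
      move=> /Xt/setD1P[_] + /Xt/setD1P[_]; rewrite !in_Es => ft f't.
      by move/(index_eq ft f't) => [].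
    move=> _ /mapP[f + ->]; rewrite mem_enum => fX; have /setD1P[fe] := Xt f fX; rewrite in_Es => ft.
    move: fX; rewrite inE => /andP[/off_edgesP[yf _] qf]; rewrite !in_cons in_nil orbF.
    have [EL|nL] := eqVneq (index (inr f : node) t).+2 L; first by rewrite -EL subn2 eqxx.
    have [q' [z [Ef q't zt Eq' Ez]]] := path_val unif L3 bt Er yf ft (elimN eqP nL).
    move: qf; rewrite Ef in_setU1 in_set2 (negbTE qy) /= => /orP[] /eqP Eqq; last first.
      by rewrite Eqq Ez eqxx orbT.
    case/negP: fe; have : index (inr f : node) t = index (inr e : node) t.
      rewrite -Eq' -Eqq; move: uat; rewrite Et => /index_split[+ ->].
      by rewrite Eq.
    by move/(index_eq ft et) => [->].
  move: thr; rewrite leqNgt => /negP; apply; apply: leq_ltn_trans X2 _.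
  by rewrite Er bin1; move: r3 rk; rewrite Er; clear; lia.
exfalso; have h1 := leq_ltn_trans thr cX.
by have := leq_bin_mid r4 rk; move: h1 hk; clear; lia.
Qed.

(** Every vertex of the tail can thus become its end, so that [tight] holds at each of them. *)
Lemma rot_end a c t y s1 (e : E) v t2 : best a c t y -> t = s1 ++ inr e :: inl v :: t2 ->
  exists t', best a c t' v /\ Vs t' = Vs t.
Proof.
move=> bt Et; have [pt _ _ _ _] := best_tail bt.
have gq : g (last a s1) (inr e) by move: pt; rewrite Et cat_path => /and3P[].
case Eq: (last a s1) gq => [q|//] qe; have [f [yf qf fO]] := rot_edge bt Et Eq.
have gf : g (last a s1) (inr f) by rewrite Eq.
have [x [t3 [[<- _] _ bt' EV]]] := best_rotate bt Et yf gf fO.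
by exists (s1 ++ inr f :: rev (inl v :: t2)).
Qed.

Lemma tight_cover a c t y : best a c t y -> forall i, i < 2 * #|K a c y| + 1 ->
  (exists x, [/\ x \in K a c y, inl x \in c, index (inl x : node) c = L + 1 + 2 * cpos L c (inl x)
     & i = cpos L c (inl x) \/ i = (cpos L c (inl x)).+1]) \/
  (exists e, [/\ e \in on_edges (a :: c) y, inr e \in c & index (inr e : node) c = L + 2 * i]).
Proof.
move=> bt i lti; have [aV hk _ [D1 onK] _] := tight bt.
have gO f : f \in off_edges (a :: c) y -> @good T H L a c t f.
  exact: (all_good r3 rk unif mindeg maxN leN maxL L3 L2k bt).
have iD := inner_le a c y; rewrite D1 aV addn0 in iD.
have LL := odd_double_half L; have [_ _ pL] := tail_sizes L3 bt; rewrite pL aV add0n in LL.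
have Vk := best_V r3 rk leN bt.
have [|||h1 h2] := @count_links T H N L maxN a c t y bt (ltnW (ltnW L3)) _ (thick_sub (Vs c) (off_edges (a :: c) y)).
- by move=> x /thick_mem[f fO xf]; exists f; split=> //; apply: gO.
- move=> x x' xK /thick_mem[f' f'F xf'] _.
  by have [f [fF xf ff']] := thickP f' xK; exists f, f'.
- by rewrite addn_gt0 iD orbT.
have Ek : L + 2 * #|K a c y| = 2 * k - 2 by move: hk LL r3 rk; clear; lia.
have V2 : #|Vs (a :: c)| = 2 * k - 1 /\ L + 2 * #|K a c y| + #|inner_edges a c y| = #|Vs (a :: c)|.
  rewrite Ek in h1 *; move: h1 iD Vk r3 rk; move: #|inner_edges _ _ _| #|Vs _| => x1 x2; clear.
  by move=> h1 h2 h3 h4 h5; split; lia.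
have iL : i + L < #|Vs (a :: c)|.
  by rewrite (proj1 V2); move: lti Ek r3 rk; clear; lia.
have [[x xK Ex]|[e eI Ei]] := h2 (proj2 V2) i iL.
- left; exists x; have [f fO xf] := thick_mem xK.
  have xc : inl x \in c by have := subsetP (thick_sub _ _) x xK; rewrite in_Vs.
  by have [] := cpos_V bt (gO f fO) xf xc; split.
- right; exists e; have [ec Ee _] := cpos_E maxN bt eI; rewrite -Ei in Ee.
  by split=> //; case/setIP: eI.
Qed.

(** Each possible end has its only cycle edge at index [L] of [c], so one edge contains all [k - 1]
    tail vertices. With its two cycle neighbours it has at least [k + 1] vertices. *)
Lemma tight_all a c t y : best a c t y -> #|K a c y| = 0 -> False.
Proof.
move=> bt K0; have [aV hk _ _ _] := tight bt; have [pt ly szt uat dt] := best_tail bt.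
have pos t' v : best a c t' v ->
    exists e, [/\ e \in on_edges (a :: c) v, inr e \in c & index (inr e : node) c = L].
  move=> bt'; have [_ hk' _ _ _] := tight bt'.
  have K0' : #|K a c v| = 0 by apply/eqP; rewrite -(eqn_add2l L./2) hk' -hk K0.
  have [|[x [xK _ _ _]]|[e [eD ec Ee]]] := @tight_cover a c t' v bt' 0; first by rewrite addn1.
    by rewrite (cards0_eq K0') in_set0 in xK.
  by exists e; split=> //; rewrite Ee muln0 addn0.
have [e [eD ec Ee]] := pos t y bt.
have all v : v \in Vs t -> v \in val e.
  rewrite in_Vs => vt; have [|s1 [e' [t2 [Et _]]]] := tail_before bt vt.
    rewrite lt0n; apply/eqP => i0; move: pt vt i0; case: (t) => [//|b t'] /= /andP[gb _] _.
    by case: eqP => // Eb _; move: gb aV; rewrite Eb; case: (a).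
  have [t' [bt' _]] := rot_end bt Et; have [e2 [/on_edgesP[ve2 _] e2c Ee2]] := pos t' v bt'.
  by have [<-] : inr e2 = inr e :> node by apply: (index_eq e2c ec); rewrite Ee2 Ee.
have [/and4P[cy _ _ _] _ _ _] := bt; have /on_edgesP[ye eac] := eD.
have [cb cE pL] := tail_sizes L3 bt.
have gt2 : 2 < size (a :: c).
  rewrite [size _]/= ltnS; apply: ltnW; apply: ltn_trans L3 _.
  by rewrite -Ee index_mem.
have [p [q [pV qV pq [_ _ pe qe]]]] := edge_ends cy gt2 eac.
have sub : [set p; q] :|: Vs t \subset val e.
  apply/subsetP => u; rewrite in_setU in_set2 => /orP[/orP[]/eqP->//|]; exact: all.
have dis : [disjoint [set p; q] & Vs t].
  apply: disjoint_of => u; rewrite in_set2 in_Vs => uP; apply/negP => /dt /negP; apply.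
  by move: pV qV; rewrite !in_Vs; case/orP: uP => /eqP->.
have := subset_leq_card sub; rewrite (card_edge unif) cardsU (disjoint_setI0 dis) cards0 subn0 cards2 pq.
have ut : uniq t by case/andP: uat.
have := card_VsEs ut; rewrite cE szt; have := odd_double_half L; rewrite pL aV.
by move: hk rk r3; rewrite K0; move: #|_|; clear; lia.
Qed.

Lemma pick3 (X : {set E}) (f1 f2 : E) : 2 < #|X| -> exists f, [/\ f \in X, f != f1 & f != f2].
Proof.
move=> X3; have /card_gt0P[f /setDP[fX]] : 0 < #|X :\: [set f1; f2]|.
  rewrite cardsD subn_gt0; apply: leq_ltn_trans X3.
  by apply: leq_trans (subset_leq_card (subsetIr _ _)) _; rewrite cards2; case: (_ == _).
by rewrite in_set2 => /norP[]; exists f.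
Qed.

(** A second end [z] of a tail on the same vertices inherits the thick vertices of [y]. Detours
    through both [y] and [z] then keep the links further apart than [tight_cover] permits. *)
Lemma tight_false a c t y : ~ best a c t y.
Proof.
move=> bt; have [aV hk cS [D1 onK] complete] := tight bt; have [pt ly szt uat dt] := best_tail bt.
have three : 2 < 'C(k - 2, r - 2).
  by have := @leq_bin_self (k - 2) (r - 2); move: 'C(_, _) => x; move: r3 rk; clear; lia.
have [e0 [z [t2 Et]]] : exists e0 z t2, t = inr e0 :: inl z :: t2.
  move: pt szt aV; case: (t) => [|b [|b' t2]] /=; try by move: L3; clear; lia.
  by case: (a) => [a0|//]; case: b => [//|e0]; case: b' => [z|e1] /and3P[] // *; exists e0, z, t2.
have [t' [bt' EV]] := @rot_end a c t y [::] e0 z t2 bt Et.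
have [_ hk' _ [_ onK'] _] := tight bt'.
have zy : z != y.
  apply/eqP => Ezy; have := y_index L3 bt; rewrite Et Ezy /= eqxx.
  by move: L3; clear; lia.
have zt : inl z \in t by rewrite Et !inE eqxx orbT.
have zS : z \in core a c t y by rewrite in_setU in_setD1 zy in_Vs inE zt orbT.
have KS x : x \in K a c y -> x \in core a c t y by rewrite in_setU => ->; rewrite orbT.
have Kc x : x \in K a c y -> inl x \in c.
  by move=> xK; have := subsetP (thick_sub _ _) x xK; rewrite in_Vs.
have offz f : f \in off_edges (a :: c) y -> z \in val f -> f \in off_edges (a :: c) z.
  by case/off_edgesP => _ fac zf; rewrite in_setD in_Es fac inE.
(* Completeness at [y] yields an edge containing [y], [z] and [x]; it is also an edge at [z], where
   [tight] makes [x] thick. *)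
have KK x : x \in K a c y -> x \in K a c z.
  move=> xK; have [||B [sB BS cB]] := @set_between [set z; x] (core a c t y) (r - 1).
  - by rewrite subUset !sub1set zS KS.
  - by rewrite cS cards2; case: (_ != _); move: r3 rk; clear; lia.
  have [f fO Ef] := complete B BS cB; move: sB; rewrite subUset !sub1set => /andP[zB xB].
  have zf : z \in val f by rewrite Ef in_setU1 zB orbT.
  apply: (onK' x f (offz f fO zf)); last by rewrite Ef in_setU1 xB orbT.
  by rewrite in_Vs Kc.
have KS' x : x \in K a c y -> x \in core a c t' z by move/KK; rewrite in_setU => ->; rewrite orbT.
have out v : v = inl y \/ v = inl z -> v \notin a :: c.
  by case=> ->; apply: dt => //; exact: (y_tail L3 bt).
have pickf x x' : x \in K a c y -> x' \in K a c y -> exists f1 f2 f3 : E,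
    [/\ [/\ x \in val f1, y \in val f1, y \in val f2, z \in val f2 & z \in val f3],
      x' \in val f3, [/\ f1 != f2, f1 != f3 & f2 != f3]
    & [/\ inr f1 \notin a :: c, inr f2 \notin a :: c & inr f3 \notin a :: c]].
  move=> xK x'K; have h1 := leq_trans three (through bt (KS x xK)).
  have h2 := leq_trans three (through bt zS); have h3 := leq_trans three (through bt' (KS' x' x'K)).
  have [f1 [f1X _ _]] := @pick3 _ e0 e0 h1; have [f2 [f2X f21 _]] := @pick3 _ f1 e0 h2.
  have [f3 [f3X f31 f32]] := @pick3 _ f1 f2 h3; exists f1, f2, f3.
  move: f1X f2X f3X => /setIdP[/off_edgesP[yf1 f1c] xf1].
  move=> /setIdP[/off_edgesP[yf2 f2c] zf2] /setIdP[/off_edgesP[zf3 f3c] xf3].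
  by split=> //; split=> //; rewrite eq_sym.
have farK x x' : x \in K a c y -> x' \in K a c y -> index (inl x : node) c < index (inl x' : node) c ->
    5 + index (inl x : node) c < index (inl x' : node) c.
  move=> xK x'K lt; have [f1 [f2 [f3 [[xf1 yf1 yf2 zf2 zf3] xf3 [f12 f13 f23] [c1 c2 c3]]]]] := pickf x x' xK x'K.
  apply: (@chord_off T H N L maxN a c t y bt (inl x) (inl x') [:: inr f1; inl y; inr f2; inl z; inr f3]) => //; try exact: Kc.
  - by rewrite /= xf1 yf1 yf2 zf2 zf3 xf3.
  - by rewrite /= !in_cons !in_nil !orbF /= (inj_eq inl_inj) !(inj_eq inr_inj) (negbTE f12) (negbTE f13) (negbTE f23) eq_sym zy.
  - by move=> u; rewrite !in_cons in_nil orbF => /or4P[/eqP->|/eqP->|/eqP->|/orP[]/eqP->] //;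
      apply: out; [left|right].
have farE x e : x \in K a c y -> e \in on_edges (a :: c) y -> inr e \in c ->
    (index (inl x : node) c < index (inr e : node) c -> 4 + index (inl x : node) c < index (inr e : node) c) /\
    (index (inr e : node) c < index (inl x : node) c -> 4 + index (inr e : node) c < index (inl x : node) c).
  move=> xK /on_edgesP[ye _] ec.
  have [f1 [f2 [f3 [[xf1 yf1 yf2 zf2 zf3] xf3 [f12 f13 f23] [c1 c2 c3]]]]] := pickf x x xK xK.
  split=> lt.
    apply: (@chord_off T H N L maxN a c t y bt (inl x) (inr e) [:: inr f3; inl z; inr f2; inl y]) => //; try exact: Kc.
    + by rewrite /= xf3 yf2 zf2 zf3 ye.
    + by rewrite /= !in_cons !in_nil !orbF /= (inj_eq inl_inj) !(inj_eq inr_inj) eq_sym (negbTE f23) zy.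
    + by move=> u; rewrite !in_cons in_nil orbF => /or4P[]/eqP-> //; apply: out; [right|left].
  apply: (@chord_off T H N L maxN a c t y bt (inr e) (inl x) [:: inl y; inr f2; inl z; inr f3]) => //; try exact: Kc.
  + by rewrite /= xf3 yf2 zf2 zf3 ye.
  + by rewrite /= !in_cons !in_nil !orbF /= (inj_eq inl_inj) !(inj_eq inr_inj) (negbTE f23) eq_sym zy.
  + by move=> u; rewrite !in_cons in_nil orbF => /or4P[]/eqP-> //; apply: out; [left|right].
have [K0|/card_gt0P[x xK]] := posnP #|K a c y|; first exact: tight_all bt K0.
have [f fO xf] := thick_mem xK.
have gO : @good T H L a c t f := all_good r3 rk unif mindeg maxN leN maxL L3 L2k bt fO.
have [Ex ux] := cpos_V bt gO xf (Kc x xK).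
have K1 : 0 < #|K a c y| by apply/card_gt0P; exists x.
have uK : cpos L c (inl x) < 2 * #|K a c y|.
  have := best_V r3 rk leN bt; have LL := odd_double_half L; have [_ _ pL] := tail_sizes L3 bt.
  rewrite pL aV add0n in LL; move: hk ux LL r3 rk.
  by move: #|K a c y| (cpos _ _ _) #|_| => x1 x2 x3; clear; lia.
move: Ex uK {ux}; move: {1 2}(cpos L c (inl x)) => u Ex uK.
(* The position just before the two taken by [x], or just after them if [u = 0]. Whatever occupies
   it is closer to [x] than [farK] and [farE] allow. *)
have far i : i <= 2 * #|K a c y| -> i.+1 = u \/ u = 0 /\ i = 2 -> False.
  move=> ile hi; have [|[x' [x'K x'c Ex' Ei]]|[e [eD ec Ee]]] := @tight_cover a c t y bt i.
  - by rewrite addn1 ltnS.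
  - have := farK x x' xK x'K; have := farK x' x x'K xK; rewrite Ex Ex'.
    by move: Ei hi; clear; lia.
  - have [] := farE x e xK eD ec; rewrite Ex Ee.
    by move: hi; clear; lia.
case: u Ex uK far => [|u] Ex uK far.
  by apply: (far 2); [move: K1; clear; lia | right].
by apply: (far u); [apply: ltnW; apply: ltnW | left].
Qed.

End Incidence.

(** * Two disjoint paths to a cycle *)

Section Fan.

Variables (U : finType) (g : rel U).
Hypothesis gC : symmetric g.
Hypothesis conn : forall s x y : U, x != s -> y != s -> connect (delete g [set s]) x y.

Implicit Types (A B C : {pred U}) (u v x : U) (p q s : seq U).

Definition hits A v p := [&& path g v p, last v p \in A & all [predC A] (belast v p)].

Lemma prefix_hit A v p : path g v p -> last v p \in A ->
  exists p1 p2, p = p1 ++ p2 /\ hits A v p1.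
Proof.
elim: p v => [|w p IHp] v /= pp lA; first by exists [::], [::]; rewrite /hits /= lA.
have [vA|vA] := boolP (v \in A); first by exists [::], (w :: p); rewrite /hits /= vA.
case/andP: pp => gvw pw; have [p1 [p2 [-> /and3P[h1 h2 h3]]]] := IHp w pw lA.
by exists (w :: p1), p2; rewrite /hits /= gvw h1 h2 h3 vA.
Qed.

Lemma first_hit A u v b : v != u -> b \in A -> b != u ->
  exists p, [/\ hits A v p, uniq (v :: p) & u \notin v :: p].
Proof.
move=> vu bA bu; have /connectP[p0 pp0 Eb] := conn vu bu.
case/shortenP: pp0 Eb => p pp up _ Eb; rewrite {}Eb in bA.
have pg : path g v p by apply: sub_path pp => x y /and3P[].
have un : u \notin v :: p.
  rewrite inE eq_sym (negbTE vu) /=; elim: (p) (v) pp => //= w q IHq x /andP[/and3P[_ + _] /IHq h].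
  by rewrite in_set1 inE eq_sym negb_or h => ->.
have [p1 [p2 [Ep hp]]] := prefix_hit pg bA; exists p1; split=> //.
  by move: up; rewrite Ep -cat_cons cat_uniq => /andP[].
by apply: contra un; rewrite Ep -cat_cons mem_cat => ->.
Qed.

Lemma hits_cons A u v p : g v u -> v \notin A -> hits A u p -> hits A v (u :: p).
Proof. by move=> gvu vA /and3P[h1 h2 h3]; rewrite /hits /= gvu h1 h2 vA. Qed.

(* A path [r] that meets [q1] follows it to [A], leaving [q2] untouched. *)
Lemma fan_merge A v q1 q2 w r : hits A v q1 -> uniq (v :: q1 ++ q2) ->
    hits [predU A & [predU mem q1 & mem q2]] w r -> uniq (w :: r) -> v \notin w :: r ->
    last w r \in q1 ->
  exists p, [/\ hits A w p, uniq (w :: p ++ v :: q2) & last w p = last v q1].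
Proof.
move=> hq1 uq /and3P[pr _ /allP ar] ur vr hit.
have [s1 [s2 [Eq _ _]]] := split_index1 hit; have [h Eh] : exists h, last w r = h by exists (last w r).
have Er := lastI w r; rewrite Eh in Eq Er.
have [pq lq] : path g v q1 /\ last v q1 \in A by case/and3P: hq1.
have aq : all [predC A] (belast v q1) by case/and3P: hq1.
have /and4P[nh nv us _] : [&& h \notin v :: s2 ++ q2, v \notin s2 ++ q2, uniq (s2 ++ q2) & true].
  have : uniq ((h :: v :: s2 ++ q2) ++ s1).
    by rewrite (perm_uniq (_ : perm_eq _ (v :: q1 ++ q2))) // Eq; perm_by_count.
  by rewrite [uniq (_ ++ s1)]cat_uniq !cons_uniq -!andbA => /and4P[-> -> ->].
have sub u : u \in s2 ++ q2 -> (u \in q1) || (u \in q2).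
  by rewrite Eq !mem_cat inE; case/orP => ->; rewrite ?orbT.
have wr u : u \in s2 ++ v :: q2 -> u \notin w :: r.
  have [->|nu us2] := eqVneq u v; first by [].
  rewrite Er mem_rcons inE.
  have uq2 : u \in s2 ++ q2 by move: us2; rewrite !mem_cat inE (negbTE nu).
  apply/norP; split; first by apply: contraNneq nh => <-; rewrite inE uq2 orbT.
  by apply/negP => /ar /=; rewrite !inE (orbA (u \in A)) -orbA sub ?orbT.
exists (r ++ s2); split.
- have /and3P[_ ph ah] : [&& path g v s1, path g h s2 & all [predC A] (belast h s2)].
    move: pq aq; rewrite Eq cat_path belast_cat all_cat /= => /and3P[-> _ ->] /and3P[_ _ ->].
    done.
  rewrite /hits cat_path last_cat belast_cat all_cat pr Eh ph ah andbT.
  have arA : all [predC A] (belast w r) by apply/allP => u /ar; rewrite /= !inE => /norP[].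
  have lh : last h s2 \in A by move: lq; rewrite Eq last_cat.
  by rewrite arA lh.
- rewrite -catA -cat_cons cat_uniq ur (_ : uniq (s2 ++ v :: q2)) ?andbT /=; last first.
    by rewrite (perm_uniq (perm_middle _ _ _)) cons_uniq nv.
  by apply/hasPn => u /wr.
- by rewrite last_cat Eh Eq last_cat.
Qed.

(** Menger's theorem for two paths, strengthened by prescribing [x0] as one of the two end points.
    The other start [v] is arbitrary, which lets the property travel along a path from [x0]. *)
Definition fans A x0 u := forall v, v != u -> exists p q, [/\ hits A v p, hits A u q,
  uniq (v :: p ++ u :: q) & x0 \in [:: last v p; last u q]].

Lemma fans_self A x0 x : x0 \in A -> x \in A -> x != x0 -> fans A x0 x0.
Proof.
move=> x0A xA xx0 v vx0; have [p [hp up np]] := first_hit vx0 xA xx0.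
exists p, [::]; split=> //; first by rewrite /hits /= x0A.
  by rewrite -cat_cons cats1 rcons_uniq np.
by rewrite !inE eqxx orbT.
Qed.

(** The fan at [u] for the start [v] gives two paths from [v] to [A]. A path from [w] that avoids
    [v] either meets one of them and follows it, leaving the other to [v], or reaches [A] without
    meeting them; then [v] takes the one ending at [x0]. *)
Lemma fans_step A x0 u v : x0 \in A -> fans A x0 u -> g u v -> v \notin A -> v != u -> fans A x0 v.
Proof.
move=> x0A fu guv vA vu w wv; have [q1 [q0 [h1 h0 uq0 lx0]]] := fu v vu.
have h2 : hits A v (u :: q0) by apply: hits_cons; rewrite // gC.
move: (u :: q0) h2 uq0 (lx0 : x0 \in [:: last v q1; last v (u :: q0)]) => q2 h2 uq {}lx0.
have x0v : x0 != v by apply: contraTneq x0A => ->.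
have [r [hr ur vr]] : exists r, [/\ hits [predU A & [predU mem q1 & mem q2]] w r, uniq (w :: r) & v \notin w :: r].
  by apply: (@first_hit _ v w x0) => //; rewrite inE /= x0A.
have uq' : uniq (v :: q2 ++ q1) by move: uq; rewrite /= !mem_cat orbC uniq_catC.
have [hit1|n1] := boolP (last w r \in q1).
  have [p [hp up Ep]] := fan_merge h1 uq hr ur vr hit1.
  by exists p, q2; rewrite Ep.
have [hit2|n2] := boolP (last w r \in q2).
  have hr' : hits [predU A & [predU mem q2 & mem q1]] w r.
    move: hr; rewrite /hits => /and3P[-> h3 h4]; apply/and3P; split=> //.
      by move: h3; rewrite !inE /=; case: (_ \in A) => //=; rewrite orbC.
    by apply/allP => x /(allP h4); rewrite /= !inE ![(x \in q1) || _]orbC.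
  have [p [hp up Ep]] := fan_merge h2 uq' hr' ur vr hit2.
  by exists p, q1; split=> //; rewrite Ep; move: lx0; rewrite !inE orbC.
have hrA : hits A w r.
  have /and3P[pr lr ar] := hr; apply/and3P; split=> //.
    by move: lr; rewrite !inE /= (negbTE n1) (negbTE n2) !orbF.
  by apply/allP => x /(allP ar); rewrite /= !inE => /norP[].
have free x : x \in w :: r -> x \notin q1 /\ x \notin q2.
  rewrite lastI mem_rcons inE => /predU1P[->//|]; have /and3P[_ _ /allP ar] := hr.
  by move/ar; rewrite /= !inE => /norP[_ /norP].
have [q [hq sq uqq Eq]] : exists q, [/\ hits A v q, {subset q <= q1 ++ q2}, uniq (v :: q) & x0 = last v q].
  move: lx0; rewrite !inE => /orP[] /eqP Eq; [exists q1 | exists q2]; split=> //.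
  - by move=> x; rewrite mem_cat => ->.
  - by move: uq; rewrite -cat_cons cat_uniq => /andP[].
  - by move=> x; rewrite mem_cat orbC => ->.
  - by move: uq'; rewrite -cat_cons cat_uniq => /andP[].
exists r, q; split=> //; last by rewrite Eq !inE eqxx orbT.
rewrite -cat_cons cat_uniq ur uqq andbT /=; apply/norP; split=> //.
apply/hasPn => x /sq; rewrite mem_cat => xq; apply/negP => /free[/negbTE h3 /negbTE h4].
by rewrite h3 h4 in xq.
Qed.

Lemma fans_path A x0 x w : x0 \in A -> x \in A -> x != x0 -> path g x0 w -> uniq (x0 :: w) ->
  all [predC A] w -> fans A x0 (last x0 w).
Proof.
move=> x0A xA xx0; elim/last_ind: w => [|w v IHw]; first by move=> *; apply: fans_self xA xx0.
rewrite rcons_path -rcons_cons rcons_uniq all_rcons last_rcons => /andP[pw gv] /andP[vw uw] /andP[vA aw].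
apply: (fans_step x0A (IHw pw uw aw)) => //.
by apply: contraNneq vw => ->; rewrite mem_last.
Qed.

Lemma hits_suffix A v p p1 c p2 : hits A v p -> v :: p = p1 ++ c :: p2 ->
  hits A c p2 /\ last c p2 = last v p.
Proof.
case: p1 => [|b p1]; first by move=> h [<- <-].
move=> /and3P[h1 h2 h3] [Ev Ep]; move: h1 h2 h3; rewrite Ep cat_path last_cat belast_cat all_cat /=.
by move=> /and3P[_ _ h1] h2 /and3P[_ _ h3]; rewrite /hits h1 h2 h3.
Qed.

(** Both paths of a fan start in [C]; only the parts after their last visits to [C] are kept. *)
Lemma two_paths A C x0 x w b : x0 \in A -> x \in A -> x != x0 -> path g x0 w -> uniq (x0 :: w) ->
    all [predC A] w -> last x0 w \in C -> b \in C -> b != last x0 w ->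
  exists c1 p1 c2 p2, [/\ hits A c1 p1, hits A c2 p2, uniq (c1 :: p1 ++ c2 :: p2), c1 \in C /\ c2 \in C
    & [/\ all [predC C] p1, all [predC C] p2 & last c1 p1 = x0]].
Proof.
move=> x0A xA xx0 pw uw aw lC bC bl.
have [p [q [hp hq upq lx0]]] := fans_path x0A xA xx0 pw uw aw bl.
have exit v s : v \in C -> exists s1 c s2, [/\ v :: s = s1 ++ c :: s2, c \in C & all [predC C] s2].
  move=> vC; have [|s1 [c [s2 [Es cC nC]]]] := @split_last _ (mem C) (v :: s); first by rewrite /= vC.
  by exists s1, c, s2; rewrite all_predC.
have [p1 [c1 [p2 [Ep c1C ap2]]]] := exit b p bC.
have [q1 [c2 [q2 [Eq c2C aq2]]]] := exit _ q lC.
have [hp2 lp2] := hits_suffix hp Ep; have [hq2 lq2] := hits_suffix hq Eq.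
have u1 : uniq (c1 :: p2 ++ c2 :: q2).
  move: upq; rewrite -cat_cons Ep Eq -catA cat_uniq => /and3P[_ _].
  rewrite -!cat_cons !cat_uniq => /and3P[-> + /andP[_ /andP[_ ->]]].
  by rewrite has_cat negb_or => /andP[_ ->].
move: lx0; rewrite !inE -lp2 -lq2 => /orP[] /eqP El.
  by exists c1, p2, c2, q2.
exists c2, q2, c1, p2; split=> //.
by rewrite -cat_cons uniq_catC.
Qed.

Lemma long_arc (s : seq U) u v : ucyc g s -> u \in s -> v \in s -> u != v ->
  exists m, [/\ path g u (rcons m v), uniq m, {subset m <= s}, u \notin m /\ v \notin m
    & size s <= (2 * size m).+2].
Proof.
move=> cy us vs uv; have [d cyd pd] := ucyc_from cy us.
have vd : v \in d by move: vs; rewrite -(perm_mem pd) inE eq_sym (negbTE uv).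
have [m1 [m2 [Ed _ _]]] := split_index1 vd; have /andP[pc uc] := cyd.
have sub w : w \in m1 ++ m2 -> w \in s.
  by rewrite -(perm_mem pd) Ed inE !mem_cat inE => /orP[] ->; rewrite ?orbT.
have : uniq ((u :: v :: m1) ++ m2).
  by rewrite (perm_uniq (_ : perm_eq _ (u :: d))) // Ed; perm_by_count.
rewrite cat_uniq => /and3P[/and3P[/norP[_ um1] vm1 uq1] /hasPn dis uq2].
have sz : size s = (size m1 + size m2).+2 by rewrite -(perm_size pd) Ed /= size_cat /= addnS.
have [le12|lt21] := leqP (size m2) (size m1).
  exists m1; split=> //.
  - move: pc; rewrite Ed /= rcons_cat cat_path => /and3P[h1 h2 _].
    by rewrite rcons_path h1.
  - by move=> w wm; apply: sub; rewrite mem_cat wm.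
  - by rewrite sz !ltnS mul2n -addnn leq_add2l.
exists (rev m2); split.
- by rewrite -path_rcons_rev //; move: pc; rewrite Ed /= rcons_cat cat_path => /and3P[].
- by rewrite rev_uniq.
- by move=> w; rewrite mem_rev => wm; apply: sub; rewrite mem_cat wm orbT.
- by split; rewrite mem_rev; apply/negP => /dis; rewrite !inE eqxx ?orbT.
- by rewrite sz size_rev !ltnS mul2n -addnn leq_add2r ltnW.
Qed.

(** The longer arc between [c1] and [c2], the two paths and [z] form a cycle. The arc contributes at
    least [N / 2 - 1] nodes, whence the factor 2; if [x0] is off the cycle, the path ending at [x0]
    adds one more node. *)
Lemma fan_cycle N A a c x0 x w : (forall s, ucyc g s -> size s <= N) ->
    ucyc g (a :: c) -> size (a :: c) = N -> 0 < size c ->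
    x0 \in A -> x \in A -> x != x0 -> path g x0 w -> uniq (x0 :: w) -> all [predC A] w ->
    last x0 w = a -> (forall u, u \in A -> u \in a :: c -> u = x0) ->
  exists x1, [/\ x1 \in A, x1 != x0, exists u, g u x1 /\ u \notin A &
    forall z, path g x1 z -> last x1 z = x0 -> uniq (x1 :: z) -> {subset x1 :: z <= A} ->
      2 * size (x1 :: z) + 2 * (x0 \notin a :: c) <= N].
Proof.
move=> maxN cy szN c0 x0A xA xx0 pw uw aw lw AC.
have [b bC ba] : exists2 b, b \in a :: c & b != last x0 w.
  move: cy c0; rewrite lw; case: (c) => //= b c' /andP[_ /andP[ac _]] _.
  exists b; first by rewrite !inE eqxx orbT.
  by apply: contraNneq ac => ->; rewrite mem_head.
have lC : last x0 w \in a :: c by rewrite lw mem_head.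
have [c1 [p1 [c2 [p2 [h1 h2 u12 [c1C c2C] [a1 a2 l1]]]]]] :=
  @two_paths A (mem (a :: c)) x0 x w b x0A xA xx0 pw uw aw lC bC ba.
have dis u : u \in c1 :: p1 -> u \notin c2 :: p2.
  by move: u12; rewrite -cat_cons cat_uniq => /and3P[_ /hasPn h _] u1; apply/negP => /h /negP.
have c12 : c1 != c2 by have := dis c1 (mem_head _ _); rewrite inE => /norP[].
have [m [pm um mC [c1m c2m] szm]] := long_arc cy c1C c2C c12.
have /and3P[pp1 lA1 b1] := h1; have /and3P[pp2 lA2 b2] := h2.
have x0c1 : x0 \in c1 :: p1 by rewrite -l1 mem_last.
have x1x0 : last c2 p2 != x0 by apply: contraTneq x0c1 => <-; apply: contraL (mem_last c2 p2) => /dis.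
exists (last c2 p2); split=> //.
  case/lastP: p2 {h2 u12} a2 x1x0 lA2 pp2 b2 {dis} => [|p2 y] a2 x1x0 lA2 pp2 b2.
    by case/eqP: x1x0; apply: AC.
  exists (last c2 p2); move: pp2 b2; rewrite rcons_path last_rcons belast_rcons => /andP[_ gy].
  by split=> //; move: b2 => /allP/(_ _ (mem_last c2 p2)).
move=> z pz lz uz zA; set s := c2 :: p2 ++ z ++ rev (belast c1 p1) ++ m.
have p1A u : u \in belast c1 p1 -> u \notin A by move/(allP b1).
have p2A u : u \in c2 :: p2 -> u \in A -> u = last c2 p2.
  by rewrite lastI mem_rcons inE => /predU1P[//|/(allP b2)/negP h /h].
have c1last : last x0 (rev (belast c1 p1)) = c1.
  by rewrite -l1; case: (p1) => //= v p; rewrite rev_cons last_rcons.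
have zA' u : u \in z -> u \in A by move=> uinz; apply: zA; rewrite inE uinz orbT.
have mA u : u \in m -> u \notin A.
  move=> um'; apply/negP => uA; have Eu := AC u uA (mC u um').
  move: l1 a1 c1m; case: (p1) => [|v p] /=; first by move=> ->; rewrite -Eu um'.
  by move=> lp /andP[vC /allP pC]; have := mem_last v p; rewrite lp -Eu inE => /predU1P[Ev|/pC/negP[]];
    [rewrite -Ev (mC u um') in vC | apply: mC].
have cs : ucyc g s.
  apply/andP; split.
    rewrite /= !rcons_cat !cat_path pp2 pz lz c1last pm andbT.
    by rewrite -{1}l1 rev_path (eq_path (e' := g)) // => u v; rewrite gC.
  rewrite /s -cat_cons !cat_uniq rev_uniq um.
  have up2 : uniq (c2 :: p2) by move: u12; rewrite -cat_cons cat_uniq => /and3P[].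
  have up1 : uniq (belast c1 p1).
    by move: u12; rewrite -cat_cons cat_uniq lastI rcons_uniq => /and3P[/andP[]].
  have uz' : uniq z by case/andP: uz.
  rewrite up2 uz' up1 /=; apply/and3P; split.
  - apply/hasPn => u; rewrite !mem_cat mem_rev => /or3P[uz2|u1|um2]; apply/negP => u2.
    + by have Eu := p2A u u2 (zA' u uz2); move: uz; rewrite /= -Eu uz2.
    + by have /dis/negP := mem_belast u1; apply.
    + move: u2; rewrite inE => /predU1P[Eu|]; first by rewrite -Eu um2 in c2m.
      by move/(allP a2) => /negP; apply; apply: mC.
  - by apply/hasPn => u; rewrite mem_cat mem_rev => /orP[/p1A|/mA] h; apply/negP => /zA'; apply/negP.
  - rewrite andbT; apply/hasPn => u um2; rewrite mem_rev; apply/negP => u1.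
    have := mem_belast u1; rewrite inE => /predU1P[Eu|]; first by rewrite -Eu um2 in c1m.
    by move/(allP a1) => /negP; apply; apply: mC.
have := maxN s cs; rewrite /s /= !size_cat size_rev size_belast.
have p2n : 0 < size p2.
  by move: x1x0 lA2; case: (p2) => //= x1x0 lA2; case/eqP: x1x0; apply: AC.
have p1n : (x0 \notin a :: c) <= size p1.
  case: (boolP (x0 \in a :: c)) => // x0C; move: l1 x0C; case: (p1) => //= <-.
  by rewrite c1C.
by move: p1n p2n szm szN; rewrite /=; move: (nat_of_bool _) (size p1) (size p2) (size m); clear; lia.
Qed.

End Fan.

(** * Long tails *)

Section Seq.

Variables (U : eqType) (g : rel U).
Hypothesis gC : symmetric g.

Lemma sorted_mid (p : seq U) u s : sorted g (p ++ u :: s) = sorted g (rcons p u) && path g u s.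
Proof. by case: p => [|b p] //=; rewrite cat_path rcons_path /= andbA. Qed.

Lemma sorted_revC (s : seq U) : sorted g (rev s) = sorted g s.
Proof.
rewrite rev_sorted; case: s => //= x s.
by apply: eq_path => u v; rewrite gC.
Qed.

Lemma uniq_part (z q s : seq U) : perm_eq (z ++ q) s -> uniq s -> uniq z /\ {subset z <= s}.
Proof.
move=> ps us; split; first by move: us; rewrite -(perm_uniq ps) cat_uniq => /andP[].
by move=> u uz; rewrite -(perm_mem ps) mem_cat uz.
Qed.

Lemma consec_index (s p q : seq U) u v : uniq s -> s = p ++ u :: v :: q ->
  [/\ u \in s, v \in s & index v s = (index u s).+1].
Proof.
move=> us Es; rewrite Es in us *; rewrite !mem_cat !inE !eqxx !orbT; split=> //.
move: us; rewrite cat_uniq => /and3P[_ /hasPn h /= /andP[+ _]]; rewrite inE negb_or => /andP[uv _].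
have /negbTE up : u \notin p by apply: h; rewrite inE eqxx.
have /negbTE vp : v \notin p by apply: h; rewrite !inE eqxx orbT.
by rewrite !index_cat up vp /= eqxx (negbTE uv) eqxx addn0 addn1.
Qed.

End Seq.

Section Incidence.

Variables (T : finType) (H : {set {set T}}).

Local Notation E := {e : {set T} | e \in H}.
Local Notation node := (T + E)%type.
Local Notation g := (@incidence_graph T H).
Local Notation isV := (@isV T H).
Local Notation Vs := (@Vs T H).
Local Notation Es := (@Es T H).
Local Notation edges_at := (@edges_at T H).
Local Notation gC := (@inc_sym T H).

Variables (k r N L : nat).
Hypotheses (r3 : 2 < r) (rk : r <= k - 2) (unif : uniform r H).
Hypothesis mindeg : forall y, 'C(k - 1, r - 1) + 1 <= degree H y.
Hypothesis maxN : forall s : seq node, ucyc g s -> size s <= N.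
Hypothesis leN : N <= 2 * (2 * k - 1).
Hypothesis maxL : forall (a : node) (c t : seq node), lolli g a c t -> size (a :: c) = N ->
  isV (last a t) -> size t <= L.
Hypotheses (L3 : 2 < L) (L2k : 2 * k - 2 < L).

Hypothesis conn : forall s x y : node, x != s -> y != s -> connect (delete g [set s]) x y.

Local Notation best := (@best T H N L).



Lemma thick0 (F : {set E}) : thick set0 F = set0 :> {set T}.
Proof. by apply/setP => w; rewrite !inE. Qed.

Lemma thin0 (F : {set E}) : thin set0 F = set0 :> {set E}.
Proof.
by apply/setP => f; rewrite !inE; apply/negbTE/nandP; right; apply/existsPn => x; rewrite inE.
Qed.

(** * The nodes of a long tail that edges at its end reach *)

Section Frame.

Variables (a : node) (c t : seq node) (y : T).
Hypothesis bt : best a c t y.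

Local Notation O := (out_edges a c t y).
Local Notation P := (a :: t).

Definition mates : {set T} := [set w | (w != y) && [exists f in O, w \in val f]].
Definition tail_edges : {set E} := edges_at y :&: Es P.
Local Notation M := mates.
Local Notation B := tail_edges.

Lemma matesP w : reflect (w != y /\ exists2 f, f \in O & w \in val f) (w \in M).
Proof.
rewrite inE; apply: (iffP andP) => [[wy /existsP[f /andP[fO wf]]]|[wy [f fO wf]]].
  by split=> //; exists f.
by split=> //; apply/existsP; exists f; rewrite fO.
Qed.

Lemma size_c_lt : size c <= 4 * k - 3.
Proof. by have [_ szN _ _] := bt; move: szN leN r3 rk; rewrite /=; clear; lia. Qed.

(** A link would leave more than [L] nodes of [c] on either side, too many for a cycle of at most
    [4 * k - 2] nodes. *)
Lemma no_link (f : E) w : @good T H L a c t f -> w \in val f -> inl w \in P.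
Proof.
move=> gf wf; have [wact wl] := gf w wf; move: wact; rewrite -cat_cons mem_cat inE -orbA.
case/or3P => [/eqP->|wc|wt]; rewrite ?mem_head //; last by rewrite inE wt orbT.
have [_ l1 l2] := wl wc; exfalso; have := size_c_lt; move: l1 l2 L2k r3 rk; clear.
by move: (index _ _) (size c); lia.
Qed.

Lemma out_P (f : E) w : f \in O -> w \in val f -> inl w \in P.
Proof. by move=> fO; apply: no_link; apply: (out_good maxN maxL bt (ltnW (ltnW L3)) fO). Qed.

Lemma out_notP (f : E) : f \in O -> inr f \notin P.
Proof.
by case/out_edgesP => _ fac ft; rewrite inE negb_or ft andbT; apply: contraNneq fac => <-; apply: mem_head.
Qed.

Lemma edges_split : edges_at y \subset O :|: B.
Proof.
apply/subsetP => e eE; rewrite in_setU in_setI eE in_Es orbC.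
have [//|eP] := boolP (inr e \in P); apply: out_edgesI.
- by move: eE; rewrite inE.
- apply/negP => eac; have ec : inr e \in c.
    by move: eac; rewrite inE => /predU1P[Ea|//]; rewrite -Ea mem_head in eP.
  have eD : e \in on_edges (a :: c) y by rewrite in_setI eE in_Es.
  have [l1 l2] := on_index maxN bt eD ec; have := size_c_lt; move: l1 l2 L2k r3 rk; clear.
  by move: (index _ _) (size c); lia.
- by apply: contra eP; rewrite inE orbC => ->.
Qed.

Lemma out_count : #|O| <= 'C(#|M|, r - 1) /\
  (#|O| = 'C(#|M|, r - 1) -> forall S : {set T}, S \subset M -> #|S| = r - 1 ->
    exists2 f, f \in O & val f = y |: S).
Proof.
have yM : y \notin M by rewrite inE eqxx.
have [|h1 h2] := @card_thick_thin T H set0 O M y r yM (negbT (in_set0 y)).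
  move=> f fO; have [yf _ _] := out_edgesP fO; split=> //; first exact: (card_edge unif).
  apply/subsetP => w wf; rewrite setU0 in_setU1; have [//|wy] := eqVneq w y.
  by apply/matesP; split=> //; exists f.
by move: h1 h2; rewrite thick0 thin0 setU0 cards0 addn0 -subn1 => h1 h2; split=> // /h2; apply.
Qed.

Lemma tail_count : 'C(k - 1, r - 1) + 1 <= #|O| + #|B|.
Proof.
apply: leq_trans (mindeg y) _; rewrite -card_edges_at.
by apply: leq_trans (subset_leq_card edges_split) (leq_card_setU _ _).
Qed.

(** The nodes of the tail where a path can arrive from [y]: a mate through an outside edge, a tail
    edge at [y] directly. *)
Definition reach (u : node) := match u with inl w => w \in M | inr e => y \in val e end.


(* The paths of the fan avoid these edges, so they may serve to lengthen a path in [X]. *)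
Definition spare (X : seq node) (f : E) :=
  [&& inr f \notin P, inr f \notin a :: c & [forall w in val f, inl w \in X]].

(* The tail from its first reach node [x0 = head rn xa] on is [xa ++ rn :: gap ++ x1 :: xb],
   where [x1] is the second end of the fan and [rn] the last reach node before it. *)
Definition framed s1 xa rn gap x1 xb :=
  [/\ P = s1 ++ xa ++ rn :: gap ++ x1 :: xb, reach (head rn xa) /\ reach rn, ~~ has reach (s1 ++ gap) &
   forall z, sorted g z -> uniq z ->
     {subset z <= [pred u | (u \in xa ++ rn :: gap ++ x1 :: xb) ||
       (if u is inr f then spare (xa ++ rn :: gap ++ x1 :: xb) f else false)]} ->
     head a z = x1 -> last a z = head rn xa -> size z + (s1 != [::]) <= 2 * k - 1].

(** This is [fan_cycle] for the tail from its first reach node on, enlarged by the spare edges; the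
    constant [2 * k - 1] is half the bound on [N]. *)
Lemma frame : exists s1 xa rn gap x1 xb, framed s1 xa rn gap x1 xb.
Proof.
have [pt ly szt uat dt] := best_tail bt.
have L0 := ltnW (ltnW L3).
have yP : inl y \in P by rewrite inE (y_tail L3 bt) orbT.
have yr : ~~ reach (inl y) by rewrite /= inE eqxx.
have hasr : has reach P.
  have [|s1 [e [t2 [Et ye]]]] := tail_before bt (y_tail L3 bt).
    by rewrite (y_index L3 bt); move: L3; clear; lia.
  by apply/hasP; exists (inr e) => //; rewrite Et -cat_cons mem_cat mem_head orbT.
have [s1 [x0 [s2 [EP x0r ns1]]]] : exists s1 x0 s2, [/\ P = s1 ++ x0 :: s2, reach x0 & ~~ has reach s1].
  case: (split_find hasr) => x0 s1 s2 x0r ns1.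
  by exists s1, x0, s2; rewrite cat_rcons.
have sP : sorted g P by [].
pose A : {pred node} := [pred u | (u \in x0 :: s2) || (if u is inr f then spare (x0 :: s2) f else false)].
have inA u : u \in A -> u \in x0 :: s2 \/ exists2 f, u = inr f & spare (x0 :: s2) f.
  by case/orP => [->|]; [left | case: u => // f; right; exists f].
have us : uniq (s1 ++ x0 :: s2) by rewrite -EP.
have dis u : u \in s1 -> u \notin x0 :: s2.
  by move: us; rewrite cat_uniq => /and3P[_ /hasPn h _] u1; apply/negP => /h /negP.
have x0A : x0 \in A by apply/orP; left; apply: mem_head.
have yA : inl y \in A.
  move: yP; rewrite EP mem_cat inE /= => /orP[y1|y2]; last by apply/orP; left.
  have : last a t \in x0 :: s2.
    have -> : last a t = last x0 s2 by rewrite -[last a t]/(last a P) EP last_cat.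
    exact: mem_last.
  by rewrite ly => y2; have := dis _ y1; rewrite y2.
have yx0 : inl y != x0 by apply: contraNneq yr => ->.
have pw : path g x0 (rev s1).
  by move: sP; rewrite EP sorted_mid => /andP[+ _]; rewrite -(sorted_revC gC) rev_rcons.
have uw : uniq (x0 :: rev s1).
  by move: us; rewrite -cat_rcons cat_uniq -rev_rcons rev_uniq => /and3P[].
have aw : all [predC A] (rev s1).
  rewrite all_rev; apply/allP => u u1; rewrite /=; apply/negP => /inA[u2|[f Eu fO]].
    by have := dis u u1; rewrite u2.
  by have /and3P[/negP[]] := fO; rewrite -Eu EP mem_cat u1.
have [lw a0] : last x0 (rev s1) = a /\ (s1 = [::] -> x0 = a).
  by move: EP; case: (s1) => [[<-]|b s1' [-> _]] //; rewrite rev_cons last_rcons.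
have AC u : u \in A -> u \in a :: c -> u = x0.
  case/inA => [u2 uac|[f -> /and3P[_ /negP fac _]] //].
  have : u \in P by rewrite EP mem_cat; apply/orP; right.
  rewrite inE => /predU1P[Eu|/dt]; last by rewrite uac.
  have -> : u = a by [].
  case Es: s1 a0 => [|b s1'] a0; first by rewrite a0.
  by move: EP; rewrite Es => -[Eb _]; have := dis u; rewrite u2 Es Eu Eb mem_head => /(_ isT).
have [/and4P[cy _ _ _] szN _ _] := bt.
have c0 : 0 < size c by have [-> V0] := size_c_odd bt; move: V0; clear; lia.
have [x1 [x1A x10 [u [gux1 uA]] bound]] :=
  fan_cycle gC conn maxN cy szN c0 x0A yA yx0 pw uw aw lw AC.
(* A spare edge has all its neighbours in [A], whereas [x1] has one outside. *)
have x1s : x1 \in s2.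
  case/inA: (x1A) => [|[f Ex /and3P[_ _ /forall_inP sf]]]; first by rewrite inE (negbTE x10).
  case/negP: uA; move: gux1; rewrite Ex; case: u => [w|//] wf.
  by apply/orP; left; apply: sf.
have [d [xb [Es2 _ _]]] := split_index1 x1s.
have [|xa' [rn [gap [Ed rnr ngap]]]] := @split_last _ reach (x0 :: d); first by rewrite /= x0r.
exists s1, xa', rn, gap, x1, xb.
have Ex : xa' ++ rn :: gap ++ x1 :: xb = x0 :: s2 by rewrite Es2 -cat_cons catA -Ed.
have z0 : head rn xa' = x0 by move: Ed; case: (xa') => [|? ?] [].
split; rewrite ?Ex ?z0 //; first by rewrite has_cat negb_or ns1.
move=> z sz uz zA hz lz.
case: z sz uz zA hz lz => [|x z] sz uz zA hz lz.
  by rewrite add0n; move: r3 rk; case: (_ != _); clear; lia.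
move: hz lz; rewrite /= => Ex1 lz; rewrite Ex1 in sz uz zA lz.
have s1x0 : (s1 != [::]) <= (x0 \notin a :: c).
  case: eqP => // s1n; rewrite lt0b; apply: dt; move: EP s1n; case: (s1) => // b s1' [_ ->] _.
  by rewrite mem_cat mem_head orbT.
have := bound z sz lz uz zA; move: s1x0 leN r3 rk.
rewrite [size (x1 :: z)]/=; move: (nat_of_bool _) (nat_of_bool _) (size z); clear; lia.
Qed.

(** * Paths inside a frame *)

Section Framed.

Variables (s1 xa : seq node) (rn : node) (gap : seq node) (x1 : node) (xb : seq node).
Hypothesis fr : framed s1 xa rn gap x1 xb.

Local Notation K := (xa ++ rn :: x1 :: xb).
Local Notation X := (xa ++ rn :: gap ++ x1 :: xb).

Lemma framed_tail : [/\ uniq X, sorted g (rcons xa rn), sorted g (x1 :: xb), last x1 xb = inl y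
  & forall u, reach u -> u \in P -> u \in K].
Proof.
have [EP _ nr _] := fr; have [pt ly _ uat _] := best_tail bt.
have sP : sorted g P by [].
split.
- by move: uat; rewrite EP cat_uniq => /and3P[].
- move: sP; rewrite EP; case: (s1) => [|b s']; first by rewrite cat0s sorted_mid => /andP[].
  by rewrite /= cat_path => /andP[_ /path_sorted]; rewrite sorted_mid => /andP[].
- have EP2 : P = (s1 ++ xa ++ rn :: gap) ++ x1 :: xb by rewrite EP -!catA.
  by move: sP; rewrite EP2 sorted_mid => /andP[].
- by rewrite -ly -[last a t]/(last a P) EP !(last_cat, last_cons).
- move=> u ur; have := hasPn nr u; rewrite EP !(mem_cat, inE) => h.
  by case/or4P => [us|-> //|->|/orP[ug|->]]; rewrite ?orbT //;
    have := h _; rewrite ?us ?ug ?orbT => /(_ isT); rewrite ur.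
Qed.

Lemma frame_in z q : perm_eq (z ++ q) X -> sorted g z -> head a z = x1 -> last a z = head rn xa ->
  size z + (s1 != [::]) <= 2 * k - 1.
Proof.
have [uX _ _ _ _] := framed_tail; have [_ _ _ bound] := fr.
move=> pz sz; have [uz zX] := uniq_part pz uX; apply: bound => // u /zX uX'.
by apply/orP; left.
Qed.

Lemma frame_out (f : E) z q : spare X f -> perm_eq (z ++ q) (inr f :: X) -> sorted g z ->
  head a z = x1 -> last a z = head rn xa -> size z + (s1 != [::]) <= 2 * k - 1.
Proof.
move=> sf; have [uX _ _ _ _] := framed_tail; have [EP _ _ bound] := fr; have /and3P[fP _ _] := sf.
have ufX : uniq (inr f :: X).
  by rewrite cons_uniq uX andbT; apply: contra fP; rewrite EP [_ \in s1 ++ _]mem_cat => ->; rewrite orbT.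
move=> pz sz; have [uz zX] := uniq_part pz ufX; apply: bound => // u /zX.
by rewrite in_cons => /predU1P[->|uX']; apply/orP; [right | left].
Qed.

Lemma out_spare (f : E) : f \in O -> spare X f.
Proof.
move=> fO; have [_ _ _ ly rK] := framed_tail; have [yf fac _] := out_edgesP fO.
apply/and3P; split=> //; first exact: out_notP.
apply/forall_inP => w wf; have KX u : u \in K -> u \in X.
  by rewrite !(mem_cat, in_cons) => /or4P[->|->|->|->]; rewrite ?orbT.
apply: KX; have [->|wy] := eqVneq w y.
  by rewrite -ly !(mem_cat, inE) -in_cons mem_last !orbT.
by apply: rK; [apply/matesP; split=> //; exists f | apply: out_P fO wf].
Qed.

(** From [x1] along the tail to [y], across to [rn], and back to the first reach node: only [gap] is
    skipped. If [rn] is a vertex, the crossing uses an outside edge, which explains the term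
    [isV rn]. *)
Lemma basic : exists z : seq node, [/\ size z + (s1 != [::]) <= 2 * k - 1, uniq z /\ sorted g z,
   head a z = x1 /\ last a z = head rn xa, Vs z = Vs K & #|Es K| + isV rn <= #|Es z|].
Proof.
have [uX sa sb ly _] := framed_tail; have [EP [_ rr] _ _] := fr.
have hr : last a (rn :: rev xa) = head rn xa by case: (xa) => // b xa'; rewrite /= rev_cons last_rcons.
have pr : path g rn (rev xa) by move: sa; rewrite -(sorted_revC gC) rev_rcons.
have uX' : uniq ((x1 :: xb ++ rn :: rev xa) ++ gap).
  by rewrite (perm_uniq (_ : perm_eq _ X)) //; perm_by_count.
case Er: rn => [w|e] in rr hr pr *.
  have [wy [f fO wf]] := matesP _ rr; have [yf _ _] := out_edgesP fO.
  exists ((x1 :: xb) ++ inr f :: inl w :: rev xa).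
  have sz : sorted g ((x1 :: xb) ++ inr f :: inl w :: rev xa).
    by rewrite sorted_mid /= rcons_path ly /= yf wf pr !andbT; exact: sb.
  have hl : last a ((x1 :: xb) ++ inr f :: inl w :: rev xa) = head rn xa.
    by rewrite last_cat Er -hr.
  have fX : inr f \notin X.
    by apply: contra (out_notP fO); rewrite EP [_ \in s1 ++ _]mem_cat => ->; rewrite orbT.
  have pz : perm_eq ((x1 :: xb) ++ inr f :: inl w :: rev xa) (inr f :: xa ++ inl w :: x1 :: xb).
    by perm_by_count.
  have uz : uniq (((x1 :: xb) ++ inr f :: inl w :: rev xa) ++ gap).
    by rewrite (perm_uniq (_ : perm_eq _ (inr f :: X))) ?cons_uniq ?fX // Er; perm_by_count.
  split=> //.
  - by apply: (frame_out (q := gap) (out_spare fO) _ sz _ hl) => //; rewrite Er; perm_by_count.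
  - by split=> //; move: uz; rewrite cat_uniq => /andP[].
  - by rewrite hl Er.
  - by apply/setP => v; rewrite !in_Vs (perm_mem pz) inE.
  - have -> : Es ((x1 :: xb) ++ inr f :: inl w :: rev xa) = f |: Es (xa ++ inl w :: x1 :: xb).
      by apply/setP => v; rewrite in_setU1 !in_Es (perm_mem pz) inE (inj_eq (@inr_inj _ _)).
    rewrite cardsU1 addn1 in_Es (_ : inr f \notin _) //.
    by apply: contra fX; rewrite Er !(mem_cat, inE); case/or3P => [->|//|/orP[]->]; rewrite ?orbT.
exists ((x1 :: xb) ++ inr e :: rev xa).
have sz : sorted g ((x1 :: xb) ++ inr e :: rev xa).
  rewrite sorted_mid pr andbT /= rcons_path ly; apply/andP; split; last exact: rr.
  exact: sb.
have pz : perm_eq ((x1 :: xb) ++ inr e :: rev xa) (xa ++ inr e :: x1 :: xb) by perm_by_count.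
have hl : last a ((x1 :: xb) ++ inr e :: rev xa) = head (inr e) xa by rewrite last_cat -hr.
split=> //.
- apply: (frame_in (q := gap) _ sz) => //; last by rewrite hl Er.
  by rewrite Er; perm_by_count.
- by split=> //; move: uX'; rewrite Er cat_uniq => /andP[].
- by apply/setP => v; rewrite !in_Vs (perm_mem pz).
- by rewrite addn0; apply/subset_leq_card/subsetP => v; rewrite !in_Es (perm_mem pz).
Qed.

Lemma pred_in p1 w u p2 : P = p1 ++ w :: u :: p2 -> u \in K -> u != x1 -> u != head rn xa -> w \in K.
Proof.
have [EP _ _ _] := fr; have [_ _ _ uat _] := best_tail bt => Ew uK u1 u0.
suff [p1' [w' [p2' [Ew' w'K]]]] : exists p1' w' p2', P = p1' ++ w' :: u :: p2' /\ w' \in K.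
  have [wP uP Eu] := consec_index uat Ew; have [w'P _ Eu'] := consec_index uat Ew'.
  by have -> : w = w' by apply: (index_eq wP w'P); move: Eu' Eu => -> [].
move: uK; rewrite -cat_rcons mem_cat => /orP[] /split_index1[b1 [b2 [Eb _ _]]].
  case/lastP: b1 => [|b1 w'] in Eb *; first by case: (xa) Eb u0 => [|b xa'] /= [-> _]; rewrite eqxx.
  exists (s1 ++ b1), w', (b2 ++ gap ++ x1 :: xb); split.
    by rewrite EP -cat_rcons Eb -!cats1 -!catA.
  by rewrite mem_cat Eb cat_rcons mem_cat mem_head orbT.
case/lastP: b1 => [|b1 w'] in Eb *; first by case: Eb u1 => ->; rewrite eqxx.
exists (s1 ++ xa ++ rn :: gap ++ b1), w', b2; split.
  by rewrite EP Eb -!cats1 -!catA /= -!catA.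
by rewrite mem_cat Eb cat_rcons [_ \in b1 ++ _]mem_cat mem_head !orbT.
Qed.

Lemma succ_in p1 u w p2 : P = p1 ++ u :: w :: p2 -> u \in K -> u != rn -> u != inl y -> w \in K.
Proof.
have [EP _ _ _] := fr; have [_ _ _ uat _] := best_tail bt => Ew uK ur uy.
have [_ _ _ ly _] := framed_tail.
suff [p1' [w' [p2' [Ew' w'K]]]] : exists p1' w' p2', P = p1' ++ u :: w' :: p2' /\ w' \in K.
  have [uP wP Eu] := consec_index uat Ew; have [_ w'P Eu'] := consec_index uat Ew'.
  by have -> : w = w' by apply: (index_eq wP w'P); rewrite Eu Eu'.
move: uK; rewrite -cat_rcons mem_cat => /orP[] /split_index1[b1 [[|w' b2] [Eb _ _]]].
- by case/eqP: ur; have := last_rcons rn xa rn; rewrite Eb last_cat.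
- exists (s1 ++ b1), w', (b2 ++ gap ++ x1 :: xb); split.
    by rewrite EP -cat_rcons Eb -!catA.
  by rewrite mem_cat Eb mem_cat !inE eqxx !orbT.
- by case/eqP: uy; rewrite -ly -[last x1 xb]/(last x1 (x1 :: xb)) Eb last_cat.
- exists (s1 ++ xa ++ rn :: gap ++ b1), w', b2; split.
    by rewrite EP Eb -!catA /= -!catA.
  by rewrite mem_cat Eb [_ \in b1 ++ _]mem_cat !inE eqxx !orbT.
Qed.

Lemma tail_edgesP (f : E) : f \in B -> y \in val f /\ inr f \in P.
Proof. by case/setIP; rewrite in_Es inE. Qed.

Lemma edge_nbrs p1 w (f : E) w' p2 : P = p1 ++ w :: inr f :: w' :: p2 -> exists q z,
  [/\ w = inl q, w' = inl z, q \in val f, z \in val f & q != z /\ q != y].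
Proof.
have [_ ly _ uat _] := best_tail bt => Ep; have sP : sorted g P by have [] := best_tail bt.
move: sP; rewrite Ep sorted_mid => /andP[_ /= /and3P[gw gw' _]].
case: w gw Ep => [q|//] qf Ep; case: w' gw' Ep => [z|//] zf Ep; exists q, z; split=> //.
have [_ _ E1] := consec_index uat Ep; rewrite -cat_rcons in Ep.
have [_ zP E2] := consec_index uat Ep; split.
  by apply: contra_eqN E2 => /eqP Eqz; rewrite E1 Eqz; move: (index _ _); clear; lia.
apply: contraL zP => /eqP Eqy; rewrite -index_mem E2 E1 Eqy -ly.
by rewrite (index_last uat) -leqNgt [size _]/= leqW.
Qed.

Lemma tail_split (f : E) : inr f != a -> f \in B -> exists p1 q z p2, P = p1 ++ inl q :: inr f :: inl z :: p2.
Proof.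
move=> fa /tail_edgesP[_]; rewrite inE (negbTE fa) /=.
case/(tail_edge bt) => s [t2 [q [z [Et Eq _ _]]]]; exists (belast a s), q, z, t2.
by rewrite -cat_rcons -Eq -lastI Et.
Qed.

Lemma pick_avoid (F : {set E}) (l : seq node) : size l < #|F| ->
  exists f, f \in F /\ inr f \notin l.
Proof.
move=> lF; have [f fF|h] := pickP [pred f | (f \in F) && (inr f \notin l)].
  by case/andP: fF; exists f.
suff : #|F| <= size l by rewrite leqNgt lF.
have -> : #|F| = size [seq (inr f : node) | f <- enum F] by rewrite size_map -cardE.
apply: uniq_leq_size; first by rewrite map_inj_uniq ?enum_uniq //; exact: inr_inj.
move=> _ /mapP[f + ->]; rewrite mem_enum => fF.
by have := h f; rewrite /= fF => /negbFE.
Qed.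

Lemma mates_K : y |: M \subset Vs K.
Proof.
have [_ _ _ ly rK] := framed_tail; apply/subsetP => w; rewrite in_setU1 in_Vs => /predU1P[->|wM].
  by rewrite -ly !(mem_cat, inE) -in_cons mem_last !orbT.
by apply: rK => //; have [_ [f fO wf]] := matesP _ wM; apply: out_P fO wf.
Qed.

Lemma tail_edges_K : B \subset Es K.
Proof.
have [_ _ _ _ rK] := framed_tail; apply/subsetP => f /tail_edgesP[yf fP].
by rewrite in_Es; apply: rK.
Qed.

(* When [r = 3], no tail edge at [y] has its two other vertices in [M] then. *)
Definition full := forall S : {set T}, S \subset M -> #|S| = r - 1 -> exists2 f, f \in O & val f = y |: S.

Lemma full_no_edge (f : E) q z : r = 3 -> full -> f \in B -> q \in val f -> z \in val f -> q != z ->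
  q \in M -> z \in M -> False.
Proof.
move=> Er fu /tail_edgesP[yf fP] qf zf qz qM zM.
have [||f0 f0O Ef0] := fu [set q; z].
- by rewrite subUset !sub1set qM.
- by rewrite cards2 qz Er.
have Ef : val f = y |: [set q; z].
  apply/eqP; rewrite eq_sym eqEcard (card_edge unif) -Ef0 (card_edge unif) leqnn andbT Ef0.
  by rewrite subUset sub1set yf subUset !sub1set qf.
have Eff : f0 = f by apply: val_inj; rewrite /= Ef0 Ef.
by have := out_notP f0O; rewrite Eff fP.
Qed.

Lemma cycle_not_reach : r = 3 -> reach a -> isV a.
Proof.
case Ea: {2}a => [//|e] /= Er ye; exfalso.
have [/and4P[cy _ _ _] szN _ _] := bt; have [pt ly szt uat dt] := best_tail bt.
have ra : y \in val e by move: ye; rewrite Ea.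
(* The closed tail serves to exclude a degenerate longest cycle, so that [a] has two cycle
   neighbours besides [y] and the first tail vertex. *)
have cyt : ucyc g P by rewrite /ucyc /cycle rcons_path pt ly {1}Ea /= ra; exact: uat.
have gt2 : 2 < size (a :: c).
  by rewrite szN; apply: leq_trans (maxN cyt); rewrite [size _]/= szt ltnW.
have eac : inr e \in a :: c by rewrite Ea mem_head.
have [p [p' [pV p'V pp' [_ _ pe p'e]]]] := edge_ends cy gt2 eac.
have [q [t' Et]] : exists q t', t = inl q :: t'.
  by move: pt szt L3; rewrite Ea; case: (t) => [_ <- //|[q|//] t'] _ _ _; exists q, t'.
have qe : q \in val e by move: pt; rewrite Et Ea => /andP[].
have qac : inl q \notin a :: c by apply: dt; rewrite Et mem_head.
have yac : inl y \notin a :: c by apply: dt; apply: y_tail bt.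
have qy : q != y.
  by apply/eqP => Eqy; have := y_index L3 bt; rewrite Et Eqy /= eqxx; move: L3; clear; lia.
have : #|q |: (y |: [set p; p'])| <= #|val e|.
  apply/subset_leq_card/subsetP => u; rewrite !in_setU1 in_set1.
  by case/or4P => /eqP->.
have notV x z : inl x \notin a :: c -> z \in Vs (a :: c) -> (x == z) = false.
  by move=> xac; rewrite in_Vs => zac; apply/eqP => Exz; rewrite Exz zac in xac.
rewrite (card_edge unif) Er !cardsU1 cards1 !in_setU1 !in_set1 (negbTE pp') (negbTE qy).
by rewrite !notV.
Qed.

(* Except in these two cases the path formed by [x1 :: xb] and the reversal of
   [rcons xa rn] is long enough to close a cycle that is too long. *)
Definition wide := [/\ s1 = [::], isV a, isV x1 & #|Vs K| = k].
Definition crowded := #|M| = k - 1 \/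
  [/\ r = 3, #|M| = k - 2, #|B| = k - 1, ~~ isV rn & full].

Lemma frame_cases : wide /\ crowded.
Proof.
have [z [szz [uz soz] [hz lz] EVz leEz]] := basic.
have [EP [r0 rr] _ _] := fr; have [dO fullO] := out_count.
case: z szz uz soz hz lz EVz leEz => [|x z] szz uz soz hz lz EVz leEz.
  have : y \in Vs K by apply: (subsetP mates_K); rewrite setU11.
  by rewrite -EVz in_Vs.
have Ex : x = x1 by []; have cV := card_Vs uz; have cVE := card_VsEs uz; have cE := card_Es uz.
have hd : s1 = [::] -> head rn xa = a by move=> s10; move: EP; rewrite s10; case: (xa) => [|b xa'] [].
have par : #|Vs K| + 1 = #|Es (x :: z)| + isV x1 + isV (head rn xa).
  have h : count isV z + isV x = count (predC isV) z + isV (last x z) := path_countV (soz : path g x z).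
  have [-> ->] : #|Vs K| = isV x + count isV z /\ #|Es (x :: z)| = ~~ isV x + count (predC isV) z.
    by rewrite -EVz cV cE.
  rewrite -lz -Ex [last a _]/=; move: h; move: (count isV z) (count (predC isV) z) => x2 x3.
  by case: (isV x); case: (isV (last x z)); clear; lia.
have h3 : #|M| < #|Vs K|.
  by apply: leq_trans (subset_leq_card mates_K); rewrite cardsU1 inE eqxx.
have h4 : #|B| + isV rn <= #|Es (x :: z)|.
  by apply: leq_trans leEz; rewrite leq_add2r; apply: subset_leq_card tail_edges_K.
have h6 : #|Vs K| + #|Es (x :: z)| + (s1 != [::]) <= 2 * k - 1 by rewrite -EVz cVE.
have h9 : r = 3 -> (s1 != [::]) = 0 :> nat -> isV (head rn xa) = 1 :> nat.
  move=> Er; case: eqP => // s10 _; rewrite (hd s10) in r0 *.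
  by rewrite (cycle_not_reach Er r0).
have fullB : #|O| = 'C(#|M|, r - 1) -> full by move=> /fullO h S; apply: h.
have := path_count_cases r3 rk tail_count dO h3 h4 par h6 (leq_b1 _) (leq_b1 _) h9.
case=> [[s10 i0 i1 cK cr]|[[Er i01] cM cB cK cO]].
  have {}s10 : s1 = [::] by case: eqP s10.
  rewrite (hd s10) in i0; split; first by split=> //; [case: (isV a) i0|case: (isV x1) i1].
  case: cr => [cM|[Er cM cB rE cO]]; first by left.
  by right; split=> //; [case: (isV rn) rE | apply: fullB].
(* In the remaining outcome all vertices of [K] other than [y] are mates, and [full] forbids a tail
   edge at [y] between two mates. *)
exfalso; have EM : y |: M = Vs K.
  by apply/eqP; rewrite eqEcard mates_K cK cardsU1 inE eqxx cM; move: r3 rk; clear; lia.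
have [_ _ _ uat _] := best_tail bt.
have [b1 [fl [b2 [Ey _]]]] : exists s1 e t2, t = s1 ++ inr e :: inl y :: t2 /\ y \in val e.
  by apply: (tail_before bt (y_tail L3 bt)); rewrite (y_index L3 bt); move: L3; clear; lia.
have {}Ey : P = (a :: b1) ++ inr fl :: inl y :: b2 by rewrite Ey.
have [flP yP Eyl] := consec_index uat Ey.
(* Exactly one end of the frame is an edge here. It is avoided together with [rn] and the edge
   before [y], since their tail neighbours may fall outside [K] or equal [y]. *)
have [f [fB]] : exists f, f \in B /\
    inr f \notin [:: rn; (if isV x1 then head rn xa else x1); inr fl].
  by apply: pick_avoid; rewrite cB; move: r3 rk; rewrite Er /=; clear; lia.
rewrite !in_cons in_nil orbF !negb_or => /and3P[frn fe ffl].
have fx1 : inr f != x1 by case: ifP fe => // x1V _; apply: contraTneq x1V => <-.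
have fx0 : inr f != head rn xa.
  by case: ifP fe i01 => // _ _ /= h0; apply/eqP => Ef; rewrite -Ef in h0.
have [yf fP] := tail_edgesP fB.
have fa : inr f != a by apply/eqP => Ea; have := cycle_not_reach Er; rewrite -Ea => /(_ yf).
have [p1 [q [z' [p2 Ef]]]] := tail_split fa fB.
have fK : inr f \in K by rewrite -in_Es (subsetP tail_edges_K).
have [_ [_ [[<-] [<-] qf zf [qz qy]]]] := edge_nbrs Ef.
have Ef2 : P = rcons p1 (inl q) ++ inr f :: inl z' :: p2 by rewrite cat_rcons.
have zy : z' != y.
  apply: contra ffl => /eqP Ezy; have [_ _ i2] := consec_index uat Ef2.
  rewrite Ezy in i2; have /eqP := etrans (esym i2) Eyl; rewrite eqSS => /eqP.
  by move/(index_eq fP flP) => ->.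
have qM : q \in M.
  have : q \in Vs K by rewrite in_Vs (pred_in Ef).
  by rewrite -EM in_setU1 (negbTE qy).
have zM : z' \in M.
  have : z' \in Vs K by rewrite in_Vs (succ_in Ef2).
  by rewrite -EM in_setU1 (negbTE zy).
exact: full_no_edge Er (fullB cO) fB qf zf qz qM zM.
Qed.

(** In the case [r = 3] a failure makes [q] the only vertex of [K] besides [y] and the mates. By
    [full], every tail edge at [y] other than [rn] and the one before [y] would then have to be the
    edge preceding [q], but there are at least two such edges. *)
Lemma near_mates p1 q (f : E) z p2 : wide -> crowded -> f \in B ->
  P = p1 ++ inl q :: inr f :: inl z :: p2 -> q \in M \/ z \in M.
Proof.
case=> s10 aV x1V cK cr fB Ef; have [EP _ _ _] := fr.
have [yf fP] := tail_edgesP fB; have fK : inr f \in K by rewrite -in_Es (subsetP tail_edges_K).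
have hd : head rn xa = a by move: EP; rewrite s10; case: (xa) => [|b xa'] [].
have fx1 (f' : E) : inr f' != x1 by apply: contraTneq x1V => <-.
have fx0 (f' : E) : inr f' != head rn xa by rewrite hd; apply: contraTneq aV => <-.
have [_ [_ [[<-] [<-] qf zf [qz qy]]]] := edge_nbrs Ef.
have qK : q \in Vs K by rewrite in_Vs (pred_in Ef).
have cyM : #|y |: M| = #|M|.+1 by rewrite cardsU1 inE eqxx.
have [cM|[Er cM cB rE fu]] := cr.
  left; have EM : y |: M = Vs K.
    by apply/eqP; rewrite eqEcard mates_K cK cyM cM; move: r3 rk; clear; lia.
  by move: qK; rewrite -EM in_setU1 (negbTE qy).
have [qM|qM] := boolP (q \in M); [by left | have [zM|zM] := boolP (z \in M); [by right|]].
exfalso.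
have VK v : v \in Vs K -> [\/ v = y, v = q | v \in M].
  have : q |: (y |: M) = Vs K.
    apply/eqP; rewrite eqEcard subUset sub1set qK mates_K cK cardsU1 in_setU1 (negbTE qy) (negbTE qM) cyM cM.
    by move: r3 rk; clear; lia.
  by move=> <-; rewrite !in_setU1 => /or3P[/eqP|/eqP|]; [constructor 2|constructor 1|constructor 3].
have [_ _ _ uat _] := best_tail bt.
have [b1 [fl [b2 [Ey _]]]] : exists s1 e t2, t = s1 ++ inr e :: inl y :: t2 /\ y \in val e.
  by apply: (tail_before bt (y_tail L3 bt)); rewrite (y_index L3 bt); move: L3; clear; lia.
have {}Ey : P = (a :: b1) ++ inr fl :: inl y :: b2 by rewrite Ey.
have [flP yP Eyl] := consec_index uat Ey.
have mid (f' : E) : f' \in B -> inr f' \notin [:: rn; inr fl] -> exists p1 p2 q' z',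
    [/\ P = p1 ++ inl q' :: inr f' :: inl z' :: p2, q' = q \/ z' = q & z' \in Vs K /\ z' != y].
  move=> f'B f'l; have [yf' f'P] := tail_edgesP f'B.
  have f'a : inr f' != a by apply: contraTneq aV => <-.
  have [p1' [q' [z' [p2' Ef']]]] := tail_split f'a f'B.
  have f'K : inr f' \in K by rewrite -in_Es (subsetP tail_edges_K).
  have [_ [_ [[<-] [<-] q'f z'f [qz' qy']]]] := edge_nbrs Ef'.
  move: f'l; rewrite !inE negb_or => /andP[f'r f'fl].
  have Ef'2 : P = rcons p1' (inl q') ++ inr f' :: inl z' :: p2' by rewrite cat_rcons.
  have zy' : z' != y.
    apply: contra f'fl => /eqP Ezy; have [_ _] := consec_index uat Ef'2.
    rewrite Ezy => i3; have /eqP := etrans (esym Eyl) i3; rewrite eqSS => /eqP.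
    by move/(index_eq flP f'P) => ->.
  have q'K : q' \in Vs K by rewrite in_Vs (pred_in Ef').
  have z'K : z' \in Vs K by rewrite in_Vs (succ_in Ef'2).
  exists p1', p2', q', z'; split=> //.
  have [Eq|Eq|q'M] := VK q' q'K; [by rewrite Eq eqxx in qy'|by left|].
  have [Ez|Ez|z'M] := VK z' z'K; [by rewrite Ez eqxx in zy'|by right|].
  by case: (full_no_edge Er fu f'B q'f z'f qz').
have fl0 : inr f \in [:: rn; inr fl].
  apply: contraT => /(mid f fB)[p1' [p2' [q' [z' [Ef' _ [z'K zy']]]]]].
  have [_ _ i1] := consec_index uat Ef.
  have [_ zP i2] := consec_index uat (etrans Ef (esym (cat_rcons _ _ _))).
  have [_ z'P i2'] := consec_index uat (etrans Ef' (esym (cat_rcons _ _ _))).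
  have [Ez] : inl z = inl z' :> node by apply: (index_eq zP z'P); exact: etrans i2 (esym i2').
  have [Ezy|Ezq|] := VK z' z'K; first by rewrite Ezy eqxx in zy'.
    by rewrite Ez Ezq eqxx in qz.
  by rewrite -Ez (negbTE zM).
have uniqf f' p1' q' z' p2' : f' \in B -> P = p1' ++ inl q' :: inr f' :: inl z' :: p2' ->
    inr f' \notin [:: rn; inr fl] -> q' = q \/ z' = q -> (index (inr f' : node) P).+1 = index (inl q : node) P.
  move=> f'B Ef' f'l [Eq|Eq].
    have [qP fP1 i1] := consec_index uat Ef; have [_ f'P i1'] := consec_index uat Ef'.
    have [Eff] : inr f' = inr f :> node.
      by apply: (index_eq f'P fP1); rewrite i1' Eq; exact: esym i1.
    by case/negP: f'l; rewrite Eff; exact: fl0.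
  have [_ _ i2'] := consec_index uat (etrans Ef' (esym (cat_rcons _ _ _))).
  by rewrite -Eq; exact: esym i2'.
have [f1 [f1B f1l]] : exists f1, f1 \in B /\ inr f1 \notin [:: rn; inr fl].
  by apply: pick_avoid; rewrite cB; move: r3 rk; rewrite Er /=; clear; lia.
have [f2 [f2B]] : exists f2, f2 \in B /\ inr f2 \notin [:: inr f1; rn; inr fl].
  by apply: pick_avoid; rewrite cB; move: r3 rk; rewrite Er /=; clear; lia.
rewrite in_cons negb_or => /andP[f21 f2l].
have [p11 [p12 [q1 [z1 [E1 h1 _]]]]] := mid f1 f1B f1l.
have [p21 [p22 [q2 [z2 [E2 h2 _]]]]] := mid f2 f2B f2l.
have i1 := uniqf f1 p11 q1 z1 p12 f1B E1 f1l h1; have i2 := uniqf f2 p21 q2 z2 p22 f2B E2 f2l h2.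
case/negP: f21; apply/eqP; have [_ f1P] := tail_edgesP f1B; have [_ f2P] := tail_edgesP f2B.
apply: (index_eq f2P f1P); have := etrans i2 (esym i1).
by move/eqP; rewrite eqSS => /eqP.
Qed.

Lemma wide_head : wide -> head rn xa = a /\ P = X.
Proof.
case=> s10 _ _ _; have [EP _ _ _] := fr; rewrite s10 in EP; split=> //.
by move: EP; case: (xa) => [|b xa'] [].
Qed.

(** Both ends of a wide frame are vertices, so a path with more than [k] vertices has at least
    [2 * k + 1] nodes. *)
Lemma too_long (f : E) z q w : wide -> spare X f -> perm_eq (z ++ q) (inr f :: X) -> sorted g z ->
  head a z = x1 -> last a z = head rn xa -> Vs K \subset Vs z -> w \in Vs z -> w \notin Vs K -> False.
Proof.
move=> wd sf pz sz hz lz Kz wz wK; have := frame_out sf pz sz hz lz.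
have [hd EP] := wide_head wd; have [s10 aV x1V cK] := wd.
have [uX _ _ _ _] := framed_tail; have [fP _ _] := and3P sf.
have uz : uniq z.
  by have [] := uniq_part pz; rewrite // cons_uniq uX -EP fP.
have : k < #|Vs z|.
  rewrite -cK; apply: leq_trans (_ : #|w |: Vs K| <= _); first by rewrite cardsU1 wK.
  by apply: subset_leq_card; rewrite subUset sub1set wz.
have := card_VsEs uz; rewrite (card_Vs uz) (card_Es uz).
move: sz hz lz; case: (z) => [//|x z'] sz hz lz.
have := path_countV (sz : path g x z').
have -> : last x z' = a by rewrite -hd -lz.
have -> : x = x1 by [].
rewrite aV x1V /= x1V /=; move: (count isV z') (count (predC isV) z') (size z') => n1 n2 n3.
by move: (nat_of_bool _); clear; lia.
Qed.

Lemma tail_of p1 u v p2 : P = p1 ++ u :: v :: p2 -> exists s, t = s ++ v :: p2 /\ last a s = u.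
Proof.
case: p1 => [[<- ->]|b p1 [_ ->]]; first by exists [::].
by exists (rcons p1 u); rewrite cat_rcons last_rcons.
Qed.

(** The predecessor [q] is a mate, so [rot_good] makes [e] good and [no_link] keeps its vertices on
    the tail; outside [K] only the gap is left. *)
Lemma escape p1 q (e : E) p2 w : wide -> y |: M = Vs K -> e \in B -> P = p1 ++ inl q :: inr e :: p2 ->
    inl q \in K -> q != y -> w \in val e -> w \notin Vs K ->
  inl w \in gap /\ exists2 f, f \in O & q \in val f.
Proof.
move=> wd EM eB Ep qK qy we wK; have [ye eP] := tail_edgesP eB.
have qM : q \in M by have := qK; rewrite -in_Vs -EM in_setU1 (negbTE qy).
have [_ [f fO qf]] := matesP _ qM; split; last by exists f.
have [s [Et El]] := tail_of Ep; have [_ EPX] := wide_head wd.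
have ge : @good T H L a c t e.
  by apply: (rot_good maxN maxL bt (ltnW (ltnW L3)) Et ye fO); rewrite El.
have := no_link ge we; rewrite EPX; move: wK; rewrite in_Vs !(mem_cat, in_cons).
by case/norP => /negbTE-> /norP[/negbTE-> /norP[/negbTE-> /negbTE->]]; rewrite /= orbF.
Qed.

(** The summand 1 in the degree is decisive: at most ['C(k - 1, r - 1)] edges at [y] fit into
    [y |: M]. *)
Lemma leaving_edge : y |: M = Vs K -> #|M| = k - 1 ->
  exists e w, [/\ e \in B, w \in val e & w \notin Vs K].
Proof.
move=> EM cM; have [e /andP[eE neM]|h] := pickP [pred e : E | (e \in edges_at y) && ~~ (val e \subset y |: M)].
  have [w we wM] := subsetPn neM; exists e, w; split=> //; last by rewrite -EM.
  have := subsetP edges_split e eE; rewrite in_setU => /orP[eO|//].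
  case/negP: wM; rewrite in_setU1; have [//|wy] := eqVneq w y.
  by apply/matesP; split=> //; exists e.
have yM : y \notin M by rewrite inE eqxx.
have [|h1 _] := @card_thick_thin T H set0 (edges_at y) M y r yM (negbT (in_set0 y)).
  move=> e eE; split; rewrite ?(card_edge unif) //; first by move: eE; rewrite inE.
  by have := h e; rewrite /= eE setU0 => /negbFE.
move: h1; rewrite thick0 thin0 setU0 cards0 addn0 cM card_edges_at -subn1.
by move=> h1; have := leq_trans (mindeg y) h1; rewrite addn1 ltnn.
Qed.

(** If [rn] were a vertex, some tail edge at [y] would lead to a vertex [w] of the gap, and a path
    could visit [w] in addition to [K]. *)
Lemma rn_edge : wide -> crowded -> ~~ isV rn.
Proof.
move=> wd; case=> [cM|[]//]; apply/negP => rnV.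
have [s10 aV x1V cK] := wd; have [hd EP] := wide_head wd.
have [uX sa sb ly rK] := framed_tail; have [_ _ _ uat _] := best_tail bt.
have EM : y |: M = Vs K.
  by apply/eqP; rewrite eqEcard mates_K cK cardsU1 inE eqxx cM; move: r3 rk; clear; lia.
have [e [w [eB we wK]]] := leaving_edge EM cM; have [ye eP] := tail_edgesP eB.
have eK : inr e \in K by rewrite -in_Es (subsetP tail_edges_K).
have sX : sorted g X by rewrite -EP; have [] := best_tail bt.
have ex1 : inr e != x1 by apply: contraTneq x1V => <-.
have exr : inr e != rn by apply: contraTneq rnV => <-.
have exa : inr e != a by apply: contraTneq aV => <-.
have hdr : head rn (rcons xa rn) = a by rewrite -hd; case: (xa).
have splitgap q p1 p2 : P = p1 ++ inl q :: inr e :: p2 -> inl q \in K -> q != y ->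
    exists g1 g2, gap = g1 ++ inl w :: g2 /\ exists2 f, f \in O & q \in val f.
  move=> Ep qK qy; have [/split_index1[g1 [g2 [Eg _ _]]] fq] := escape wd EM eB Ep qK qy we wK.
  by exists g1, g2.
move: eK; rewrite -cat_rcons mem_cat => /orP[] /split_index1[b1 [b2 [Eb _ _]]].
  case/lastP: b1 => [|b1 u] in Eb; first by rewrite -hdr Eb /= eqxx in exa.
  case: b2 => [|u' a2] in Eb; first by case/eqP: exr; rewrite -[rn](last_rcons rn xa rn) Eb last_cat.
  rewrite cat_rcons in Eb.
  have Ep : P = b1 ++ u :: inr e :: u' :: a2 ++ gap ++ x1 :: xb by rewrite EP -cat_rcons Eb -catA.
  have [q [z [Eu Eu' qe ze [qz qy]]]] := edge_nbrs Ep; subst u u'.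
  have qK : inl q \in K by rewrite -cat_rcons Eb !(mem_cat, in_cons) eqxx ?orbT.
  have [g1 [g2 [Eg _]]] := splitgap _ _ _ Ep qK qy.
  have zy : z != y.
    apply/eqP => Ezy; move: uX; rewrite -cat_rcons Eb cat_uniq => /and3P[_ /hasPn/(_ (inl y))].
    have yb : inl y \in x1 :: xb by rewrite -ly mem_last.
    rewrite mem_cat yb orbT => /(_ isT)/negP[]; rewrite Ezy.
    by rewrite mem_cat !in_cons eqxx !orbT.
  have zM : z \in M.
    have : z \in Vs K by rewrite in_Vs -cat_rcons Eb !(mem_cat, in_cons) eqxx ?orbT.
    by rewrite -EM in_setU1 (negbTE zy).
  have [_ [f fO zf]] := matesP _ zM; have [yf _ _] := out_edgesP fO.
  have EX : X = b1 ++ inl q :: inr e :: inl z :: (a2 ++ g1) ++ inl w :: g2 ++ x1 :: xb.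
    by rewrite -EP Ep Eg -!catA.
  move: sX; rewrite EX sorted_mid /= cat_path /= => /and4P[sq _ _ /and3P[pz gw _]].
  (* With [e] before the gap: from [y] through [f] to [z], forward along the tail to [w], and
     through [e] back to [q]. *)
  pose Z := (x1 :: xb) ++ inr f :: inl z :: (a2 ++ g1) ++ inl w :: inr e :: rev (rcons b1 (inl q)).
  have pZ : perm_eq (K ++ inr f :: g1 ++ [:: inl w]) Z.
    by rewrite -cat_rcons Eb /Z rev_rcons; perm_by_count.
  apply: (@too_long f Z g2 w wd (out_spare fO)) => //.
  - by rewrite EX /Z rev_rcons; perm_by_count.
  - rewrite /Z sorted_mid [path _ (inr f) _]/= cat_path [path _ (last _ _) _]/= rev_rcons.
    have sq' : path g (inl q) (rev b1) by move: sq; rewrite -(sorted_revC gC) rev_rcons.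
    by rewrite /= rcons_path ly /= yf pz gw we zf qe sq' !andbT.
  - rewrite /Z !(last_cat, last_cons) rev_rcons last_cons.
    have : head rn (rcons b1 (inl q)) = head rn xa.
      by rewrite hd -hdr Eb; case: (b1).
    by case: (b1) => [|b b1'] //=; rewrite rev_cons last_rcons.
  - by apply/subsetP => v; rewrite !in_Vs => vK; rewrite -(perm_mem pZ) mem_cat vK.
  - by rewrite in_Vs /Z !(mem_cat, in_cons) eqxx ?orbT.
case/lastP: b1 => [|b1 u] in Eb; first by case: Eb ex1 => ->; rewrite eqxx.
case: b2 => [|u' b2] in Eb; first by have := ly; rewrite -[last x1 xb]/(last x1 (x1 :: xb)) Eb last_cat.
rewrite cat_rcons in Eb.
have Ep : P = (xa ++ rn :: gap ++ b1) ++ u :: inr e :: u' :: b2 by rewrite EP Eb -!catA /= -!catA.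
have [q [z [Eu Eu' qe ze [qz qy]]]] := edge_nbrs Ep; subst u u'.
have qK : inl q \in K by rewrite Eb !(mem_cat, in_cons) eqxx ?orbT.
have [g1 [g2 [Eg [f fO qf]]]] := splitgap _ _ _ Ep qK qy; have [yf _ _] := out_edgesP fO.
have EX : X = (xa ++ rn :: g1) ++ inl w :: g2 ++ b1 ++ inl q :: inr e :: inl z :: b2.
  by rewrite Eb Eg -!catA.
move: sX; rewrite EX sorted_mid => /andP[sw _].
move: sb; rewrite Eb sorted_mid /= => /and4P[sq _ _ pz].
have lz : last (inl z) b2 = inl y by rewrite -ly -[last x1 xb]/(last x1 (x1 :: xb)) Eb last_cat.
(* With [e] after the gap: from [q] through [f] to [y], backwards to [z], and through [e] to [w]. *)
pose Z := b1 ++ inl q :: inr f :: rev (inl z :: b2) ++ inr e :: inl w :: rev (xa ++ rn :: g1).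
have pZ : perm_eq (K ++ inr f :: g1 ++ [:: inl w]) Z by rewrite Eb /Z; perm_by_count.
apply: (@too_long f Z g2 w wd (out_spare fO)) => //.
- by rewrite EX /Z; perm_by_count.
- have pf : path g (inr f) (rev (inl z :: b2)).
    by move: (sorted_revC gC (rcons (inl z :: b2) (inr f))); rewrite rev_rcons /= rcons_path pz lz /= yf => ->.
  rewrite /Z sorted_mid sq [path _ (inl q) _]/= qf cat_path pf /= rev_cons last_rcons /= ze we /=.
  by move: sw; rewrite -(sorted_revC gC) rev_rcons.
- by rewrite /Z; move: Eb; case: (b1) => [|b b1'] [->].
- rewrite /Z !(last_cat, last_cons); case: (xa) => [|b xa']; rewrite /= ?rev_cons ?last_rcons //.
- by apply/subsetP => v; rewrite !in_Vs => vK; rewrite -(perm_mem pZ) mem_cat vK.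
- by rewrite in_Vs /Z !(mem_cat, in_cons) eqxx ?orbT.
Qed.

(** Otherwise the path of [basic] runs through all of [P], which has [L + 1 >= 2 * k] nodes. *)
Lemma gap_not_nil : wide -> ~~ isV rn -> gap != [::].
Proof.
move=> wd rE; apply/eqP => g0; have [hd EP] := wide_head wd; have [_ [_ rr] _ _] := fr.
have [uX sa sb ly _] := framed_tail; have [_ _ szt _ _] := best_tail bt.
have pr : path g rn (rev xa) by move: sa; rewrite -(sorted_revC gC) rev_rcons.
have ryr : g (inl y) rn by move: rr rE; case: (rn).
have pz : perm_eq ((x1 :: xb) ++ rn :: rev xa ++ [::]) X by rewrite g0; perm_by_count.
have := @frame_in ((x1 :: xb) ++ rn :: rev xa) [::]; rewrite -catA => /(_ pz).
have -> : sorted g ((x1 :: xb) ++ rn :: rev xa).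
  by rewrite sorted_mid pr andbT /= rcons_path ly ryr andbT; exact: sb.
have -> : last a ((x1 :: xb) ++ rn :: rev xa) = head rn xa.
  by rewrite last_cat last_cons; case: (xa) => [|b xa'] //=; rewrite rev_cons last_rcons.
move=> /(_ isT erefl erefl); rewrite -[_ ++ _]cats0 -catA (perm_size pz) -EP [size P]/= szt.
by move: (nat_of_bool _); move: L2k; clear; lia.
Qed.

(** The rotation about the edge [rn] makes the first node [y'] of the gap the new end. It is outside
    [K], so a spare edge through [q] and [y'] would give a path as in [too_long]. *)
Lemma rotated_end : wide -> crowded -> exists t' y' q e p1 p2,
  [/\ best a c t' y' /\ perm_eq t' t, P =i a :: t', a :: t' = p1 ++ inl q :: inr e :: inl y :: p2,
    [/\ y' \in val e, y' != y & y' \notin M]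
  & forall f : E, spare P f -> q \in val f -> y' \in val f -> False].
Proof.
move=> wd cr; have rE := rn_edge wd cr; have gn := gap_not_nil wd rE.
have [hd EP] := wide_head wd; have [s10 aV x1V cK] := wd; have [_ [_ rr] _ _] := fr.
have [uX sa sb ly _] := framed_tail; have [pt _ _ uat _] := best_tail bt.
case Er: rn rE rr => [//|e] _ /= ye.
case/lastP Ex: xa hd => [|xa2 u] hd; first by rewrite -hd Er in aV.
case Eg: gap gn => [//|u' g2] _.
have Ep : P = xa2 ++ u :: inr e :: u' :: g2 ++ x1 :: xb by rewrite EP Er Ex Eg cat_rcons.
have [q [y' [Eu Eu' qe y'e [qy' qy]]]] := edge_nbrs Ep; subst u u'.
have [s [Et El]] := tail_of Ep.
have gf : g (last a s) (inr e) by rewrite El.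
have [x [t3 [[<- _] _ bt' EV]]] := best_rotate bt Et ye gf (or_introl (erefl _)).
have pt' : perm_eq (s ++ inr e :: rev (inl y' :: g2 ++ x1 :: xb)) t.
  by rewrite Et perm_cat2l perm_cons perm_rev.
have y'K : y' \notin Vs K.
  rewrite in_Vs; move: uX; rewrite Eg (perm_uniq (_ : perm_eq _ (inl y' :: g2 ++ K))) //; last by perm_by_count.
  by rewrite cons_uniq mem_cat negb_or => /andP[/andP[]].
have [p2 Ep2] : exists p2, rev (inl y' :: g2 ++ x1 :: xb) = inl y :: p2.
  rewrite -cat_cons rev_cat lastI ly rev_rcons; eexists; reflexivity.
exists (s ++ inr e :: rev (inl y' :: g2 ++ x1 :: xb)), y', q, e, (belast a s), p2; split=> //.
- by move=> u; rewrite !in_cons (perm_mem pt').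
- by rewrite Ep2 -[in RHS]cat_rcons -El -lastI.
- split=> //; first by apply: contraNneq y'K => ->; rewrite (subsetP mates_K) ?setU11.
  by apply: contra y'K => y'M; rewrite (subsetP mates_K) // setU1r.
move=> f sf qf y'f; rewrite EP in sf.
have sxa : path g (inl q) (rev xa2).
  have : sorted g P := pt; rewrite Ep sorted_mid => /andP[+ _].
  by rewrite -(sorted_revC gC) rev_rcons.
pose Z := (x1 :: xb) ++ inr e :: inl y' :: inr f :: inl q :: rev xa2.
have pZ : perm_eq (K ++ [:: inl y'; inr f]) Z by rewrite Ex Er cat_rcons /Z; perm_by_count.
apply: (@too_long f Z g2 y' wd sf) => //.
- by rewrite Ex Er Eg cat_rcons /Z; perm_by_count.
- by rewrite /Z sorted_mid /= rcons_path ly /= ye y'e y'f qf sxa !andbT; exact: sb.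
- rewrite /Z last_cat !last_cons Ex; case: (xa2) => [|b xa'] //=.
  by rewrite rev_cons last_rcons.
- by apply/subsetP => v; rewrite !in_Vs => vK; rewrite -(perm_mem pZ) mem_cat vK.
- by rewrite in_Vs /Z !(mem_cat, in_cons) eqxx ?orbT.
Qed.

End Framed.



End Frame.
(** After the rotation [e] stands between [q] and [y], so [near_mates] makes one of them a mate of
    [y']. [rotated_end] rules out [q]; being mates is symmetric, and [y'] is no mate of [y]. *)
Lemma long_false a c t y : ~ best a c t y.
Proof.
move=> bt; have [s1 [xa [rn [gap [x1 [xb fr]]]]]] := frame bt.
have [wd cr] := frame_cases bt fr.
have [t' [y' [q [e [p1 [p2 [[bt' pt'] PP' Ep' [y'e y'y y'M] no]]]]]]] := rotated_end bt fr wd cr.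
have [s1' [xa' [rn' [gap' [x1' [xb' fr']]]]]] := frame bt'.
have [wd' cr'] := frame_cases bt' fr'.
have eB : e \in tail_edges a t' y'.
  by rewrite in_setI in_Es Ep' mem_cat !in_cons eqxx !orbT inE y'e.
have outs f : f \in out_edges a c t' y' -> [/\ y' \in val f, inr f \notin a :: c & inr f \notin t].
  by move=> fO; have [h1 h2 h3] := out_edgesP fO; rewrite -(perm_mem pt').
have [] := near_mates bt' fr' wd' cr' eB Ep' => /matesP[_ [f fO qf]]; have [y'f fac ft] := outs f fO.
  apply: (no f) => //; apply/and3P; split=> //; first by rewrite PP' (out_notP fO).
  by apply/forall_inP => w wf; rewrite PP'; apply: out_P fO wf.
case/negP: y'M; apply/matesP; split=> //; exists f => //.
exact: out_edgesI.
Qed.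

End Incidence.

(** * Longest cycles and tails *)

Section Incidence.

Variables (T : finType) (H : {set {set T}}).

Local Notation E := {e : {set T} | e \in H}.
Local Notation node := (T + E)%type.
Local Notation g := (@incidence_graph T H).
Local Notation isV := (@isV T H).
Local Notation Vs := (@Vs T H).
Local Notation gC := (@inc_sym T H).

Lemma longest_ucyc : exists N s, [/\ ucyc g s, size s = N & forall s', ucyc g s' -> size s' <= N].
Proof.
pose Q m := [exists s : m.-tuple node, ucyc g s].
have Q0 : exists m, Q m by exists 0; apply/existsP; exists [tuple].
have QP s : ucyc g s -> Q (size s) by move=> cs; apply/existsP; exists (in_tuple s).
have Qb m : Q m -> m <= #|{: node}|.
  case/existsP => s /andP[_ us]; rewrite -(size_tuple s) -(card_uniqP us).
  exact: max_card.
case: (ex_maxnP Q0 Qb) => N /existsP[s cs] maxN.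
by exists N, s; split; rewrite ?size_tuple // => s' /QP /maxN.
Qed.

Lemma longest_tail N s x : ucyc g s -> size s = N -> inl x \in s -> exists L a c t,
  [/\ lolli g a c t, size (a :: c) = N, isV (last a t), size t = L &
   forall a' c' t', lolli g a' c' t' -> size (a' :: c') = N -> isV (last a' t') -> size t' <= L].
Proof.
move=> cs sz xs.
(* The cycle is stored as a node and an [N.-1]-tuple, so that lollipops range over a finite type. *)
pose Q m := [exists p : node * N.-1.-tuple node, exists t : m.-tuple node,
  [&& lolli g p.1 p.2 t, size (p.1 :: p.2) == N & isV (last p.1 t)]].
have QP a c t : lolli g a c t -> size (a :: c) = N -> isV (last a t) -> Q (size t).
  move=> lol szN lV; have sc : size c = N.-1 by rewrite -szN.
  apply/existsP; exists (a, tcast sc (in_tuple c)); apply/existsP; exists (in_tuple t).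
  by rewrite val_tcast lol lV andbT -[size _]/(size (a :: c)) szN eqxx.
have Q0 : exists m, Q m.
  have [c cc pc] := ucyc_from cs xs; exists 0; apply: (QP (inl x) c [::]) => //.
    by apply/and4P.
  by rewrite (perm_size pc).
have Qb m : Q m -> m <= #|{: node}|.
  case/existsP => p /existsP[t /and3P[/and4P[_ _ ut _] _ _]].
  by rewrite -(size_tuple t) -(card_uniqP ut) max_card.
case: (ex_maxnP Q0 Qb) => L /existsP[[a c] /existsP[t /and3P[lol /eqP szN lV]]] maxL.
exists L, a, c, t; split=> //; first exact: size_tuple.
by move=> a' c' t' h1 h2 h3; apply: maxL (QP _ _ _ h1 h2 h3).
Qed.

(** * Tails of at most two nodes *)

Section Short.

Variables (k r N L : nat).
Hypotheses (r3 : 2 < r) (rk : r <= k - 2) (unif : uniform r H).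
Hypothesis mindeg : forall y, 'C(k - 1, r - 1) + 1 <= degree H y.
Hypothesis maxL : forall (a : node) (c t : seq node), lolli g a c t -> size (a :: c) = N ->
  isV (last a t) -> size t <= L.
Hypothesis conn : forall s x y : node, x != s -> y != s -> connect (delete g [set s]) x y.
Hypothesis L2 : L <= 2.

Lemma tail_le (s : seq node) x (t : seq node) : ucyc g s -> size s = N -> x \in s -> path g x t -> uniq t ->
  {in t, forall u, u \notin s} -> isV (last x t) -> size t <= 2.
Proof.
move=> cs sz xs pt ut dt lV; have [c cc pc] := ucyc_from cs xs; apply: leq_trans L2.
apply: (@maxL x c) => //; last by rewrite (perm_size pc).
by apply/and4P; split=> //; apply/allP => u /dt; rewrite /= (perm_mem pc).
Qed.

(** A vertex [w] of [f] off the cycle would extend any short route from the cycle to [y] to a tail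
    that is too long. Hence no cycle edge contains [y] and no edge at [y] meets a cycle vertex; but
    a path from [y] to the cycle, reversed, is a tail and has length at most two. *)
Lemma short_near (s : seq node) y f : ucyc g s -> size s = N -> 0 < N -> inl y \notin s ->
  f \in off_edges s y -> val f \subset y |: Vs s.
Proof.
move=> cs sz N0 ys /off_edgesP[yf fs]; apply/subsetP => w wf; rewrite in_setU1 in_Vs.
apply/norP => -[wy ws].
have tl := tail_le cs sz.
have [b bs] : exists b, b \in s by move: sz N0; case: (s) => [<- //|b s']; exists b; rewrite mem_head.
have via_edge (e : E) : y \in val e -> inr e \in s -> False.
  move=> ye es; have := tl (inr e) [:: inl y; inr f; inl w] es; rewrite /= ye yf wf !inE /= => h.
  suff : 3 <= 2 by [].
  apply: h => //.
    by rewrite andbT; apply: contra wy => /eqP [->].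
  by move=> u; rewrite !inE => /or3P[] /eqP->.
have via_two (e e' : E) x w' : inl x \in s -> x \in val e -> y \in val e -> inr e \notin s -> inr e' \notin s ->
    e != e' -> y \in val e' -> w' \in val e' -> w' != y -> inl w' \notin s -> False.
  move=> xs xe ye es e's ee' ye' we' w'y w's.
  have := tl (inl x) [:: inr e; inl y; inr e'; inl w'] xs; rewrite /= xe ye ye' we' => h.
  suff : 4 <= 2 by [].
  apply: h => //.
    by rewrite /= !in_cons !in_nil !orbF /= (inj_eq inl_inj) (inj_eq inr_inj) (negbTE ee') eq_sym w'y.
  by move=> u; rewrite !inE => /or4P[] /eqP->.
have [e yf2 fe] : exists2 e : E, y \in val e & e != f.
  have : 1 < #|edges_at H y|.
    rewrite card_edges_at; apply: leq_trans (mindeg y); rewrite addn1 ltnS bin_gt0.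
    by move: r3 rk; clear; lia.
  by case/(two_members f) => e; rewrite inE; exists e.
have es : inr e \notin s by apply/negP; apply: via_edge.
have noV x (e' : E) : y \in val e' -> x \in val e' -> inl x \in s -> False.
  move=> ye' xe' xs; have e's : inr e' \notin s by apply/negP; apply: via_edge.
  have [Ee|ne] := eqVneq e' f; last exact: (via_two e' f x w).
  have [x' /and3P[x'e x'y _]] : exists x', [&& x' \in val e, x' != y & true].
    have : 1 < #|val e| by rewrite (card_edge unif) ltnW.
    by case/(two_members y) => x' ? ?; exists x'; apply/and3P.
  have [x's|x's] := boolP (inl x' \in s); first by apply: (via_two e f x' w).
  by apply: (via_two f e x x') => //; rewrite ?Ee -?Ee // eq_sym Ee.
(* Connectivity is given after deletion of a node; any node other than [b] and [y] can be
   deleted. *)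
have [z zb zy] : exists2 z : node, z != b & z != inl y.
  by exists (inr f) => //; apply: contraNneq fs => ->.
have bz : b != z by rewrite eq_sym.
have yz : inl y != z by rewrite eq_sym.
have [p [/and3P[pp lp bp] up _]] := first_hit (A := mem s) conn yz bs bz.
have lb : {in belast (inl y : node) p, forall u, u \notin s} by move=> u /(allP bp).
have := tl (last (inl y) p) (rev (belast (inl y) p)) lp.
rewrite (path_revE gC) => /(_ pp); rewrite rev_uniq size_rev size_belast.
have -> : uniq (belast (inl y : node) p) by move: up; rewrite lastI rcons_uniq => /andP[].
have hlast : last (last (inl y : node) p) (rev (belast (inl y) p)) = inl y.
  by case: (p) lp ys => [|v q] /=; [move=> -> | rewrite rev_cons last_rcons].
move=> /(_ isT); rewrite hlast => h; have {h} : size p <= 2.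
  by apply: h => // u; rewrite mem_rev => /lb.
case: p pp lp {bp up hlast lb} => [|u [|v [|//]]] /=; first by rewrite (negbTE ys).
  by rewrite andbT; case: u => // e' ye' es' _; apply: via_edge es'.
rewrite andbT; case: u => // e' /andP[ye']; case: v => // x xe' xs _.
exact: noV ye' xe' xs.
Qed.

End Short.

End Incidence.


Theorem theorem1p7 (n k r : nat) (n_gt0 : 0 < n) (k_gt0 : 0 < k) (r_gt0 : 0 < r)
    (hr : 3 <= r) (hrk : r <= k - 2) (hkn : k - 2 <= n - 2)
    (T : finType) (hT : #|T| = n) (H : {set {set T}})
    (hunif : uniform r H) (hconn : k_connected 2 H)
    (hdeg : 'C(k - 1, r - 1) + 1 <= min_degree H) :
  exists (l : nat) (v : 'I_l -> T) (e : 'I_l -> {set T}),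
    minn (2 * k) n <= l /\ berge_cycle H v e.

Proof.
have v0 : T by apply: (@enum_val _ T); apply: (@Ordinal _ 0); rewrite hT.
have mindeg v : 'C(k - 1, r - 1) + 1 <= degree H v.
  by move: hdeg; rewrite (leq_min_degree _ _ v0) => /forallP/(_ v).
have conn (s x y : T + {e : {set T} | e \in H}) : x != s -> y != s ->
    connect (delete (@incidence_graph T H) [set s]) x y.
  move=> xs ys; have /andP[_ /forallP/(_ [set s])] := hconn.
  by rewrite cards1 => /forall_inP/(_ x); rewrite in_setC in_set1 xs => /(_ isT)/forall_inP/(_ y);
    rewrite in_setC in_set1 ys; apply.
have [N [s [cs szs maxN]]] := @longest_ucyc T H.
have szV := ucyc_size cs.
have [long|short] := leqP (minn (2 * k) n) #|Vs s|.
  have [|v [e ve]] := ucyc_berge cs szV; last by exists #|Vs s|, v, e.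
  by apply: leq_trans long; rewrite leq_min n_gt0 muln_gt0 k_gt0.
exfalso; have [sk sn] : #|Vs s| < 2 * k /\ #|Vs s| < n by move: short; rewrite leq_min => /andP[].
have leN : N <= 2 * (2 * k - 1) by rewrite -szs szV; move: sk; clear; lia.
(* A vertex and an edge at it already form a list accepted by [ucyc], so the longest cycle has a
   vertex. *)
have N2 : 1 < N.
  have [e] : exists e, e \in edges_at H v0.
    by apply/card_gt0P; rewrite card_edges_at; apply: leq_trans (mindeg v0); rewrite addn1.
  rewrite inE => ve; apply: (maxN [:: inl v0; inr e]).
  by rewrite /ucyc /= ve.
have [x xs] : exists x, inl x \in s.
  have /card_gt0P[x] : 0 < #|Vs s| by move: szV N2; rewrite szs; case: #|_| => [->|].
  by rewrite in_Vs; exists x.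
have [L [a [c [t [lol szN lV szt maxL]]]]] := longest_tail cs szs xs.
have [L2|L3] := leqP L 2.
  have near s' y f := short_near (s := s') (y := y) (f := f) hr hrk hunif mindeg maxL conn L2.
  have full y : inl y \in s.
    apply: (near_empty hr hrk hunif mindeg maxN leN) cs szs => s' y' f cs' szs' ys'.
    by apply: near => //; apply: ltnW.
  move: sn; rewrite -hT ltnNge => /negP; apply; rewrite -cardsT; apply/subset_leq_card/subsetP => y _.
  by rewrite in_Vs.
case Ey: (last a t) lV => [y|//] _; have bt : best N L a c t y by split.
have [L2k|L2k] := leqP L (2 * k - 2).
  exact: (tight_false hr hrk hunif mindeg maxN leN maxL L3 L2k bt).
exact: (long_false hr hrk hunif mindeg maxN leN maxL L3 L2k conn bt).
Qed.
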